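(* Let $A$ be a commutative ring, let $1\leq n\leq m$, and let $\phi:\mathcal L^n(A)\to\mathcal L^m(A)$ be a continuous homomorphism of $A$-algebras. Then for any differential form $\omega\in\widetilde\Omega^n_{\mathcal L^n(A)}$, there is an equality in $A$ $$\mathrm{res}\left(\phi(\omega)\wedge\frac{dt_{q_1}}{t_{q_1}}\wedge\ldots\wedge\frac{dt_{q_{m-n}}}{t_{q_{m-n}}}\right)=\mathrm{sgn}(\phi)\,d(\phi)\,\mathrm{res}(\omega),$$ where $q_1,\ldots,q_{m-n}$, $\mathrm{sgn}(\phi)$ and $d(\phi)$ are the (locally constant on $\mathrm{Spec}(A)$) data attached to $\phi$ as defined in the context.
   Context: Rings are commutative, associative and unital. For $n\geq 1$, $\mathcal L^n(A)=A((t_1))\ldots((t_n))$ is the ring of iterated Laurent series (inductively $\mathcal L^1(A)=A((t_1))$, $\mathcal L^n(A)=\mathcal L^{n-1}(A)((t_n))$). Elements are written $f=\sum_{l\in\mathbb Z^n}a_lt^l$ with $t^l=t_1^{l_1}\cdots t_n^{l_n}$, and $\mathrm{supp}(f)=\{l: a_l\neq 0\}$. Put $\Lambda_1=\mathbb Z$, $\mathbb Z^1_\lambda=\{l\in\mathbb Z: l\geq\lambda\}$, and for $n\geq 2$ put $\Lambda_n=\mathrm{Map}(\mathbb Z,\Lambda_{n-1})\times\mathbb Z$ and $\mathbb Z^n_\lambda=\bigcup_{l_n\geq\lambda_n}\mathbb Z^{n-1}_{\lambda'(l_n)}\times\{l_n\}$ for $\lambda=(\lambda',\lambda_n)\in\Lambda_n$.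 A formal series lies in $\mathcal L^n(A)$ iff its support is contained in $\mathbb Z^n_\lambda$ for some $\lambda\in\Lambda_n$. Topology: $\mathcal L^n(A)$ is an additive topological group with a base of open neighborhoods of zero given by the $A$-submodules $U_\lambda=\{f:\mathrm{supp}(f)\cap(-\mathbb Z^n_\lambda)=\varnothing\}$, $\lambda\in\Lambda_n$. $\underline{\mathbb Z}(A)$ is the ring of locally constant functions $\mathrm{Spec}(A)\to\mathbb Z$; it maps naturally to $A$ (a function with values $c_i$ on the factors of a finite decomposition $A\simeq\prod_iA_i$ goes to $(c_i\cdot 1)_i$), and elements of $\underline{\mathbb Z}(A)$ act on $A$ through this map. The lexicographical order on $\mathbb Z^n$ compares the last coordinates first: $(l_1,\ldots,l_n)\leq(l_1',\ldots,l_n')$ iff $l_n<l'_n$, or $l_n=l_n'$ and $(l_1,\ldots,l_{n-1})\leq(l'_1,\ldots,l'_{n-1})$. For $f\in\mathcal L^n(A)^*$ it is known that there is a finite decomposition $A\simeq\prod_i A_i$ and elements $l_i\in\mathbb Z^n$ such that the component $\sum_l a_{i,l}t^l\in\mathcal L^n(A_i)$ of $f$ has $a_{i,l}$ nilpotent for all $l<l_i$ and $a_{i,l_i}$ invertible; then $\nu(f)\in\underline{\mathbb Z}(A)^n$ is the locally constant function with value $l_i$ on $\mathrm{Spec}(A_i)$, and $\nu:\mathcal L^n(A)^*\to\underline{\mathbb Z}(A)^n$ is a group homomorphism. Elements of $\underline{\mathbb Z}(A)^n$ are viewed as columns. For a continuous $A$-algebra homomorphism $\phi:\mathcal L^n(A)\to\mathcal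 L^m(A)$, $\Upsilon(\phi)$ is the $(m\times n)$-matrix $(x_{ji})$ over $\underline{\mathbb Z}(A)$ with columns $\nu(\phi(t_1)),\ldots,\nu(\phi(t_n))$. It is known that, at every point of $\mathrm{Spec}(A)$, this matrix is in column echelon form with positive leading entries: there are $1\leq p_1<\ldots<p_n\leq m$ in $\underline{\mathbb Z}(A)$ with $x_{p_i,i}>0$ and $x_{j,i}=0$ for $j>p_i$ (pointwise on $\mathrm{Spec}(A)$); in particular $n\leq m$ when $A\neq 0$. Let $1\leq q_1<\ldots<q_{m-n}\leq m$ be the elements of $\underline{\mathbb Z}(A)$ complementary to $p_1,\ldots,p_n$ pointwise, i.e. $\{1,\ldots,m\}=\{p_1,\ldots,p_n\}\sqcup\{q_1,\ldots,q_{m-n}\}$ at each point. $\mathrm{sgn}(\phi)\in\underline{\mathbb Z}(A)$ is the sign of the (locally constant) permutation sending $(1,2,\ldots,m)$ to $(p_1,\ldots,p_n,q_1,\ldots,q_{m-n})$, and $d(\phi)=\prod_{i=1}^n x_{p_i,i}\in\underline{\mathbb Z}(A)$. Expressions such as $t_{q_j}$ with $q_j$ locally constant are understood componentwise over a finite decomposition of $A$ on whose factors the $q_j$ are constant. $\widetilde\Omega^1_{\mathcal L^n(A)}$ is the quotient of the module of absolute Kähler differentials of $\mathcal L^n(A)$ by the $\mathcal L^n(A)$-submodule generated by all $df-\sum_{i=1}^n\frac{\partial f}{\partial t_i}dt_i$; it is free of rank $n$ with basis $dt_1,\ldots,dt_n$. $\widetilde\Omega^i_{\mathcal L^n(A)}=\bigwedge^i_{\mathcal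 L^n(A)}\widetilde\Omega^1_{\mathcal L^n(A)}$. The residue map $\mathrm{res}:\widetilde\Omega^n_{\mathcal L^n(A)}\to A$ is the $A$-linear map $\sum_l a_lt^l\,dt_1\wedge\ldots\wedge dt_n\mapsto a_{-1\ldots-1}$ (and similarly $\mathrm{res}:\widetilde\Omega^m_{\mathcal L^m(A)}\to A$). $\phi$ also denotes the induced additive maps $\widetilde\Omega^i_{\mathcal L^n(A)}\to\widetilde\Omega^i_{\mathcal L^m(A)}$, $f\,dt_{j_1}\wedge\ldots\wedge dt_{j_i}\mapsto\phi(f)\,d\phi(t_{j_1})\wedge\ldots\wedge d\phi(t_{j_i})$. *)

(* Defs.v *)
From HB Require Import structures.
From mathcomp Require Import fingroup perm all_boot all_order all_algebra.
From mathcomp Require Import all_classical.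
From mathcomp Require Import zify ring.
Set Implicit Arguments.
Unset Strict Implicit.
Unset Printing Implicit Defensive.
Import Order.TTheory GRing.Theory Num.Theory.
Local Open Scope classical_set_scope.
Local Open Scope ring_scope.

Section LaurentSeries.
Variable R : comPzRingType.

Record laurent := MkLaurent {
  lcoef :> int -> R;
  lcoef_bounded : exists N : int, forall k, k < N -> lcoef k = 0 }.

Lemma laurentP (f g : laurent) : lcoef f =1 lcoef g -> f = g.
Proof.
case: f g => [f hf] [g hg] /= /funext fg; case: _ / fg in hg *.
by congr MkLaurent; exact: Prop_irrelevance.
Qed.

HB.instance Definition _ := gen_eqMixin laurent.
HB.instance Definition _ := gen_choiceMixin laurent.

Lemma laurent0_bounded : exists N : int, forall k : int, k < N -> 0 = 0 :> R.
Proof. by exists 0. Qed.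
Definition laurent0 := MkLaurent laurent0_bounded.

Lemma laurentN_bounded (f : laurent) :
  exists N : int, forall k, k < N -> - f k = 0.
Proof. by case: f => f [N hN]; exists N => k /hN /= ->; rewrite oppr0. Qed.
Definition laurentN f := MkLaurent (laurentN_bounded f).

Lemma laurentD_bounded (f g : laurent) :
  exists N : int, forall k, k < N -> f k + g k = 0.
Proof.
case: f g => [f [N hN]] [g [M hM]] /=; exists (Num.min N M) => k.
by rewrite lt_min => /andP[/hN -> /hM ->]; rewrite addr0.
Qed.
Definition laurentD f g := MkLaurent (laurentD_bounded f g).

Lemma laurentDA : associative laurentD.
Proof. by move=> f g h; apply: laurentP => k /=; rewrite addrA. Qed.
Lemma laurentDC : commutative laurentD.
Proof. by move=> f g; apply: laurentP => k /=; rewrite addrC. Qed.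
Lemma laurentD0 : left_id laurent0 laurentD.
Proof. by move=> f; apply: laurentP => k /=; rewrite add0r. Qed.
Lemma laurentDN : left_inverse laurent0 laurentN laurentD.
Proof. by move=> f; apply: laurentP => k /=; rewrite addNr. Qed.

HB.instance Definition _ :=
  GRing.isZmodule.Build laurent laurentDA laurentDC laurentD0 laurentDN.

Lemma lcoef0 k : (0 : laurent) k = 0. Proof. by []. Qed.
Lemma lcoefD (f g : laurent) k : (f + g) k = f k + g k. Proof. by []. Qed.
Lemma lcoefN (f : laurent) k : (- f) k = - f k. Proof. by []. Qed.

(* The sum has finite support for Laurent series f and g, see [lconvE]. *)
Definition lconv (f g : int -> R) (k : int) : R :=
  \sum_(i \in [set: int]) f i * g (k - i).

Lemma lconvE (f g : int -> R) (a b k : int) (n : nat) :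
  (forall i, i < a -> f i = 0) -> (forall i, i < b -> g i = 0) ->
  k < a + b + n%:Z ->
  lconv f g k = \sum_(i < n) f (a + i%:Z) * g (k - (a + i%:Z)).
Proof.
move=> fa gb kn; pose r := [seq a + i%:Z | i <- iota 0 n].
have ur : uniq r by rewrite map_inj_uniq ?iota_uniq// => i j /addrI [].
rewrite /lconv -(fsbig_widen [set` r])//.
  by rewrite -fsbig_seq// big_map -{1}(subn0 n) big_mkord.
move=> i [_ /= ir]; have [ia|ai] := ltP i a; first by rewrite fa// mul0r.
rewrite gb ?mulr0//; have [//|h] := ltP (k - i) b; exfalso; apply: ir.
apply/mapP; exists (absz (i - a)%R); last by lia.
by rewrite mem_iota; lia.
Qed.

Lemma laurentM_bounded (f g : laurent) :
  exists N : int, forall k, k < N -> lconv f g k = 0.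
Proof.
case: f g => [f [a fa]] [g [b gb]] /=; exists (a + b) => k kab.
by rewrite (@lconvE _ _ a b k 0) ?big_ord0// addr0.
Qed.
Definition laurentM f g := MkLaurent (laurentM_bounded f g).

Lemma lmono_bounded (j : int) (c : R) :
  exists N : int, forall k, k < N -> (if k == j then c else 0) = 0.
Proof. by exists j => k kj; rewrite lt_eqF. Qed.
Definition lmono j c := MkLaurent (lmono_bounded j c).

Lemma laurentMC : commutative laurentM.
Proof.
move=> f g; apply: laurentP => k /=.
case: f g => [f [a fa]] [g [b gb]] /=.
pose n := (absz (k - a - b)%R).+1.
have kn : k < a + b + n%:Z by rewrite /n; lia.
rewrite (lconvE fa gb kn) (@lconvE g f b a k n) 1?(addrC b)//.
pose c (i : nat) := f (a + i%:Z) * g (k - (a + i%:Z)).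
have [kab|kab] := ltP k (a + b).
  rewrite !big1// => i _; first by rewrite mulrC fa ?mul0r//; lia.
  by rewrite mulrC gb ?mul0r//; lia.
rewrite (reindex_inj rev_ord_inj) /=; apply: eq_bigr => i _.
rewrite mulrC; congr (_ * _); [congr (g _) | congr (f _)]; rewrite /n; have := ltn_ord i; rewrite /n; lia.
Qed.

Lemma laurentMA : associative laurentM.
Proof.
move=> f g h; apply: laurentP => k /=.
case: f g h => [f [a fa]] [g [b gb]] [h [c hc]] /=.
pose n := (absz (k - a - b - c)%R).+1.
have kn : k < a + b + c + n%:Z by rewrite /n; lia.
have gh0 i : i < b + c -> lconv g h i = 0.
  by move=> ?; rewrite (@lconvE g h b c _ 0) ?big_ord0// addr0.
have fg0 i : i < a + b -> lconv f g i = 0.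
  by move=> ?; rewrite (@lconvE f g a b _ 0) ?big_ord0// addr0.
rewrite (@lconvE f _ a (b + c) k n)// ?addrA//.
rewrite (@lconvE _ h (a + b) c k n)//.
have ghE (i : 'I_n) := @lconvE g h b c (k - (a + i%:Z)) n gb hc.
have fgE (i : 'I_n) := @lconvE f g a b (a + b + i%:Z) n fa gb.
under eq_bigr => i _ do [rewrite ghE ?mulr_sumr; last by lia].
under [RHS]eq_bigr => i _ do
  [rewrite fgE ?mulr_suml; last by have := ltn_ord i; lia].
rewrite [RHS]exchange_big /=; apply: eq_bigr => i _.
under [RHS]eq_bigr => j _ do rewrite -mulrA.
rewrite -!mulr_sumr; congr (_ * _).
rewrite -(big_mkord xpredT
  (fun j => g (b + j%:Z) * h (k - (a + i%:Z) - (b + j%:Z)))).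
rewrite -(big_mkord xpredT
  (fun j => g (a + b + j%:Z - (a + i%:Z)) * h (k - (a + b + j%:Z)))).
have hi : (i <= n)%N by rewrite ltnW.
rewrite [RHS](big_cat_nat _ hi)//= [X in _ = X + _]big_nat.
rewrite [X in _ = X + _]big1 ?add0r; last first.
  by move=> j /andP[_ ji]; rewrite gb ?mul0r//; lia.
rewrite (big_cat_nat _ (leq_subr i n))//= [X in _ + X]big_nat.
rewrite [X in _ + X]big1 ?addr0; last first.
  by move=> j /andP[ji jn]; rewrite hc ?mulr0//; move: ji jn kn; lia.
rewrite (_ : \sum_(i <= j < n) _ = \sum_(0 + i <= j < n) g (a + b + j%:Z - (a + i%:Z)) * h (k - (a + b + j%:Z)))// big_addn.
apply: eq_bigr => j _; congr (g _ * h _); lia.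
Qed.

Lemma laurentM1 : left_id (lmono 0 1) laurentM.
Proof.
move=> f; apply: laurentP => k /=; rewrite /lconv.
rewrite -(fsbig_widen [set 0])//; last first.
  by move=> i [_ /= /eqP/negPf ->]; rewrite mul0r.
by rewrite fsbig_set1 /= mul1r subr0.
Qed.

Lemma laurentMD : left_distributive laurentM laurentD.
Proof.
move=> f g h; apply: laurentP => k /=.
case: f g h => [f [a fa]] [g [b gb]] [h [c hc]] /=.
pose d := Num.min a b; pose n := (absz (k - d - c)%R).+1.
have fd i : i < d -> f i = 0 by rewrite lt_min => /andP[/fa].
have gd i : i < d -> g i = 0 by rewrite lt_min => /andP[_ /gb].
have kn : k < d + c + n%:Z by rewrite /n; lia.
rewrite (lconvE fd hc kn) (lconvE gd hc kn) (@lconvE _ h d c k n)//.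
  by rewrite -big_split; apply: eq_bigr => i _; rewrite mulrDl.
by move=> i id /=; rewrite fd// gd// addr0.
Qed.

HB.instance Definition _ := GRing.Zmodule_isComPzRing.Build laurent
  laurentMA laurentMC laurentM1 laurentMD.

Lemma lcoefM (f g : laurent) k :
  (f * g) k = \sum_(i \in [set: int]) f i * g (k - i).
Proof. by []. Qed.

End LaurentSeries.

Definition lmap_fun (R S : comPzRingType) (h : {additive R -> S})
  (f : laurent R) (k : int) : S := h (f k).

Lemma lmap_bounded (R S : comPzRingType) (h : {additive R -> S})
  (f : laurent R) : exists N : int, forall k, k < N -> lmap_fun h f k = 0.
Proof.
by case: f => f [N fN]; exists N => k /fN fk; rewrite /lmap_fun /= fk raddf0.
Qed.

Definition lmap (R S : comPzRingType) (h : {additive R -> S}) (f : laurent R) :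
  laurent S := MkLaurent (lmap_bounded h f).

Lemma lmap_additive (R S : comPzRingType) (h : {additive R -> S}) :
  zmod_morphism (lmap h).
Proof. by move=> f g; apply: laurentP => k; rewrite /= /lmap_fun raddfB. Qed.

HB.instance Definition _ (R S : comPzRingType) (h : {additive R -> S}) :=
  GRing.isZmodMorphism.Build (laurent R) (laurent S) (lmap h) (lmap_additive h).

Lemma lderiv_bounded (R : comPzRingType) (f : laurent R) :
  exists N : int, forall k, k < N -> f (k + 1) *~ (k + 1) = 0.
Proof.
case: f => f [N fN]; exists (N - 1) => k kN /=.
by rewrite fN ?mul0rz// -ltrBrDr.
Qed.

Definition lderiv (R : comPzRingType) (f : laurent R) : laurent R :=
  MkLaurent (lderiv_bounded f).

Lemma lderiv_additive (R : comPzRingType) : zmod_morphism (@lderiv R).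
Proof. by move=> f g; apply: laurentP => k; rewrite /= mulrzBl. Qed.

HB.instance Definition _ (R : comPzRingType) :=
  GRing.isZmodMorphism.Build (laurent R) (laurent R) (@lderiv R)
    (@lderiv_additive R).

(* A((t_1))...((t_n)); the variable t_n, of index [ord_max], is the outermost
   one, and [iterL 0 A] is A.  Variables are numbered from 0. *)
Fixpoint iterL (n : nat) (A : comPzRingType) : comPzRingType :=
  if n is k.+1 then laurent (iterL k A) else A.

(* Elements of Z^n are columns; [row' ord_max l] forgets the last coordinate. *)
Fixpoint coefL (n : nat) (A : comPzRingType) :
    iterL n A -> 'cV[int]_n -> A :=
  match n with
  | 0 => fun f _ => f
  | k.+1 => fun (f : laurent (iterL k A)) l =>
      coefL (f (l ord_max 0)) (row' ord_max l)
  end.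

(* a t^l *)
Fixpoint monoL (n : nat) (A : comPzRingType) :
    'cV[int]_n -> A -> iterL n A :=
  match n with
  | 0 => fun _ a => a
  | k.+1 => fun l a => lmono (l ord_max 0) (monoL (row' ord_max l) a)
  end.

Definition constL (n : nat) (A : comPzRingType) (a : A) : iterL n A := monoL 0 a.

Definition tvar (n : nat) (A : comPzRingType) (i : 'I_n) : iterL n A :=
  monoL (delta_mx i 0) 1.

Definition tvarV (n : nat) (A : comPzRingType) (i : 'I_n) : iterL n A :=
  monoL (- delta_mx i 0) 1.

Fixpoint pderiv (n : nat) (A : comPzRingType) :
    'I_n -> {additive iterL n A -> iterL n A} :=
  match n return 'I_n -> {additive iterL n A -> iterL n A} with
  | 0 => fun _ => idfun
  | k.+1 => fun i =>
      if unlift ord_max i is Some j then lmap (pderiv A j)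
      else @lderiv (iterL k A)
  end.

Definition suppL (n : nat) (A : comPzRingType) (f : iterL n A) :
  set 'cV[int]_n := [set l | coefL f l != 0].

(* Lambda_n, with Lambda_0 a point: then Lambda_1 = Map(Z, Lambda_0) * Z is Z
   and [Zlam] below is {l | lambda <= l} for n = 1. *)
Fixpoint Lam (n : nat) : Type :=
  if n is k.+1 then ((int -> Lam k) * int)%type else unit.

Fixpoint Zlam (n : nat) : Lam n -> set 'cV[int]_n :=
  match n return Lam n -> set 'cV[int]_n with
  | 0 => fun _ => setT
  | k.+1 => fun lam : (int -> Lam k) * int => [set l : 'cV[int]_k.+1 | lam.2 <= l ord_max 0 /\
      Zlam (lam.1 (l ord_max 0)) (row' ord_max l)]
  end.

Definition Unbhs (n : nat) (A : comPzRingType) (lam : Lam n) :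
    set (iterL n A) :=
  [set f | suppL f `&` [set l | Zlam lam (- l)] = set0].

Definition continuousL (n m : nat) (A : comPzRingType)
    (phi : iterL n A -> iterL m A) : Prop :=
  forall f (lam : Lam m), exists mu : Lam n,
    forall g, Unbhs mu (g - f) -> Unbhs lam (phi g - phi f).

Fixpoint lexle (n : nat) : 'cV[int]_n -> 'cV[int]_n -> Prop :=
  match n with
  | 0 => fun _ _ => True
  | k.+1 => fun l l' => l ord_max 0 < l' ord_max 0 \/
      (l ord_max 0 = l' ord_max 0 /\ lexle (row' ord_max l) (row' ord_max l'))
  end.

Definition lexlt (n : nat) (l l' : 'cV[int]_n) : Prop := lexle l l' /\ l <> l'.

Section Spectrum.
Variable A : comPzRingType.

Record Spec := MkSpec {
  prime_set :> A -> Prop;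
  spec0 : prime_set 0;
  specD : forall a b, prime_set a -> prime_set b -> prime_set (a + b);
  specM : forall a b, prime_set b -> prime_set (a * b);
  spec1 : ~ prime_set 1;
  specP : forall a b, prime_set (a * b) -> prime_set a \/ prime_set b }.

(* The sets {y | ~ y a} are the basic open sets of the Zariski topology. *)
Definition locally_constant (X : Type) (F : Spec -> X) : Prop :=
  forall x : Spec, exists a : A,
    ~ x a /\ forall y : Spec, ~ y a -> F y = F x.

Record lcfun (X : Type) := MkLcfun {
  lcval :> Spec -> X;
  lcvalP : locally_constant lcval }.

HB.instance Definition _ (X : Type) := gen_eqMixin (lcfun X).
HB.instance Definition _ (X : Type) := gen_choiceMixin (lcfun X).

Lemma lc_const_subproof (X : Type) (c : X) :
  locally_constant (fun _ : Spec => c).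
Proof. by move=> x; exists 1; split=> //; exact: spec1. Qed.
Definition lc_const (X : Type) (c : X) := MkLcfun (lc_const_subproof c).

Lemma lc_map_subproof (X Y : Type) (h : X -> Y) (F : lcfun X) :
  locally_constant (fun x => h (F x)).
Proof. by move=> x; have [a [xa Fa]] := lcvalP F x; exists a; split=> // y /Fa ->. Qed.
Definition lc_map (X Y : Type) (h : X -> Y) (F : lcfun X) :=
  MkLcfun (lc_map_subproof h F).

Lemma lc_prod_subproof (I : finType) (X : Type) (F : I -> lcfun X) :
  locally_constant (fun x i => F i x).
Proof.
move=> x; have /choice[a aP] i := lcvalP (F i) x.
exists (\prod_i a i); split.
  apply: (big_ind (fun b => ~ x b)) => [|b c xb xc|i _]; first exact: spec1.
    by case/specP.
  by have [] := aP i.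
move=> y ya; apply/funext => i; have [_] := aP i; apply=> yi; apply: ya.
by rewrite (bigD1 i)//= mulrC; exact: specM.
Qed.
Definition lc_prod (I : finType) (X : Type) (F : I -> lcfun X) :
  lcfun (I -> X) := MkLcfun (lc_prod_subproof F).

(* A decomposition of A as a product of rings A_i is given by complete
   orthogonal idempotents e_i; then A_i = e_i A is a quotient of A by
   multiplication by e_i, and Spec(A_i) is {x | ~ x (e_i)}. *)
Record decomposition := MkDecomposition {
  dec_size : nat;
  dec_idem :> 'I_dec_size -> A;
  dec_orth : forall i j, i != j -> dec_idem i * dec_idem j = 0;
  dec_sum : \sum_i dec_idem i = 1 }.

(* The element of V with component F(x) over Spec(A_i), x in Spec(A_i), where A
   decomposes as the product of rings A_i on which F is constant.  The group V
   is acted on by A via [act]. *)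
Definition lc_glue (V : zmodType) (act : A -> V -> V) (F : lcfun V) : V :=
  xget 0 [set v | exists (e : decomposition) (w : 'I_(dec_size e) -> V),
    (forall i (x : Spec), ~ x (e i) -> F x = w i) /\
    v = \sum_i act (e i) (w i)].

Definition ZtoA (c : lcfun int) : A :=
  lc_glue *%R (lc_map (fun k : int => k%:~R) c).

Definition is_nu (n : nat) (f : iterL n A) (c : lcfun 'cV[int]_n) : Prop :=
  exists (e : decomposition) (l : 'I_(dec_size e) -> 'cV[int]_n), forall i,
    [/\ forall l', lexlt l' (l i) -> exists N, (e i * coefL f l') ^+ N = 0,
        exists b, (e i * coefL f (l i)) * (e i * b) = e i
      & forall x : Spec, ~ x (e i) -> c x = l i].

(* Well defined by [nu_unique]; the default value is for non-units f. *)
Definition nu (n : nat) (f : iterL n A) : lcfun 'cV[int]_n :=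
  xget (lc_const 0) [set c | is_nu f c].

End Spectrum.

Definition Upsilon (n m : nat) (A : comPzRingType)
    (phi : iterL n A -> iterL m A) : lcfun A 'M[int]_(m, n) :=
  lc_map (fun c : 'I_n -> 'cV[int]_m => \matrix_(j, i) c i j 0)
    (lc_prod (fun i => nu (phi (tvar A i)))).

Definition increasing (n m : nat) (p : 'I_n -> 'I_m) : bool :=
  [forall i : 'I_n, forall j : 'I_n, (i < j)%N ==> (p i < p j)%N].

(* The positions of the leading entries of a matrix in column echelon form; the
   default value is immaterial, but its type requires n <= m. *)
Definition pivots (n m : nat) (hnm : (n <= m)%N) (M : 'M[int]_(m, n)) :
    {ffun 'I_n -> 'I_m} :=
  odflt [ffun i => widen_ord hnm i]
    [pick p : {ffun 'I_n -> 'I_m} | [&& increasing p,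
      [forall i, 0 < M (p i) i] &
      [forall i, forall j : 'I_m, (p i < j)%N ==> (M j i == 0)]]].

Definition complement (n m : nat) (p : 'I_n -> 'I_m) :
    {ffun 'I_(m - n) -> 'I_m} :=
  odflt [ffun j => widen_ord (leq_subr n m) j]
    [pick q : {ffun 'I_(m - n) -> 'I_m} |
      increasing q && [forall i, forall j, p i != q j]].

Definition join_fun (T : Type) (k l m : nat) (h : (k + l)%N = m)
    (u : 'I_k -> T) (v : 'I_l -> T) (i : 'I_m) : T :=
  match fintype.split (cast_ord (esym h) i) with inl a => u a | inr b => v b end.

(* The permutation sending (1, ..., m) to (p_1, ..., p_n, q_1, ..., q_(m-n)). *)
Definition shuffle (n m : nat) (hnm : (n <= m)%N) (p : 'I_n -> 'I_m) :
    {perm 'I_m} :=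
  insubd (perm_one 'I_m) [ffun i => join_fun (subnKC hnm) p (complement p) i].

Section Invariants.
Variables (n m : nat) (hnm : (n <= m)%N) (A : comPzRingType).
Variable phi : iterL n A -> iterL m A.

Definition piv : lcfun A {ffun 'I_n -> 'I_m} :=
  lc_map (pivots hnm) (Upsilon phi).

Definition cpiv : lcfun A {ffun 'I_(m - n) -> 'I_m} :=
  lc_map (fun p : {ffun 'I_n -> 'I_m} => complement p) piv.

Definition sgn_phi : lcfun A int :=
  lc_map (fun p : {ffun 'I_n -> 'I_m} => (-1) ^+ odd_perm (shuffle hnm p)) piv.

Definition d_phi : lcfun A int :=
  lc_map (fun M : 'M[int]_(m, n) => \prod_i M (pivots hnm M i) i)
    (Upsilon phi).

End Invariants.

(* The R-module with generators X and relations rel: terms in the language of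
   R-modules, modulo the congruence generated by the module laws and rel. *)
Section Presentation.
Variables (R : pzRingType) (X : Type).

Inductive mterm :=
  | Gen of X
  | Zero
  | Add of mterm & mterm
  | Opp of mterm
  | Scale of R & mterm.

HB.instance Definition _ := gen_eqMixin mterm.
HB.instance Definition _ := gen_choiceMixin mterm.

Variable rel : mterm -> mterm -> Prop.

Inductive mcong : mterm -> mterm -> Prop :=
  | cong_rel s t : rel s t -> mcong s t
  | cong_refl s : mcong s s
  | cong_sym s t : mcong s t -> mcong t s
  | cong_trans s t u : mcong s t -> mcong t u -> mcong s u
  | cong_Add s s' t t' : mcong s s' -> mcong t t' -> mcong (Add s t) (Add s' t')
  | cong_Opp s s' : mcong s s' -> mcong (Opp s) (Opp s')
  | cong_Scale a s s' : mcong s s' -> mcong (Scale a s) (Scale a s')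
  | cong_addA s t u : mcong (Add s (Add t u)) (Add (Add s t) u)
  | cong_addC s t : mcong (Add s t) (Add t s)
  | cong_add0 s : mcong (Add Zero s) s
  | cong_addN s : mcong (Add (Opp s) s) Zero
  | cong_scaleA a b s : mcong (Scale a (Scale b s)) (Scale (a * b) s)
  | cong_scale1 s : mcong (Scale 1 s) s
  | cong_scaleDr a s t : mcong (Scale a (Add s t)) (Add (Scale a s) (Scale a t))
  | cong_scaleDl a b s : mcong (Scale (a + b) s) (Add (Scale a s) (Scale b s)).

Definition mcongb (s t : mterm) : bool := `[< mcong s t >].

Lemma mcongb_refl : reflexive mcongb.
Proof. by move=> s; apply/asboolP; exact: cong_refl. Qed.
Lemma mcongb_sym : symmetric mcongb.
Proof.
by move=> s t; apply/asboolP/asboolP; exact: cong_sym.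
Qed.
Lemma mcongb_trans : transitive mcongb.
Proof.
by move=> t s u /asboolP st /asboolP tu; apply/asboolP; exact: cong_trans tu.
Qed.

Canonical mcong_equiv := EquivRel mcongb mcongb_refl mcongb_sym mcongb_trans.

Local Open Scope quotient_scope.

Definition presmod := {eq_quot mcong_equiv}.

HB.instance Definition _ := Choice.on presmod.
HB.instance Definition _ := EqQuotient.on presmod.

Definition pm_cls (s : mterm) : presmod := \pi_presmod s.

Lemma clsP s t : pm_cls s = pm_cls t <-> mcong s t.
Proof.
split; first by move/eqmodP/asboolP.
by move=> st; apply/eqmodP/asboolP.
Qed.

Lemma cls_repr (x : presmod) : pm_cls (repr x) = x.
Proof. exact: reprK. Qed.

Lemma repr_cls s : mcong (repr (pm_cls s)) s.
Proof. by apply/clsP; rewrite cls_repr. Qed.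

Definition pm_zero : presmod := pm_cls Zero.
Definition pm_add (x y : presmod) : presmod := pm_cls (Add (repr x) (repr y)).
Definition pm_opp (x : presmod) : presmod := pm_cls (Opp (repr x)).
Definition pm_scale (a : R) (x : presmod) : presmod := pm_cls (Scale a (repr x)).

Lemma pm_addE s t : pm_add (pm_cls s) (pm_cls t) = pm_cls (Add s t).
Proof. by apply/clsP/cong_Add; exact: repr_cls. Qed.
Lemma pm_oppE s : pm_opp (pm_cls s) = pm_cls (Opp s).
Proof. by apply/clsP/cong_Opp; exact: repr_cls. Qed.
Lemma pm_scaleE a s : pm_scale a (pm_cls s) = pm_cls (Scale a s).
Proof. by apply/clsP/cong_Scale; exact: repr_cls. Qed.

Lemma pm_addA : associative pm_add.
Proof.
move=> x y z; rewrite -(cls_repr x) -(cls_repr y) -(cls_repr z) !pm_addE.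
by apply/clsP; exact: cong_addA.
Qed.
Lemma pm_addC : commutative pm_add.
Proof. by move=> x y; apply/clsP; exact: cong_addC. Qed.
Lemma pm_add0 : left_id pm_zero pm_add.
Proof.
by move=> x; rewrite -(cls_repr x) pm_addE; apply/clsP; exact: cong_add0.
Qed.
Lemma pm_addN : left_inverse pm_zero pm_opp pm_add.
Proof.
move=> x; rewrite -(cls_repr x) pm_oppE pm_addE.
by apply/clsP; exact: cong_addN.
Qed.

HB.instance Definition _ :=
  GRing.isZmodule.Build presmod pm_addA pm_addC pm_add0 pm_addN.

Lemma pm_scaleA a b x : pm_scale a (pm_scale b x) = pm_scale (a * b) x.
Proof.
by rewrite -(cls_repr x) !pm_scaleE; apply/clsP; exact: cong_scaleA.
Qed.
Lemma pm_scale1 : left_id 1 pm_scale.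
Proof.
by move=> x; rewrite -(cls_repr x) pm_scaleE; apply/clsP; exact: cong_scale1.
Qed.
Lemma pm_scaleDr : right_distributive pm_scale +%R.
Proof.
move=> a x y; rewrite -(cls_repr x) -(cls_repr y) /= /GRing.add /=.
by rewrite !(pm_addE, pm_scaleE); apply/clsP; exact: cong_scaleDr.
Qed.
Lemma pm_scaleDl x : {morph pm_scale^~ x : a b / a + b}.
Proof.
move=> a b; rewrite -(cls_repr x) [RHS]/GRing.add /=.
by rewrite !(pm_addE, pm_scaleE); apply/clsP; exact: cong_scaleDl.
Qed.

HB.instance Definition _ := GRing.Zmodule_isLmodule.Build R presmod
  pm_scaleA pm_scale1 pm_scaleDr pm_scaleDl.

Definition pm_gen (x : X) : presmod := pm_cls (Gen x).

Section Lift.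
Variables (N : lmodType R) (g : X -> N).

Fixpoint meval (s : mterm) : N :=
  match s with
  | Gen x => g x
  | Zero => 0
  | Add s t => meval s + meval t
  | Opp s => - meval s
  | Scale a s => a *: meval s
  end.

(* The linear map with value g x at the generator x, provided that g satisfies
   the relations. *)
Definition pm_lift (x : presmod) : N := meval (repr x).

Hypothesis g_rel : forall s t, rel s t -> meval s = meval t.

Lemma meval_cong s t : mcong s t -> meval s = meval t.
Proof.
elim=> //=.
- by move=> ? ? ? _ -> _ ->.
- by move=> ? ? ? ? _ -> _ ->.
- by move=> ? ? _ ->.
- by move=> ? ? ? _ ->.
- by move=> ? ? ?; rewrite addrA.
- by move=> ? ?; rewrite addrC.
- by move=> ?; rewrite add0r.
- by move=> ?; rewrite addNr.
- by move=> ? ? ?; rewrite scalerA.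
- by move=> ?; rewrite scale1r.
- by move=> ? ? ?; rewrite scalerDr.
- by move=> ? ? ?; rewrite scalerDl.
Qed.

Lemma pm_lift_cls s : pm_lift (pm_cls s) = meval s.
Proof. exact: meval_cong (repr_cls s). Qed.

Lemma pm_lift_gen x : pm_lift (pm_gen x) = g x.
Proof. exact: pm_lift_cls. Qed.

Lemma pm_lift_linear : linear pm_lift.
Proof.
move=> a x y; rewrite -(cls_repr x) -(cls_repr y).
rewrite [a *: _]pm_scaleE [_ + _ in LHS]pm_addE.
by rewrite !pm_lift_cls.
Qed.

End Lift.

Lemma presmod_ind (P : presmod -> Prop) :
  (forall x, P (pm_gen x)) -> P 0 -> (forall x y, P x -> P y -> P (x + y)) ->
  (forall a x, P x -> P (a *: x)) -> forall x, P x.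
Proof.
move=> Pg P0 PD PZ x; rewrite -(cls_repr x); elim: (repr x) => [y||s ? t ?|s ?|a s ?].
- exact: Pg.
- exact: P0.
- by rewrite -pm_addE; exact: PD.
- by rewrite -pm_oppE -[pm_opp _]/(- pm_cls s) -scaleN1r; exact: PZ.
- by rewrite -pm_scaleE; exact: PZ.
Qed.

End Presentation.

Arguments Zero {R X}.
Arguments Gen {R X}.

Definition upd (k : nat) (M : Type) (u : 'I_k -> M) (i : 'I_k) (x : M) :
  'I_k -> M := fun j => if j == i then x else u j.

Section ExteriorPower.
Variables (R : comPzRingType) (M : lmodType R).

Inductive ext_rel (k : nat) :
    mterm R ('I_k -> M) -> mterm R ('I_k -> M) -> Prop :=
  | ext_add u i x y : ext_rel (Gen (upd u i (x + y)))
      (Add (Gen (upd u i x)) (Gen (upd u i y)))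
  | ext_scale u i a x : ext_rel (Gen (upd u i (a *: x)))
      (Scale a (Gen (upd u i x)))
  | ext_alt u i j : i != j -> u i = u j -> ext_rel (Gen u) Zero.

Definition extpow (k : nat) := presmod (@ext_rel k).
HB.instance Definition _ k := GRing.Lmodule.on (extpow k).

(* u_1 /\ ... /\ u_k *)
Definition ext_pure (k : nat) (u : 'I_k -> M) : extpow k := pm_gen (@ext_rel k) u.

Definition ext_wedge (k l m : nat) (h : (k + l)%N = m)
    (x : extpow k) (y : extpow l) : extpow m :=
  pm_lift (fun u => pm_lift (fun v => ext_pure (join_fun h u v)) y) x.

Lemma ext_pure_add k (u : 'I_k -> M) i x y :
  ext_pure (upd u i (x + y)) = ext_pure (upd u i x) + ext_pure (upd u i y).
Proof.
rewrite /ext_pure [RHS]pm_addE; apply/clsP; apply: cong_rel; exact: ext_add.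
Qed.

Lemma ext_pure_scale k (u : 'I_k -> M) i a x :
  ext_pure (upd u i (a *: x)) = a *: ext_pure (upd u i x).
Proof.
rewrite /ext_pure [RHS]pm_scaleE; apply/clsP; apply: cong_rel; exact: ext_scale.
Qed.

Lemma ext_pure_alt k (u : 'I_k -> M) i j : i != j -> u i = u j -> ext_pure u = 0.
Proof. by move=> ij uij; apply/clsP/cong_rel/(ext_alt ij uij). Qed.

Lemma join_fun_l (k l m : nat) (h : (k + l)%N = m) (u : 'I_k -> M) v i :
  join_fun h u v (cast_ord h (lshift l i)) = u i.
Proof. by rewrite /join_fun cast_ordK (unsplitK (inl _ i)). Qed.

Lemma join_fun_r (k l m : nat) (h : (k + l)%N = m) (u : 'I_k -> M) v i :
  join_fun h u v (cast_ord h (rshift k i)) = v i.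
Proof. by rewrite /join_fun cast_ordK (unsplitK (inr _ i)). Qed.

Lemma join_fun_updl (k l m : nat) (h : (k + l)%N = m) (u : 'I_k -> M) v i x :
  join_fun h (upd u i x) v = upd (join_fun h u v) (cast_ord h (lshift l i)) x.
Proof.
case: m / h; apply/funext => j; rewrite /join_fun /upd !cast_ord_id.
case: (fintype.split_ordP j) => [a ->|b ->]; rewrite ?eq_lshift//.
by rewrite eq_rlshift.
Qed.

Lemma join_fun_updr (k l m : nat) (h : (k + l)%N = m) (u : 'I_k -> M) v i x :
  join_fun h u (upd v i x) = upd (join_fun h u v) (cast_ord h (rshift k i)) x.
Proof.
case: m / h; apply/funext => j; rewrite /join_fun /upd !cast_ord_id.
case: (fintype.split_ordP j) => [a ->|b ->]; rewrite ?eq_rshift//.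
by rewrite eq_lrshift.
Qed.

Lemma ext_wedge_pure_rel (k l m : nat) (h : (k + l)%N = m) (u : 'I_k -> M) s t :
  @ext_rel l s t ->
  meval (fun v => ext_pure (join_fun h u v)) s =
  meval (fun v => ext_pure (join_fun h u v)) t.
Proof.
case=> [v i x y|v i a x|v i j ij vij] /=; rewrite ?join_fun_updr.
- exact: ext_pure_add.
- exact: ext_pure_scale.
- apply: (@ext_pure_alt _ _ (cast_ord h (rshift k i)) (cast_ord h (rshift k j))).
    by rewrite (inj_eq (@cast_ord_inj _ _ h)) eq_rshift.
  by rewrite !join_fun_r.
Qed.

Lemma ext_wedge_rel (k l m : nat) (h : (k + l)%N = m) (y : extpow l) s t :
  @ext_rel k s t ->
  meval (fun u => pm_lift (fun v => ext_pure (join_fun h u v)) y) s =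
  meval (fun u => pm_lift (fun v => ext_pure (join_fun h u v)) y) t.
Proof.
rewrite /pm_lift => -[u i x1 x2|u i a x|u i j ij uij] /=;
  elim: (generic_quotient.repr y) => [v||s1 + s2 +|s1 +|b s1 +] /=.
- by rewrite !join_fun_updl ext_pure_add.
- by rewrite addr0.
- by move=> -> ->; rewrite addrACA.
- by move=> ->; rewrite opprD.
- by move=> ->; rewrite scalerDr.
- by rewrite !join_fun_updl ext_pure_scale.
- by rewrite scaler0.
- by move=> -> ->; rewrite scalerDr.
- by move=> ->; rewrite scalerN.
- by move=> ->; rewrite !scalerA mulrC.
- apply: (@ext_pure_alt _ _ (cast_ord h (lshift l i)) (cast_ord h (lshift l j))).
    by rewrite (inj_eq (@cast_ord_inj _ _ h)) eq_lshift.
  by rewrite !join_fun_l.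
- by [].
- by move=> -> ->; rewrite addr0.
- by move=> ->; rewrite oppr0.
- by move=> ->; rewrite scaler0.
Qed.

Lemma ext_wedge_pure (k l m : nat) (h : (k + l)%N = m)
    (u : 'I_k -> M) (v : 'I_l -> M) :
  ext_wedge h (ext_pure u) (ext_pure v) = ext_pure (join_fun h u v).
Proof.
rewrite /ext_wedge pm_lift_gen; last exact: ext_wedge_rel.
by rewrite pm_lift_gen//; exact: ext_wedge_pure_rel.
Qed.

Lemma ext_wedge_linearl (k l m : nat) (h : (k + l)%N = m) (y : extpow l) :
  linear (fun x : extpow k => ext_wedge h x y).
Proof. by apply: pm_lift_linear; exact: ext_wedge_rel. Qed.

Lemma ext_wedge_linearr (k l m : nat) (h : (k + l)%N = m) (x : extpow k) :
  linear (ext_wedge h x : extpow l -> extpow m).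
Proof.
move=> a y z; have lx := ext_wedge_linearl h.
have D w x1 x2 : ext_wedge h (x1 + x2) w = ext_wedge h x1 w + ext_wedge h x2 w :> extpow m.
  by rewrite -[x1]scale1r lx !scale1r.
have W0 w : ext_wedge h 0 w = 0 :> extpow m.
  by have := D w 0 0; rewrite addr0 => /eqP; rewrite -subr_eq0 opprD addNKr oppr_eq0 => /eqP.
have Z w b x1 : ext_wedge h (b *: x1) w = b *: ext_wedge h x1 w :> extpow m.
  by rewrite -[b *: x1]addr0 lx W0 addr0.
elim/presmod_ind: x => [u||x1 x2 E1 E2|b x1 E].
- rewrite -[pm_gen _ u]/(ext_pure u) /ext_wedge !pm_lift_gen; try exact: ext_wedge_rel.
  by rewrite pm_lift_linear//; exact: ext_wedge_pure_rel.
- by rewrite !W0 scaler0 addr0.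
- by rewrite !D E1 E2 scalerDr addrACA.
- by rewrite !Z E scalerDr !scalerA mulrC.
Qed.

End ExteriorPower.

(* Generators: symbols df.  The first two relations define the Kaehler
   differentials of the ring L^n(A), the third one the quotient of them. *)
Inductive omega1_rel (n : nat) (A : comPzRingType) :
    mterm (iterL n A) (iterL n A) -> mterm (iterL n A) (iterL n A) -> Prop :=
  | omega1_add f g : omega1_rel (Gen (f + g)) (Add (Gen f) (Gen g))
  | omega1_mul f g : omega1_rel (Gen (f * g))
      (Add (Scale f (Gen g)) (Scale g (Gen f)))
  | omega1_partial f : omega1_rel (Gen f)
      (\big[@Add _ _/Zero]_(i < n) Scale (pderiv A i f) (Gen (tvar A i))).

Definition omega1 (n : nat) (A : comPzRingType) := presmod (@omega1_rel n A).
HB.instance Definition _ n A := GRing.Lmodule.on (omega1 n A).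

Definition dform (n : nat) (A : comPzRingType) (f : iterL n A) : omega1 n A :=
  pm_gen (@omega1_rel n A) f.

Definition omega (i n : nat) (A : comPzRingType) := extpow (omega1 n A) i.
HB.instance Definition _ i n A := GRing.Lmodule.on (omega i n A).

(* Well defined by [res_unique]. *)
Definition res (n : nat) (A : comPzRingType) (w : omega n n A) : A :=
  xget 0 [set a | exists f : iterL n A,
    w = f *: ext_pure (fun i : 'I_n => dform (tvar A i)) /\
    a = coefL f (const_mx (-1))].

(* f dt_(j_1) /\ ... /\ dt_(j_i) is mapped to
   phi(f) dphi(t_(j_1)) /\ ... /\ dphi(t_(j_i)), additively. *)
Definition form_map (i n m : nat) (A : comPzRingType)
    (phi : iterL n A -> iterL m A) (w : omega i n A) : omega i m A :=
  xget 0 [set v | exists f : {ffun 'I_i -> 'I_n} -> iterL n A,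
    w = \sum_J (f J *: ext_pure (fun j => dform (tvar A (J j)))) /\
    v = \sum_J (phi (f J) *: ext_pure (fun j => dform (phi (tvar A (J j)))))].

Definition dlog_t (m : nat) (A : comPzRingType) (q : 'I_m) : omega1 m A :=
  tvarV A q *: dform (tvar A q).

(* dt_(q_j) / t_(q_j), with q_j locally constant on Spec(A). *)
Definition dlog_q (n m : nat) (hnm : (n <= m)%N) (A : comPzRingType)
    (phi : iterL n A -> iterL m A) (j : 'I_(m - n)) : omega1 m A :=
  lc_glue (fun (a : A) (v : omega1 m A) => (constL m a : iterL m A) *: v)
    (lc_map (fun q : {ffun 'I_(m - n) -> 'I_m} => dlog_t A (q j))
       (cpiv hnm phi)).

Lemma coefLB n (A : comPzRingType) (f g : iterL n A) l : coefL (f - g) l = coefL f l - coefL g l.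
Proof. by elim: n f g l => //= n IH f g l; rewrite -IH. Qed.
Lemma coefL0 n (A : comPzRingType) l : coefL (0 : iterL n A) l = 0.
Proof. by rewrite -[0](subrr 0) coefLB subrr. Qed.
Lemma coefLMz n (A : comPzRingType) (f : iterL n A) l (k : int) : coefL (f *~ k) l = coefL f l *~ k.
Proof.
have h : zmod_morphism (fun f : iterL n A => coefL f l) by move=> ? ?; exact: coefLB.
pose a := GRing.isZmodMorphism.Build _ _ _ h.
pose c : {additive iterL n A -> A} := HB.pack (fun f : iterL n A => coefL f l) a.
exact: (raddfMz c).
Qed.

Lemma col_ordmax k (l : 'cV[int]_k.+1) (j : 'I_k) : row' ord_max l j 0 = l (lift ord_max j) 0.
Proof. by rewrite mxE. Qed.

Lemma row'_delta k (j : 'I_k) : row' ord_max (delta_mx (lift ord_max j) 0 : 'cV[int]_k.+1) = delta_mx j 0.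
Proof. by apply/matrixP => a b; rewrite !mxE (inj_eq lift_inj). Qed.
Lemma row'_delta0 k : row' ord_max (delta_mx ord_max 0 : 'cV[int]_k.+1) = 0.
Proof. by apply/matrixP => a b; rewrite !mxE eq_sym (negPf (neq_lift _ _)). Qed.
Lemma row'D k (l l' : 'cV[int]_k.+1) : row' ord_max (l + l') = row' ord_max l + row' ord_max l'.
Proof. by apply/matrixP => a b; rewrite !mxE. Qed.

Lemma coefL_pderiv n (A : comPzRingType) (i : 'I_n) (f : iterL n A) l :
  coefL (pderiv A i f) l = coefL f (l + delta_mx i 0) *~ (l i 0 + 1).
Proof.
elim: n i f l => [[]//|n IH] i f l /=.
case: unliftP => [j ->|->] /=.
  rewrite /lmap_fun IH row'D row'_delta col_ordmax; congr (coefL (lcoef f _) _ *~ _).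
  by rewrite !mxE (negPf (neq_lift _ _)) addr0.
by rewrite coefLMz row'D row'_delta0 addr0 !mxE !eqxx.
Qed.

Lemma coefL_mono n (A : comPzRingType) (l l' : 'cV[int]_n) (a : A) :
  coefL (monoL l a : iterL n A) l' = if l' == l then a else 0.
Proof.
elim: n l l' => [|n IH] l l' /=; first by rewrite (flatmx0 l) (flatmx0 l') eqxx.
case: eqP => E; last first.
  rewrite coefL0; case: eqP => // E'; by rewrite E' in E.
rewrite IH; congr (if _ then _ else _).
apply/eqP/eqP => [|->//] E2; apply/matrixP => i j; rewrite (ord1 j).
case: (unliftP ord_max i) => [k ->|->//].
by rewrite -!col_ordmax E2.
Qed.

Lemma lderivM R (f g : laurent R) : lderiv (f * g) = f * lderiv g + g * lderiv f.
Proof.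
rewrite addrC (mulrC g); apply: laurentP => k.
rewrite lcoefD /= -/(lconv _ _ _).
case: f g => [f [a fa]] [g [b gb]] /=.
rewrite /GRing.mul /= -/(lconv _ _ _).
pose n := (absz (k - a - b)%R).+3.
rewrite (@lconvE _ f g a b _ n)//; last by lia.
rewrite (@lconvE _ _ g (a-1) b _ n)//; last by lia.
  rewrite (@lconvE _ f _ a (b-1) _ n)//; last by lia.
    rewrite mulrz_suml -big_split; apply: eq_bigr => i _ /=.
    rewrite mulrzAr mulrzAl.
    have -> : a - 1 + i + 1 = a + i%:Z by lia.
    have -> : k - (a - 1 + i) = k + 1 - (a + i%:Z) by lia.
    have -> : k - (a + i) + 1 = k + 1 - (a + i%:Z) by lia.
    by rewrite -mulrzDr; congr (_ *~ _); lia.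
  by move=> i ib; rewrite gb ?mul0rz//; lia.
by move=> i ib; rewrite fa ?mul0rz//; lia.
Qed.

Lemma lmapM (R : comPzRingType) (h : {additive R -> R}) (f g : laurent R) :
  (forall x y, h (x * y) = x * h y + y * h x) ->
  lmap h (f * g) = f * lmap h g + g * lmap h f.
Proof.
move=> hM; rewrite addrC (mulrC g); apply: laurentP => k.
rewrite lcoefD /= /lmap_fun.
case: f g => [f [a fa]] [g [b gb]] /=.
rewrite /GRing.mul /= -/(lconv _ _ _).
pose n := (absz (k - a - b)%R).+1.
rewrite (@lconvE _ f g a b _ n)//; last by lia.
rewrite (@lconvE _ _ g a b _ n)//; last by lia.
  rewrite (@lconvE _ f _ a b _ n)//; last by lia.
    rewrite raddf_sum -big_split; apply: eq_bigr => i _ /=.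
    by rewrite hM addrC (mulrC (g _)).
  by move=> i ib; rewrite /lmap_fun/= gb ?raddf0.
by move=> i ib; rewrite /lmap_fun/= fa ?raddf0.
Qed.

Lemma pderivM n (A : comPzRingType) i (f g : iterL n A) :
  pderiv A i (f * g) = f * pderiv A i g + g * pderiv A i f.
Proof.
elim: n i f g => [[]//|n IH] i f g /=.
case: unliftP => [j _|_] /=; first exact: lmapM.
exact: lderivM.
Qed.

Lemma coefLP n (A : comPzRingType) (f g : iterL n A) : (forall l, coefL f l = coefL g l) -> f = g.
Proof.
elim: n f g => [|n IH] f g /= E; first exact: (E 0).
apply: laurentP => k; apply: IH => l.
pose l' : 'cV[int]_n.+1 := \col_i (if unlift ord_max i is Some j then l j 0 else k).
have := E l'; have -> : row' ord_max l' = l by apply/matrixP => a b; rewrite !mxE liftK (ord1 b).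
by rewrite mxE unlift_none.
Qed.

Lemma monoL01 n (A : comPzRingType) : monoL 0 1 = 1 :> iterL n A.
Proof.
elim: n => //= n IH.
by apply: laurentP => k; rewrite /= -IH mxE; congr (if _ then monoL _ _ else _); apply/matrixP=> ? ?; rewrite !mxE.
Qed.

Lemma pderiv_tvar n (A : comPzRingType) i j : pderiv A i (tvar A j) = (i == j)%:R :> iterL n A.
Proof.
apply: coefLP => l; rewrite coefL_pderiv coefL_mono.
have -> : (i == j)%:R = monoL 0 (i == j)%:R :> iterL n A.
  case: eqP => _; first by rewrite monoL01.
  by apply: coefLP => l'; rewrite coefL0 coefL_mono if_same.
rewrite coefL_mono.
case: (eqVneq i j) => [->|ij].
  rewrite -subr_eq0 addrK; case: eqP => [->|_]; last by rewrite mul0rz.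
  by rewrite mxE add0r.
rewrite if_same; case: eqP => [E|_]; last by rewrite mul0rz.
by move/matrixP/(_ i 0): E; rewrite !mxE !eqxx (negPf ij) /= => ->; rewrite mulr0z.
Qed.

Definition omega1_grad n A (f : iterL n A) : 'rV[iterL n A]_n := \row_i pderiv A i f.
Lemma omega1_grad_rel n (A : comPzRingType) s t : @omega1_rel n A s t -> meval (@omega1_grad n A) s = meval (@omega1_grad n A) t.
Proof.
case=> [f g|f g|f] /=.
- by apply/rowP => i; rewrite !mxE raddfD.
- by apply/rowP => i; rewrite !mxE pderivM.
have -> : meval (@omega1_grad n A) (\big[@Add _ _/Zero]_i Scale (pderiv A i f) (Gen (tvar A i)))
  = \sum_i pderiv A i f *: omega1_grad (tvar A i) by apply: (big_morph (meval _)).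
apply/rowP => j; rewrite summxE (bigD1 j)//= !mxE pderiv_tvar eqxx mulr1 big1 ?addr0//.
by move=> i ij; rewrite !mxE pderiv_tvar eq_sym (negPf ij) mulr0.
Qed.
Definition omega1_coord n A : omega1 n A -> 'rV[iterL n A]_n := pm_lift (@omega1_grad n A).
Lemma omega1_coord_linear n (A : comPzRingType) : linear (@omega1_coord n A).
Proof. by apply: pm_lift_linear; exact: omega1_grad_rel. Qed.
Definition jacobian n A (u : 'I_n -> omega1 n A) : (iterL n A)^o := \det (\matrix_i omega1_coord (u i)).

Lemma omega1_coordD n (A : comPzRingType) : {morph @omega1_coord n A : x y / x + y}.
Proof. by move=> x y; have := omega1_coord_linear 1 x y; rewrite !scale1r. Qed.
Lemma omega1_coordZ n (A : comPzRingType) a : {morph @omega1_coord n A : x / a *: x}.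
Proof.
move=> x; have G0 : @omega1_coord n A 0 = 0 by have := omega1_coordD (0 : omega1 n A) 0; rewrite addr0 => /eqP; rewrite eq_sym -subr_eq0 addrK => /eqP.
by have := omega1_coord_linear a x 0; rewrite G0 !addr0.
Qed.

Lemma jacobian_rel n (A : comPzRingType) s t : @ext_rel _ (omega1 n A) n s t -> meval (@jacobian n A) s = meval (@jacobian n A) t.
Proof.
case=> [u i x y|u i a x|u i j ij uij] /=; rewrite /jacobian.
- rewrite (@determinant_multilinear _ _ _ (\matrix_j omega1_coord (upd u i x j)) (\matrix_j omega1_coord (upd u i y j)) i 1 1) ?mul1r//.
  + by rewrite !rowK /upd eqxx omega1_coordD !scale1r.
  + by apply/matrixP=> j k; rewrite !mxE /upd eq_sym (negPf (neq_lift _ _)).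
  + by apply/matrixP=> j k; rewrite !mxE /upd eq_sym (negPf (neq_lift _ _)).
- rewrite (@determinant_multilinear _ _ _ (\matrix_j omega1_coord (upd u i x j)) (\matrix_j omega1_coord (upd u i x j)) i a 0) ?mul0r ?addr0//.
  + by rewrite !rowK /upd eqxx omega1_coordZ scale0r addr0.
  + by apply/matrixP=> j k; rewrite !mxE /upd eq_sym (negPf (neq_lift _ _)).
  + by apply/matrixP=> j k; rewrite !mxE /upd eq_sym (negPf (neq_lift _ _)).
- by rewrite (determinant_alternate ij)// => k; rewrite !mxE uij.
Qed.

Lemma res_unique n (A : comPzRingType) (f g : iterL n A) :
  f *: ext_pure (fun i : 'I_n => dform (tvar A i)) = g *: ext_pure (fun i : 'I_n => dform (tvar A i)) -> f = g.
Proof.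
pose L : omega n n A -> (iterL n A)^o := pm_lift (@jacobian n A).
have E h : L (h *: ext_pure (fun i : 'I_n => dform (tvar A i))) = h.
  have lin := @pm_lift_linear _ _ _ _ _ (@jacobian_rel n A).
  have L0 : L 0 = 0.
    by have := lin 1 0 0; rewrite addr0 scale1r -/L => /eqP; rewrite scale1r eq_sym -subr_eq0 addrK => /eqP.
  have := lin h (ext_pure (fun i : 'I_n => dform (tvar A i))) 0.
  rewrite -/L L0 !addr0 => ->.
  rewrite /L pm_lift_gen; last exact: jacobian_rel.
  rewrite /jacobian (_ : \matrix_i _ = 1%:M) ?det1; first exact: mulr1.
  apply/matrixP => i j; rewrite !mxE /omega1_coord pm_lift_gen; last exact: omega1_grad_rel.
  by rewrite mxE pderiv_tvar eq_sym.
by move=> h; rewrite -(E f) h E.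
Qed.

Lemma spec_sum (A : comPzRingType) (x : Spec A) (I : finType) (F : I -> A) :
  (forall i, x (F i)) -> x (\sum_i F i).
Proof. by move=> H; apply: (big_ind (fun a => x a)) => //; [exact: spec0|exact: specD]. Qed.
Lemma dec_point (A : comPzRingType) (e : decomposition A) (x : Spec A) : exists i, ~ x (e i).
Proof.
apply: contrapT => /forallNP H; apply: (@spec1 _ x); rewrite -(dec_sum e).
by apply: spec_sum => i; have /contrapT := H i.
Qed.
Lemma lexle_total n (l l' : 'cV[int]_n) : lexle l l' \/ lexle l' l.
Proof.
elim: n l l' => [|n IH] l l' /=; first by left.
case: (ltgtP (l ord_max 0) (l' ord_max 0)) => [h|h|h]; [by left; left|by right; left|].
by case: (IH (row' ord_max l) (row' ord_max l')) => h2; [left|right]; right.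
Qed.
Lemma specX (A : comPzRingType) (x : Spec A) a N : x (a ^+ N) -> x a.
Proof. by elim: N => [|N IH]; [move/spec1 | rewrite exprS => /specP[]]. Qed.
Lemma specMr (A : comPzRingType) (x : Spec A) a b : x a -> x (a * b).
Proof. by rewrite mulrC; exact: specM. Qed.

Lemma lcfunP (A : comPzRingType) X (F G : lcfun A X) : lcval F =1 lcval G -> F = G.
Proof. 
case: F G => [F f] [G g] /= /funext E; case: _ / E in g *.
by congr MkLcfun; exact: Prop_irrelevance.
Qed.

Lemma nu_unique n (A : comPzRingType) (f : iterL n A) c c' : is_nu f c -> is_nu f c' -> c = c'.
Proof.
move=> [e [l H]] [e' [l' H']]; apply: lcfunP => x.
have [i xi] := dec_point e x; have [j xj] := dec_point e' x.
have [H1 [b H2] H3] := H i; have [H1' [b' H2'] H3'] := H' j.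
rewrite H3// H3'//.
apply: contrapT => ne.
case: (lexle_total (l i) (l' j)) => le.
  have [|N HN] := H1' (l i); first by split.
  have : x (e' j * coefL f (l i)) by apply: (@specX _ _ _ N); rewrite HN; exact: spec0.
  case/specP => // xf; apply: xi; rewrite -H2; apply: specMr; exact: specM.
have [|N HN] := H1 (l' j); first by split => // /esym.
have : x (e i * coefL f (l' j)) by apply: (@specX _ _ _ N); rewrite HN; exact: spec0.
case/specP => // xf; apply: xj; rewrite -H2'; apply: specMr; exact: specM.
Qed.


Lemma nu_monoL n (A : comPzRingType) l : nu (monoL l 1 : iterL n A) = lc_const A l.
Proof.
have H : is_nu (monoL l 1 : iterL n A) (lc_const A l).
  have o : forall i j : 'I_1, i != j -> (1 : A) * 1 = 0 by move=> i j; rewrite !ord1 eqxx.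
  have s : \sum_(i < 1) (1 : A) = 1 by rewrite big_ord1.
  exists (@MkDecomposition A 1 (fun=> 1) o s), (fun=> l) => i /=; split => //.
    move=> l' [_ /eqP/negPf ne]; exists 1; by rewrite coefL_mono ne mulr0 expr1.
  by exists 1; rewrite coefL_mono eqxx !mulr1.
by apply: xget_unique => // c hc; apply: (nu_unique hc).
Qed.

(* Main.v *)
(* Both sides of the equality are A-linear and continuous in the coefficient of [w], so it
   suffices to take [w = t^l dt_1 /\ .. /\ dt_n].  Over the factors of a suitable finite
   decomposition of [A] each [phi(t_i)] has the shape [c t^nu (1 + h) (1 + y)] with [h] supported
   in lex-positive exponents and [y] nilpotent.  Its logarithmic differential then lifts to a
   closed form over a torsion-free ring surjecting onto [A]; there [k g^(k-1) dg = d(g^k)], and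
   exact forms wedged with closed ones have no residue, whence [res(g^(k-1) dg /\ eta) = 0] over
   [A] as well.  A unimodular change of the exponents therefore kills the monomials with
   [l <> -1], while for [l = -1] the contributions of [1 + h] and [1 + y] vanish and the residue
   is the determinant of the valuations.  Continuity forces the map [l |-> nu(phi(t^l))] to
   preserve lexicographic positivity, which gives the echelon form and evaluates this determinant
   as [sgn(phi) d(phi)]. *)
From HB Require Import structures.
Require Import Defs.
From mathcomp Require Import fingroup perm all_boot all_order all_algebra.
From mathcomp Require Import all_classical.
From mathcomp Require Import zify ring.
From mathcomp Require finmap monalg.
Set Implicit Arguments.
Unset Strict Implicit.
Unset Printing Implicit Defensive.
Import Order.TTheory GRing.Theory Num.Theory.
Local Open Scope classical_set_scope.
Local Open Scope ring_scope.

(** Two obstacles shape the argument. Closedness over A is too weak a condition for the residues to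
    vanish (see [liftable]), so every factor of the form has to come from a closed form over a ring
    where d(g^k) can be divided by k. On the other hand neither [phi] nor the units phi(t_i) are
    lifted: the cover is a polynomial ring over Z, so a nonzero nilpotent y has no nilpotent lift
    there, and 1 plus a lift of y need not be invertible. What does lift is the logarithmic
    differential of 1 + y, written as the finite sum of the (-y)^i dy, because g^i dg is closed for
    every g. The factors of A are never formed as rings. A statement over a factor is a statement
    over A multiplied by an idempotent e, and a unit is replaced by one that is [regular] over all
    of A and agrees with it after multiplication by e. Top forms are determinants whose rows are the
    coordinates of 1-forms, so that e = e^m can be spread over the m rows. *)

Definition torsion_free (B : comPzRingType) := forall (k : nat) (x : B), x *+ k.+1 = 0 -> x = 0.

(** * Torsion-free covers of a ring *)

Section FreeCommutativeRing.
Import finmap monalg.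
Variable A : comNzRingType.

(** The monoid algebra of [cmonom A] over Z is the polynomial ring with one variable X_a for each
    element a of A; this is the evaluation X_a -> a on monomials. *)
Definition monom_eval (m : cmonom A) : A := \prod_(a <- finsupp m) a ^+ m a.

Lemma monom_evalE (m : cmonom A) (d : {fset A}) :
  (finsupp m `<=` d)%fset -> monom_eval m = \prod_(a <- d) a ^+ m a.
Proof.
move=> md; rewrite /monom_eval (big_fset_incl _ md)// => a _ /fsfun_dflt ->.
by rewrite expr0.
Qed.

Lemma monom_eval_mmorphism : mmorphism monom_eval.
Proof.
split=> [m1 m2|]; last by rewrite /monom_eval mdom1 big_seq_fset0.
rewrite (@monom_evalE (mmul m1 m2) (finsupp m1 `|` finsupp m2)%fset) ?mdomD//.
rewrite (@monom_evalE m1 (finsupp m1 `|` finsupp m2)%fset) ?fsubsetUl//.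
rewrite (@monom_evalE m2 (finsupp m1 `|` finsupp m2)%fset) ?fsubsetUr//.
by rewrite -big_split; apply: eq_bigr => a _; rewrite cmM exprD.
Qed.

HB.instance Definition _ := isMultiplicative.Build _ _ monom_eval monom_eval_mmorphism.

Lemma malg_int_torsion_free : torsion_free {malg int[cmonom A]}.
Proof.
move=> k x /malgP xk; apply/malgP => m; have := xk m; rewrite mcoeff0 mcoeffMn.
by move/eqP; rewrite mulrn_eq0 => /eqP.
Qed.

Lemma free_ring_cover : exists (B : comPzRingType) (p : {rmorphism B -> A}),
  torsion_free B /\ forall a, exists b, p b = a.
Proof.
exists {malg int[cmonom A]}, (mmap (intr : int -> A) monom_eval).
split; first exact: malg_int_torsion_free.
move=> a; exists (mkmalgU (ucm a) 1) => /=.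
by rewrite mmapU mul1r /monom_eval mdomU big_seq_fset1 cmUU expr1.
Qed.
End FreeCommutativeRing.

Lemma torsion_free_cover (A : comPzRingType) :
  exists (B : comPzRingType) (p : {rmorphism B -> A}),
  torsion_free B /\ forall a, exists b, p b = a.
Proof.
have [A1|A1] := eqVneq (1 : A) 0.
  (* The zero ring is not a [comNzRingType]; it is covered by Z. *)
  exists int, (intr : int -> A); split.
    by move=> k x /eqP; rewrite mulrn_eq0 => /eqP.
  by move=> a; exists 0; rewrite -[a]mul1r A1 mul0r.
pose A' : comNzRingType := HB.pack (GRing.ComPzRing.sort A)
  (GRing.PzSemiRing_isNonZero.Build A A1).
exact: (@free_ring_cover A').
Qed.

(** * Nilpotent elements and lifting of idempotents *)

Section Nilpotents.
Variable R : comPzRingType.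
Implicit Types x y : R.

Definition nilpotent x := exists N, x ^+ N = 0.

Lemma nilpotent0 : nilpotent 0. Proof. by exists 1%N; rewrite expr1. Qed.

Lemma nilpotentMr x y : nilpotent x -> nilpotent (x * y).
Proof. by case=> N xN; exists N; rewrite exprMn xN mul0r. Qed.

Lemma nilpotentMl x y : nilpotent y -> nilpotent (x * y).
Proof. by rewrite mulrC; exact: nilpotentMr. Qed.

Lemma nilpotentN x : nilpotent x -> nilpotent (- x).
Proof. by rewrite -mulN1r; exact: nilpotentMl. Qed.

Lemma expr_eq0_le x M N : (M <= N)%N -> x ^+ M = 0 -> x ^+ N = 0.
Proof. by move=> /subnK <- xM; rewrite exprD xM mulr0. Qed.

Lemma nilpotentD x y : nilpotent x -> nilpotent y -> nilpotent (x + y).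
Proof.
move=> [M xM] [N yN]; exists (M + N)%N; rewrite exprDn big1// => i _.
have [iN|iN] := leqP N i; first by rewrite (expr_eq0_le iN yN) mulr0 mul0rn.
by rewrite (@expr_eq0_le x M) ?mul0r ?mul0rn//; lia.
Qed.

Lemma nilpotentB x y : nilpotent x -> nilpotent y -> nilpotent (x - y).
Proof. by move=> xn yn; apply: nilpotentD => //; exact: nilpotentN. Qed.

Lemma nilpotent_sum (I : Type) (r : seq I) (P : pred I) (F : I -> R) :
  (forall i, P i -> nilpotent (F i)) -> nilpotent (\sum_(i <- r | P i) F i).
Proof. by move=> H; apply: big_ind => //; [exact: nilpotent0|exact: nilpotentD]. Qed.

Lemma nilpotentX x N : nilpotent (x ^+ N) -> nilpotent x.
Proof. by case=> M; rewrite -exprM => xM; exists (N * M)%N. Qed.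

Lemma nilpotent_unit y : nilpotent y ->
  exists2 y', nilpotent y' & (1 + y) * (1 + y') = 1.
Proof.
move=> yn; have [N yN] := yn.
have H : (1 + y) * (\sum_(i < N) (- y) ^+ i) = 1.
  have := subrX1 (- y) N; rewrite exprNn yN mulr0 sub0r => /eqP.
  by rewrite eqr_oppLR -mulNr opprB opprK => /eqP <-.
exists (- y * (\sum_(i < N) (- y) ^+ i)); first exact/nilpotentMr/nilpotentN.
have -> : 1 + - y * (\sum_(i < N) (- y) ^+ i) = \sum_(i < N) (- y) ^+ i.
  by rewrite -{1}H mulrDl mul1r mulNr addrK.
exact: H.
Qed.

Lemma comaximal_expr x z M N : x + z = 1 -> exists r s, x ^+ M * r + z ^+ N * s = 1.
Proof.
move=> xz1; have [r1 [s1 E1]] : exists r s, x * r + z ^+ N * s = 1.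
  elim: N => [|N [r [s E]]]; first by exists 0, 1; rewrite mulr0 add0r mulr1.
  exists (1 + r * z), s; transitivity (x + (x * r + z ^+ N * s) * z).
    by rewrite exprS; ring.
  by rewrite E mul1r.
elim: M => [|M [r [s E]]]; first by exists 1, 0; rewrite mulr0 addr0 mulr1.
exists (r * r1), (s * (x * r1 + z ^+ N * s1) + x ^+ M * r * s1).
transitivity ((x ^+ M * r + z ^+ N * s) * (x * r1 + z ^+ N * s1)).
  by rewrite exprS; ring.
by rewrite E E1 mulr1.
Qed.

(** In a Bezout relation x^(N+1) r + z^(N+1) s = 1 the first summand e satisfies e (1 - e) =
    (xz)^(N+1) r s = 0. The exponent N+1 ensures that x divides e and z divides 1 - e even when N =
    0. *)
Lemma lift_idempotent x z : x + z = 1 -> nilpotent (x * z) ->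
  exists e r s, [/\ e * e = e, e = x * r & 1 - e = z * s].
Proof.
move=> xz1 [N xzN].
have [r [s E]] := comaximal_expr N.+1 N.+1 xz1.
exists (x ^+ N.+1 * r), (x ^+ N * r), (z ^+ N * s).
split; [|by rewrite exprS mulrA|by rewrite -{1}E addrAC subrr add0r exprS mulrA].
rewrite -[RHS]mulr1 -E mulrDr (_ : _ * (z ^+ N.+1 * s) = (x * z) ^+ N.+1 * (r * s)).
  by rewrite (exprS (x * z)) xzN mulr0 mul0r addr0.
by rewrite exprMn; ring.
Qed.

Lemma nilpotent_idempotent e : e * e = e -> nilpotent e -> e = 0.
Proof.
move=> ee [N eN]; have {eN} : e ^+ N.+1 = 0 by rewrite exprS eN mulr0.
suff -> : e ^+ N.+1 = e by [].
by elim: N => [|N IH]; rewrite ?expr1// exprS IH.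
Qed.

(** The two-element case is applied to x_i and the sum z_i of the others. Each defect, e_i e_j and
    then 1 - \sum_i e_i, is both idempotent and nilpotent, hence zero. *)
Lemma lift_idempotents (I : finType) (x : I -> R) : \sum_i x i = 1 ->
  (forall i j, i != j -> nilpotent (x i * x j)) ->
  exists e : I -> R, exists r : I -> R, [/\ forall i, e i * e i = e i,
    forall i j, i != j -> e i * e j = 0, \sum_i e i = 1 & forall i, e i = x i * r i].
Proof.
move=> x1 xn; pose z i := \sum_(j | j != i) x j.
have xz i : x i + z i = 1 by rewrite -x1 [RHS](bigD1 i).
have nxz i : nilpotent (x i * z i).
  by rewrite mulr_sumr; apply: nilpotent_sum => j ji; apply: xn; rewrite eq_sym.
have /choice[e /choice[r /choice[s H]]] i := lift_idempotent (xz i) (nxz i).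
have ee i : e i * e i = e i by have [] := H i.
have eo i j : i != j -> e i * e j = 0.
  move=> ij; have [_ ei _] := H i; have [_ ej _] := H j.
  apply: nilpotent_idempotent; first by rewrite mulrACA !ee.
  by rewrite ei ej mulrACA; apply: nilpotentMr; exact: xn.
exists e, r; split => //; last by move=> i; have [] := H i.
pose d := 1 - \sum_i e i.
have de i : d * e i = 0.
  rewrite mulrBl mul1r mulr_suml (bigD1 i)//= big1 ?addr0 ?ee ?subrr// => j ji.
  exact: eo.
suff d0 : d = 0 by apply/eqP; rewrite eq_sym -subr_eq0 -/d d0.
apply: nilpotent_idempotent.
  rewrite {2}/d mulrBr mulr1 mulr_sumr big1 ?subr0// => i _; exact: de.
(* Since d e_i = 0, d = d (1 - e_i) is a multiple of z_i, so d x_i is a multiple of the nilpotent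
   x_i z_i; the d x_i add up to d. *)
rewrite -[d]mulr1 -x1 mulr_sumr; apply: nilpotent_sum => i _.
have [_ ei e1] := H i.
rewrite -[d]mulr1 -(subrK (e i) 1) mulrDr de addr0 e1.
have -> : d * (z i * s i) * x i = x i * z i * (d * s i) by clearbody d; ring.
exact: nilpotentMr.
Qed.

End Nilpotents.

(** * Laurent series in one variable: order, monomials, tails *)

Section LaurentBasics.
Variable R : comPzRingType.
Implicit Types (f g : laurent R) (a b k : int) (c : R).

Definition order_ge a f := forall k, k < a -> f k = 0.

Lemma order_geW a b f : b <= a -> order_ge a f -> order_ge b f.
Proof. by move=> ba fa k kb; apply: fa; exact: lt_le_trans ba. Qed.

Lemma order_ge_ex f : exists a, order_ge a f.
Proof. by case: f. Qed.

Lemma order_geD a f g : order_ge a f -> order_ge a g -> order_ge a (f + g).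
Proof. by move=> fa ga k ka; rewrite lcoefD fa// ga// addr0. Qed.

Lemma order_geN a f : order_ge a f -> order_ge a (- f).
Proof. by move=> fa k ka; rewrite lcoefN fa// oppr0. Qed.

Lemma lcoefM_ord a b f g k n : order_ge a f -> order_ge b g -> k < a + b + n%:Z ->
  (f * g) k = \sum_(i < n) f (a + i%:Z) * g (k - (a + i%:Z)).
Proof. by move=> fa gb kn; rewrite lcoefM; exact: (lconvE fa gb kn). Qed.

Lemma order_geM a b f g : order_ge a f -> order_ge b g -> order_ge (a + b) (f * g).
Proof.
by move=> fa gb k kab; rewrite (@lcoefM_ord a b _ _ _ 0) ?addr0// big_ord0.
Qed.

Lemma lcoefM_lead a b f g : order_ge a f -> order_ge b g -> (f * g) (a + b) = f a * g b.
Proof.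
move=> fa gb; rewrite (@lcoefM_ord a b _ _ _ 1)//; last by lia.
by rewrite big_ord1 addr0 addrAC subrr add0r.
Qed.

Lemma order_geX a f n : order_ge a f -> order_ge (a *+ n) (f ^+ n).
Proof.
move=> fa; elim: n => [|n IH].
  by move=> k k0; rewrite expr0 /=; case: eqP => // E; move: k0; rewrite E.
by rewrite exprS mulrS; exact: order_geM.
Qed.

Lemma lcoefX_lead a f n : order_ge a f -> (f ^+ n) (a *+ n) = f a ^+ n.
Proof.
move=> fa; elim: n => [|n IH]; first by rewrite !expr0.
by rewrite exprS mulrS lcoefM_lead ?IH ?exprS//; exact: order_geX.
Qed.

Lemma lcoef_sum (I : Type) (r : seq I) (P : pred I) (F : I -> laurent R) k :
  (\sum_(i <- r | P i) F i) k = \sum_(i <- r | P i) F i k.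
Proof. exact: (big_morph (fun f : laurent R => f k) (id1 := 0) (op1 := +%R)). Qed.

Lemma lcoef_mono k j c : lmono j c k = if k == j then c else 0. Proof. by []. Qed.

Lemma order_ge_mono j c : order_ge j (lmono j c).
Proof. by move=> k kj; rewrite lcoef_mono lt_eqF. Qed.

Lemma lcoef_monoM j c f k : (lmono j c * f) k = c * f (k - j).
Proof.
have [b fb] := order_ge_ex f; pose n := (absz (k - j - b)%R).+1.
rewrite (@lcoefM_ord j b _ _ _ n)//; [|exact: order_ge_mono|by rewrite /n; lia].
rewrite big_ord_recl addr0 lcoef_mono eqxx big1 ?addr0// => i _.
by rewrite lcoef_mono /= -subr_eq0 addrAC subrr add0r mul0r.
Qed.

Lemma lmonoM j k c d : lmono j c * lmono k d = lmono (j + k) (c * d).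
Proof.
apply: laurentP => l; rewrite lcoef_monoM !lcoef_mono subr_eq (addrC j k).
by case: eqP; rewrite ?mulr0.
Qed.

Lemma lmonoD j c d : lmono j (c + d) = lmono j c + lmono j d.
Proof. by apply: laurentP => l; rewrite lcoefD !lcoef_mono; case: eqP; rewrite ?addr0. Qed.

Definition lconst c : laurent R := lmono 0 c.

Lemma lconst_zmod_morphism : zmod_morphism lconst.
Proof.
move=> c d; apply: laurentP => l; rewrite lcoefD lcoefN !lcoef_mono.
by case: eqP; rewrite ?subr0.
Qed.
HB.instance Definition _ := GRing.isZmodMorphism.Build R (laurent R) lconst lconst_zmod_morphism.

Lemma lconst_monoid_morphism : monoid_morphism lconst.
Proof. by split=> [|c d]; rewrite ?lmonoM ?addr0. Qed.
HB.instance Definition _ := GRing.isMonoidMorphism.Build R (laurent R) lconst lconst_monoid_morphism.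

Lemma lcoef_constM c f k : (lconst c * f) k = c * f k.
Proof. by rewrite lcoef_monoM subr0. Qed.

Lemma lmonoE j c : lmono j c = lmono j 1 * lconst c.
Proof. by rewrite lmonoM addr0 mul1r. Qed.

Lemma ltail_bounded n f : exists N : int, forall k, k < N -> (if k < n then 0 else f k) = 0.
Proof. by have [a fa] := order_ge_ex f; exists a => k /fa ->; rewrite if_same. Qed.
Definition ltail n f := MkLaurent (ltail_bounded n f).

Lemma order_ge_tail n f : order_ge n (ltail n f).
Proof. by move=> k kn /=; rewrite kn. Qed.

Lemma ltailE a n f : order_ge a f ->
  f = \sum_(i < n) lmono (a + i%:Z) (f (a + i%:Z)) + ltail (a + n%:Z) f.
Proof.
move=> fa; apply: laurentP => k; rewrite lcoefD lcoef_sum /=.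
have [kn|kn] := ltP k (a + n%:Z); last first.
  rewrite big1 ?add0r// => i _; case: eqP => // E; exfalso.
  by move: kn (ltn_ord i); rewrite E; lia.
rewrite addr0; have [ka|ak] := ltP k a.
  rewrite fa// big1// => i _; case: eqP => // E; exfalso; move: ka; rewrite E; lia.
have hi : (absz (k - a) < n)%N by lia.
have E : k = a + (Ordinal hi)%:Z by rewrite /=; lia.
rewrite (bigD1 (Ordinal hi))//= -E eqxx big1 ?addr0// => i ni.
case: eqP => // E'; case/eqP: ni; apply: val_inj => /=; lia.
Qed.

Lemma geometric_bounded f : exists N : int, forall k, k < N ->
  (if k < 0 then 0 else \sum_(i < `|k|.+1) (f ^+ i) k) = 0.
Proof. by exists 0 => k ->. Qed.

(** If f has order at least 1, then f^i has no term of degree below i, and the truncated sum is the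
    degree k coefficient of the full geometric series. *)
Definition geometric f := MkLaurent (geometric_bounded f).

Lemma geometricE f : order_ge 1 f -> (1 - f) * geometric f = 1.
Proof.
move=> f1; apply: laurentP => k.
have o1 : order_ge 0 (1 - f).
  apply: order_geD; first by move=> j j0; rewrite lcoef_mono lt_eqF.
  by apply: order_geN; apply: order_geW f1.
(* The partial sum S and the series agree below degree n, and n > k, so 1 - f^n may replace the
   product when reading degree k. *)
pose n := (absz k).+1; pose S := \sum_(i < n) f ^+ i.
have SE : (1 - f) * S = 1 - f ^+ n.
  by rewrite /S -[1 - f]opprB mulNr -subrX1 opprB.
have fn : order_ge n%:Z (f ^+ n) by have := order_geX (n:=n) f1; rewrite -natz.
have oD : order_ge n%:Z (geometric f - S).
  move=> j jn; rewrite lcoefD lcoefN /S lcoef_sum /=.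
  have [j0|j0] := ltP j 0.
    rewrite big1 ?subr0// => i _; apply: (order_geX (n:=i) f1); rewrite -mulr_natl mulr1; lia.
  apply/eqP; rewrite subr_eq0; apply/eqP.
  have jn' : (`|j|.+1 <= n)%N by move: jn; rewrite /n; lia.
  rewrite -(big_mkord xpredT (fun i => (f ^+ i) j)) -(big_mkord xpredT (fun i => (f ^+ i) j)).
  rewrite [RHS](@big_cat_nat _ _ _ `|j|.+1)//= [X in _ = _ + X]big_nat [X in _ = _ + X]big1 ?addr0//.
  by move=> i /andP[ji _]; apply: (order_geX (n:=i) f1); rewrite -mulr_natl mulr1; lia.
rewrite -[geometric f](subrK S) mulrDr SE lcoefD lcoefD lcoefN.
rewrite (fn k) ?(order_geM o1 oD) ?subr0 ?add0r//; rewrite /n; lia.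
Qed.

End LaurentBasics.

(** * Coefficients and derivatives of iterated Laurent series *)

Section IterBasics.
Variable A : comPzRingType.

Lemma coefLD n (f g : iterL n A) l : coefL (f + g) l = coefL f l + coefL g l.
Proof. by elim: n f g l => //= n IH f g l; rewrite -IH. Qed.

Lemma coefLN n (f : iterL n A) l : coefL (- f) l = - coefL f l.
Proof. by elim: n f l => //= n IH f l; rewrite -IH. Qed.

Lemma coefL_sum n (I : Type) (r : seq I) (P : pred I) (F : I -> iterL n A) l :
  coefL (\sum_(i <- r | P i) F i) l = \sum_(i <- r | P i) coefL (F i) l.
Proof.
by apply: (big_morph (fun f : iterL n A => coefL f l)) => [f g|]; rewrite ?coefLD ?coefL0.
Qed.

Lemma row'0 k : row' ord_max (0 : 'cV[int]_k.+1) = 0.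
Proof. by apply/matrixP => i j; rewrite !mxE. Qed.

Lemma row'N k (l : 'cV[int]_k.+1) : row' ord_max (- l) = - row' ord_max l.
Proof. by apply/matrixP => i j; rewrite !mxE. Qed.

Lemma row'B k (l l' : 'cV[int]_k.+1) : row' ord_max (l - l') = row' ord_max l - row' ord_max l'.
Proof. by apply/matrixP => i j; rewrite !mxE. Qed.

Lemma cV_ord_maxP k (l l' : 'cV[int]_k.+1) : l ord_max 0 = l' ord_max 0 ->
  row' ord_max l = row' ord_max l' -> l = l'.
Proof.
move=> E E'; apply/matrixP => i j; rewrite (ord1 j).
by case: (unliftP ord_max i) => [k' ->|->//]; rewrite -!col_ordmax E'.
Qed.

Lemma coefLS n (f : laurent (iterL n A)) (l : 'cV[int]_n.+1) :
  coefL (f : iterL n.+1 A) l = coefL (f (l ord_max 0)) (row' ord_max l).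
Proof. by []. Qed.

Lemma monoLS n (l : 'cV[int]_n.+1) (a : A) :
  monoL l a = lmono (l ord_max 0) (monoL (row' ord_max l) a) :> laurent (iterL n A).
Proof. by []. Qed.

Lemma constLS n (a : A) : constL n.+1 a = lconst (constL n a) :> laurent (iterL n A).
Proof. by rewrite /constL monoLS row'0 mxE. Qed.

Lemma monoLM n (l l' : 'cV[int]_n) (a b : A) :
  monoL l a * monoL l' b = monoL (l + l') (a * b) :> iterL n A.
Proof.
elim: n l l' => //= n IH l l'; rewrite lmonoM IH row'D; congr lmono.
by rewrite mxE.
Qed.

Lemma coefL_monoM n (l l' : 'cV[int]_n) (a : A) (f : iterL n A) :
  coefL (monoL l a * f) l' = a * coefL f (l' - l).
Proof.
elim: n l l' f => [//|n IH] l l' f.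
by rewrite !coefLS monoLS lcoef_monoM IH row'B !mxE.
Qed.

Lemma constL_zmod_morphism n : zmod_morphism (@constL n A).
Proof.
move=> a b; apply: coefLP => l; rewrite coefLB !coefL_mono.
by case: eqP; rewrite ?subr0.
Qed.
HB.instance Definition _ n :=
  GRing.isZmodMorphism.Build A (iterL n A) (@constL n A) (@constL_zmod_morphism n).

Lemma constL_monoid_morphism n : monoid_morphism (@constL n A).
Proof. by split=> [|a b]; rewrite /constL ?monoL01// monoLM addr0. Qed.
HB.instance Definition _ n :=
  GRing.isMonoidMorphism.Build A (iterL n A) (@constL n A) (@constL_monoid_morphism n).

Lemma coefL_constM n (a : A) (f : iterL n A) l : coefL (constL n a * f) l = a * coefL f l.
Proof. by rewrite coefL_monoM subr0. Qed.

Lemma constL_inj n : injective (@constL n A).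
Proof.
by move=> a b /(congr1 (fun f : iterL n A => coefL f 0)); rewrite !coefL_mono eqxx.
Qed.

Lemma monoLE n (l : 'cV[int]_n) (a : A) : monoL l a = constL n a * monoL l 1 :> iterL n A.
Proof. by rewrite monoLM add0r mulr1. Qed.

Lemma lcoefMn (R : comPzRingType) (f : laurent R) j k : (f *+ k) j = f j *+ k.
Proof. by elim: k => [//|k IH]; rewrite !mulrS lcoefD IH. Qed.

Lemma coefLMn n (f : iterL n A) l k : coefL (f *+ k) l = coefL f l *+ k.
Proof. by elim: k => [|k IH]; rewrite ?coefL0// !mulrS coefLD IH. Qed.

Lemma pderivC n (i j : 'I_n) (f : iterL n A) :
  pderiv A i (pderiv A j f) = pderiv A j (pderiv A i f).
Proof.
apply: coefLP => l; rewrite !coefL_pderiv -!mulrzA addrAC; congr (_ *~ _).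
have [->|ij] := eqVneq i j; first by [].
by rewrite !mxE !eqxx eq_sym (negPf ij) !addr0 mulrC.
Qed.

Lemma pderiv_mono n (i : 'I_n) l (a : A) :
  pderiv A i (monoL l a) = monoL (l - delta_mx i 0) a *~ l i 0 :> iterL n A.
Proof.
apply: coefLP => l'; rewrite coefL_pderiv coefLMz !coefL_mono.
rewrite eq_sym -subr_eq eq_sym; case: eqP => [->|_]; last by rewrite !mul0rz.
by rewrite !mxE !eqxx subrK.
Qed.

Lemma pderiv_const n (i : 'I_n) (a : A) : pderiv A i (constL n a) = 0 :> iterL n A.
Proof. by rewrite pderiv_mono mxE mulr0z. Qed.

Lemma coefL_pderiv_res n (i : 'I_n) (f : iterL n A) : coefL (pderiv A i f) (const_mx (-1)) = 0.
Proof. by rewrite coefL_pderiv mxE addNr mulr0z. Qed.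

End IterBasics.

(** * Coefficients of nilpotent series and of products *)

Lemma nilpotent_rmorph (R S : comPzRingType) (p : {rmorphism R -> S}) x :
  nilpotent x -> nilpotent (p x).
Proof. by case=> N xN; exists N; rewrite -rmorphXn xN rmorph0. Qed.

Lemma nilpotent_lmono (R : comPzRingType) j (c : R) : nilpotent c -> nilpotent (lmono j c).
Proof. by move=> cn; rewrite lmonoE; apply: nilpotentMl; exact: (nilpotent_rmorph (@lconst R)). Qed.

(** The lowest coefficient of a power is the power of the lowest coefficient, so the lowest one is
    nilpotent; subtracting its monomial keeps the series nilpotent and raises the order. *)
Lemma nilpotent_lcoef (R : comPzRingType) (f : laurent R) k : nilpotent f -> nilpotent (f k).
Proof.
move=> fn; have [a fa] := order_ge_ex f.
have [N] := ubnP (absz (k - a)); elim: N => // N IH in a f fn fa *.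
have [ka|ak] := ltP k a; first by move=> _; rewrite fa//; exact: nilpotent0.
have fan : nilpotent (f a).
  by case: fn => M fM; exists M; rewrite -(lcoefX_lead _ fa) fM.
rewrite ltnS => kN; have [->//|ka] := eqVneq k a.
pose g := f - lmono a (f a).
have -> : f k = g k by rewrite lcoefD lcoefN lcoef_mono (negPf ka) subr0.
apply: (IH (a + 1)); last by lia.
  by apply: nilpotentB => //; exact: nilpotent_lmono.
move=> j ja; rewrite lcoefD lcoefN lcoef_mono; case: eqP => [->|/eqP ja']; first by rewrite subrr.
by rewrite subr0 fa//; lia.
Qed.

Lemma nilpotent_coefL (A : comPzRingType) n (f : iterL n A) l : nilpotent f -> nilpotent (coefL f l).
Proof. by elim: n f l => //= n IH f l fn; apply: IH; exact: nilpotent_lcoef. Qed.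

(** Serves to read f_i g_j, up to a nilpotent, from one coefficient of the product. *)
Lemma nilpotent_lcoefM (R : comPzRingType) (f g : laurent R) (i j : int) :
  (forall i' : int, i' != i -> nilpotent (f i' * g (i + j - i'))) ->
  nilpotent ((f * g) (i + j) - f i * g j).
Proof.
move=> H; have [a' fa'] := order_ge_ex f; have [b gb] := order_ge_ex g.
pose a : int := Num.min a' i.
have fa : order_ge a f by apply: order_geW fa'; rewrite /a; lia.
pose n := (absz (i - a)%R + absz (i + j - a - b)%R).+1.
have hi : (absz (i - a)%R < n)%N by rewrite /n; lia.
have iE : a + `|i - a| = i by rewrite /a; lia.
rewrite (@lcoefM_ord _ a b f g (i + j) n)//; last by rewrite /n; lia.
rewrite (bigD1 (Ordinal hi))//= iE [i + j - i]addrAC subrr add0r addrAC subrr add0r.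
apply: nilpotent_sum => k ki; apply: H.
by apply: contra ki => /eqP ki; apply/eqP/val_inj => /=; lia.
Qed.

Lemma order_ge_nat (R : comPzRingType) (f : laurent R) : exists M : nat, order_ge (- M%:Z) f.
Proof. by have [a fa] := order_ge_ex f; exists `|a|%N; apply: order_geW fa; lia. Qed.

(** * Principal units and idempotents of iterated series *)

Section Principal.
Variable A : comPzRingType.

(** These are the series supported in strictly lex-positive exponents; for n = 0 there is no such
    exponent, whence h = 0. *)
Fixpoint lexpos (n : nat) : iterL n A -> Prop :=
  match n with
  | 0 => fun h => h = 0
  | k.+1 => fun h : laurent (iterL k A) => order_ge 0 h /\ lexpos (h 0)
  end.

Definition principal n (u : iterL n A) := lexpos (u - 1).

Lemma lexpos0 n : lexpos (0 : iterL n A).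
Proof. by elim: n => //= n IH; split => // k. Qed.

Lemma lexposD n (h h' : iterL n A) : lexpos h -> lexpos h' -> lexpos (h + h').
Proof.
elim: n h h' => [|n IH] h h' /=; first by move=> -> ->; rewrite addr0.
move=> [h0 hp] [h0' hp']; split; first exact: order_geD.
exact: (IH _ _ hp hp').
Qed.

Lemma lexposM n (h h' : iterL n A) : lexpos h -> lexpos h' -> lexpos (h * h').
Proof.
elim: n h h' => [|n IH] h h'; first by move=> /= ->; rewrite mul0r.
move=> [h0 hp] [h0' hp']; split; first exact: (order_geM h0 h0').
by have -> := lcoefM_lead h0 h0'; exact: IH.
Qed.

Lemma principal1 n : principal (1 : iterL n A).
Proof. by rewrite /principal subrr; exact: lexpos0. Qed.

Lemma principalM n (u v : iterL n A) : principal u -> principal v -> principal (u * v).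
Proof.
rewrite /principal => up vp.
have -> : u * v - 1 = (u - 1) + (v - 1) + (u - 1) * (v - 1) by ring.
by apply: lexposD; [exact: lexposD|exact: lexposM].
Qed.

Lemma principalS n (u : laurent (iterL n A)) :
  principal (u : iterL n.+1 A) <-> order_ge 0 u /\ principal (u 0).
Proof.
rewrite /principal /=.
have o1 : order_ge 0 (1 : laurent (iterL n A)) by exact: order_ge_mono.
split=> -[u0 u0p]; split => //.
  by rewrite -[u](subrK 1); exact: order_geD.
by apply: order_geD => //; exact: order_geN.
Qed.

Lemma principal_const n (u : iterL n A) : principal u ->
  principal (lconst u : iterL n.+1 A).
Proof. by move=> up; apply/principalS; split=> //; exact: order_ge_mono. Qed.

Lemma principal_small n (f : laurent (iterL n A)) : order_ge 1 f ->
  principal (1 + f : iterL n.+1 A).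
Proof.
move=> f1; rewrite /principal addrC addKr; split; first exact: order_geW f1.
by rewrite f1//; exact: lexpos0.
Qed.

(** The outer constant term u_0 is inverted by induction; dividing by it leaves 1 - f with f of
    outer order at least 1, which the geometric series inverts. *)
Lemma principal_inv n (u : iterL n A) : principal u ->
  exists2 v : iterL n A, principal v & u * v = 1.
Proof.
elim: n u => [|n IH] u.
  by rewrite /principal /= => /eqP; rewrite subr_eq0 => /eqP ->; exists 1; rewrite ?mulr1 ?subrr.
move=> /principalS [u0 /IH[v vp uv]].
pose f : laurent (iterL n A) := 1 - u * lconst v.
have f1 : order_ge 1 f.
  have o0 : order_ge 0 (u * lconst v) by exact: (order_geM u0 (@order_ge_mono _ 0 v)).
  move=> k k1; rewrite lcoefD lcoefN lcoef_mono.
  case: eqP => [->|/eqP k0]; last by rewrite o0 ?subr0//; lia.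
  by rewrite mulrC lcoef_constM mulrC uv subrr.
have g1 : order_ge 1 (geometric f - 1).
  move=> k k1; rewrite lcoefD lcoefN [geometric f k]/=; case: (ltP k 0) => k0.
    by rewrite lcoef_mono lt_eqF// subr0.
  have -> : k = 0 by lia.
  by rewrite big_ord1 expr0 subrr.
exists (lconst v * geometric f).
  apply: principalM; first exact: principal_const.
  by rewrite -[geometric f](subrK 1) addrC; exact: principal_small.
have := geometricE f1; rewrite {1}/f opprB addrCA subrr addr0 -mulrA; exact.
Qed.

Lemma lexpos_coef n (h : iterL n A) l : lexpos h -> lexle l 0 -> coefL h l = 0.
Proof.
elim: n h l => [|n IH] h l; first by move=> /= ->.
move=> [h0 hp] [|[E lE]]; rewrite coefLS.
  by rewrite mxE => ln; rewrite h0// coefL0.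
by rewrite E mxE; apply: IH => //; rewrite -row'0.
Qed.

Lemma principal_coef_lt n (u : iterL n A) l : principal u -> lexlt l 0 -> coefL u l = 0.
Proof.
move=> up [le /eqP ne]; rewrite -[u](subrK 1) coefLD (lexpos_coef up le) add0r.
by rewrite -monoL01 coefL_mono (negPf ne).
Qed.

Lemma lexle_refl n (l : 'cV[int]_n) : lexle l l.
Proof. by elim: n l => //= n IH l; right. Qed.

Lemma principal_coef0 n (u : iterL n A) : principal u -> coefL u 0 = 1.
Proof.
move=> up; rewrite -[u](subrK 1) coefLD (lexpos_coef up) ?add0r; last exact: lexle_refl.
by rewrite -monoL01 coefL_mono eqxx.
Qed.

(** Topological nilpotence of h. Split h into h_0, constant in the outer variable, and h_1 of outer
    order at least 1. In the binomial expansion the terms with a high power of h_1 start beyond the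
    outer degree of l; the finitely many others contain a high power of h_0, to which the induction
    applies. *)
Lemma lexpos_expr_coef n (h x : iterL n A) l : lexpos h ->
  exists N0, forall N, (N0 <= N)%N -> coefL (h ^+ N * x) l = 0.
Proof.
elim: n h x l => [|n IH] h x l.
  by move=> /= ->; exists 1%N => -[//|N] _; rewrite expr0n mul0r.
move=> [h0 hp]; pose h1 : laurent (iterL n A) := ltail 1 h.
have hE : h = lconst (h 0) + h1.
  have := ltailE 1 h0; rewrite big_ord1 => {1}->.
  by [].
have [b xb] := order_ge_ex (x : laurent (iterL n A)).
set k := l ord_max 0; pose I := (absz (k - b)).+1.
have oh1 : order_ge 1 h1 by exact: order_ge_tail.
have h1i i : (I <= i)%N -> (h1 ^+ i * x : laurent (iterL n A)) k = 0.
  move=> Ii; apply: (order_geM (order_geX (n:=i) oh1) xb).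
  by rewrite -mulr_natl mulr1; move: Ii; rewrite /I; lia.
have /choice[M HM] (i : 'I_I) := IH (h 0) ((h1 ^+ i * x : laurent (iterL n A)) k) (row' ord_max l) hp.
exists (I + \max_i M i)%N => N NI; rewrite coefLS -/k {1}hE exprDn mulr_suml lcoef_sum coefL_sum.
rewrite big1// => i _.
rewrite mulrnAl lcoefMn coefLMn -mulrA -rmorphXn lcoef_constM.
have [iI|iI] := leqP I i; first by rewrite h1i// mulr0 coefL0 mul0rn.
rewrite (HM (Ordinal iI)) ?mul0rn//.
by have := leq_bigmax (F := M) (Ordinal iI); move: NI iI; lia.
Qed.

(** The coefficients of negative outer degree are nilpotent and the one of degree 0 is idempotent up
    to nilpotents, hence lifts to an idempotent eps. Then e (1 - eps) and eps (1 - e) are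
    idempotents without invertible part, so they vanish and e = eps; the induction handles eps. *)
Lemma idempotent_const n (e : iterL n A) : e * e = e ->
  exists2 a : A, a * a = a & e = constL n a.
Proof.
elim: n e => [|n IH] e ee; first by exists e.
have [M ea] := order_ge_nat (e : laurent (iterL n A)).
set a := - M%:Z in ea; pose c (i : int) := (e : laurent (iterL n A)) i.
(* Induction from the lowest degree: degree 2i of e e = e gives c_i^2 = c_(2i) up to nilpotents, and
   2i < i because i < 0. *)
have neg (i : int) : i < 0 -> nilpotent (c i).
  have [N] := ubnP (absz (i - a)); elim: N i => // N IHN i.
  have [ia|ai] := ltP i a; first by move=> _ _; rewrite /c ea//; exact: nilpotent0.
  move=> iN i0.
  have small j : j < i -> nilpotent (c j).
    move=> ji; have [ja|aj] := ltP j a; first by rewrite /c ea//; exact: nilpotent0.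
    by apply: IHN; lia.
  have := @nilpotent_lcoefM _ (e : laurent (iterL n A)) e i i; rewrite ee => H.
  apply: (@nilpotentX _ _ 2); rewrite expr2.
  rewrite -[c i * c i](subKr (c (i + i))); apply: nilpotentB; first by apply: small; lia.
  apply: H => j ji; have [h|h] := ltP j i; first by apply: nilpotentMr; exact: small.
  by apply: nilpotentMl; apply: small; move: ji h; lia.
have n0 : nilpotent (c 0 * (1 - c 0)).
  rewrite mulrBr mulr1; have := @nilpotent_lcoefM _ (e : laurent (iterL n A)) e 0 0; rewrite ee; apply.
  move=> j j0; have [h|h] := ltP j 0; first by apply: nilpotentMr; exact: neg.
  by apply: nilpotentMl; apply: neg; move: j0 h; lia.
have [eps [r [s [idem er es]]]] := lift_idempotent (subrKC _ _ : c 0 + (1 - c 0) = 1) n0.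
(* An idempotent z = nilpotent + (order at least 1) is zero: 1 - z is a product of a principal unit
   and a unipotent one, and z (1 - z) = 0. *)
have H0 (z : laurent (iterL n A)) y p : z * z = z -> z = y + p -> nilpotent y -> order_ge 1 p -> z = 0.
  move=> zz zE yn p1.
  have [v _ vE] := @principal_inv n.+1 _ (principal_small (order_geN p1)).
  have vyn : nilpotent (- (v * y)) by apply/nilpotentN/nilpotentMl.
  have [y' _ yE] := nilpotent_unit vyn.
  have z1 : z * (1 - z) = 0 by rewrite mulrBr mulr1 zz subrr.
  have inv : (1 - z) * (v * (1 + y')) = 1.
    rewrite zE.
    have -> : 1 - (y + p) = (1 + - p) * (1 + - (v * y)).
      rewrite mulrDr mulr1 mulrN mulrA vE mul1r; ring.
    by rewrite mulrACA vE mul1r.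
  by rewrite -[z]mulr1 -inv mulrA z1 mul0r.
pose E : laurent (iterL n A) := lconst eps.
have EE : E * E = E by rewrite -rmorphM idem.
pose ng : laurent (iterL n A) := \sum_(i < M) lmono (a + i%:Z) (c (a + i%:Z)).
pose ps : laurent (iterL n A) := ltail 1 (e : laurent (iterL n A)).
have ngn : nilpotent ng.
  apply: nilpotent_sum => i _; apply: nilpotent_lmono; apply: neg.
  by have := ltn_ord i; rewrite /a; lia.
have ps1 x : order_ge 1 (lconst x * ps).
  by move=> k k1; rewrite lcoef_constM order_ge_tail ?mulr0.
have eE : e = ng + lconst (c 0) + ps.
  rewrite -addrA (ltailE M ea) (_ : a + M%:Z = 0); last by rewrite /a addNr.
  congr (_ + _); have := ltailE 1 (@order_ge_tail _ 0 (e : laurent (iterL n A))).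
  rewrite big_ord1 => ->; congr (_ + _); apply: laurentP => k /=.
  by case: ifP => // /negbT; rewrite -leNgt => k1; rewrite ltNge (le_trans _ k1).
have e1 : e * (1 - E) = 0.
  apply: (H0 _ ((1 - E) * ng + lconst ((1 - eps) * c 0)) (lconst (1 - eps) * ps)) => //.
  - by rewrite mulrACA ee mulrBr mulr1 mulrBl mul1r EE subrr subr0.
  - by rewrite eE rmorphM rmorphB rmorph1; rewrite -/E; ring.
  apply: nilpotentD; first exact: nilpotentMl.
  apply: (nilpotent_rmorph (@lconst _)); rewrite es.
  have -> : (1 - c 0) * s * c 0 = c 0 * (1 - c 0) * s by ring.
  exact: nilpotentMr.
have e2 : E * (1 - e) = 0.
  apply: (H0 _ (lconst (eps * (1 - c 0)) - E * ng) (lconst (- eps) * ps)) => //.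
  - by rewrite mulrACA EE mulrBr mulr1 mulrBl mul1r ee subrr subr0.
  - by rewrite eE !(rmorphM, rmorphB, rmorphN, rmorph1); rewrite -/E; ring.
  apply: nilpotentB; last exact: nilpotentMl.
  apply: (nilpotent_rmorph (@lconst _)); rewrite er.
  have -> : c 0 * r * (1 - c 0) = c 0 * (1 - c 0) * r by ring.
  exact: nilpotentMr.
have eEE : e = E.
  have -> : e = e * E by apply/eqP; rewrite -subr_eq0 -{1}[e]mulr1 -mulrBr e1.
  by apply/eqP; rewrite eq_sym -subr_eq0 -{1}[E]mulr1 [e * E]mulrC -mulrBr e2.
by have [x xx xE] := IH eps idem; exists x => //; rewrite constLS -xE.
Qed.

End Principal.

(** * Units of constant valuation and the decomposition of arbitrary units *)

Section RegularUnits.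
Variable A : comPzRingType.

(* A unit whose valuation is constantly l. *)
Definition regular n (l : 'cV[int]_n) (f : iterL n A) :=
  exists c c' : A, exists u y : iterL n A,
    [/\ c * c' = 1, principal u, nilpotent y & f = monoL l c * u * (1 + y)].

Lemma regular_mono n (l : 'cV[int]_n) : regular l (monoL l 1 : iterL n A).
Proof.
exists 1, 1, 1, 0; rewrite !mulr1 addr0 mulr1; split => //; first exact: principal1.
exact: nilpotent0.
Qed.

Lemma regularM n (l l' : 'cV[int]_n) (f f' : iterL n A) :
  regular l f -> regular l' f' -> regular (l + l') (f * f').
Proof.
move=> [c [d [u [y [cd up yn ->]]]]] [c' [d' [u' [y' [cd' up' yn' ->]]]]].
exists (c * c'), (d * d'), (u * u'), (y + y' + y * y'); split.
- by rewrite mulrACA cd cd' mulr1.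
- exact: principalM.
- by apply: nilpotentD; [exact: nilpotentD|exact: nilpotentMl].
- by rewrite -monoLM; ring.
Qed.

Lemma regularV n (l : 'cV[int]_n) (f g : iterL n A) :
  f * g = 1 -> regular l f -> regular (- l) g.
Proof.
move=> fg [c [d [u [y [cd up yn fE]]]]].
have [v vp uv] := principal_inv up; have [y' yn' yE] := nilpotent_unit yn.
exists d, c, v, y'; split => //; first by rewrite mulrC.
have E : f * (monoL (- l) d * v * (1 + y')) = 1.
  transitivity ((monoL l c * monoL (- l) d) * (u * v) * ((1 + y) * (1 + y'))).
    by rewrite fE; ring.
  by rewrite uv yE !mulr1 monoLM cd subrr monoL01.
by rewrite -[LHS]mulr1 -[in LHS]E mulrA [g * f]mulrC fg mul1r.
Qed.

Lemma regular_unit n (l : 'cV[int]_n) (f : iterL n A) : regular l f -> exists g, f * g = 1.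
Proof.
move=> [c [d [u [y [cd up yn ->]]]]].
have [v vp uv] := principal_inv up; have [y' yn' yE] := nilpotent_unit yn.
exists (monoL (- l) d * v * (1 + y')).
transitivity ((monoL l c * monoL (- l) d) * (u * v) * ((1 + y) * (1 + y'))); first by ring.
by rewrite uv yE !mulr1 monoLM cd subrr monoL01.
Qed.

Lemma lexltB n (l l' : 'cV[int]_n) : lexlt l' l -> lexlt (l' - l) 0.
Proof.
move=> [le ne]; split; last by move/eqP; rewrite subr_eq0 => /eqP.
elim: n l l' le {ne} => //= n IH l l' [h|[h le]]; [left|right].
  by rewrite !mxE subr_lt0.
rewrite !mxE h subrr; split => //; rewrite row'B row'0; exact: IH.
Qed.

Lemma regular_coef_lt n (l l' : 'cV[int]_n) (f : iterL n A) :
  regular l f -> lexlt l' l -> nilpotent (coefL f l').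
Proof.
move=> [c [d [u [y [cd up yn ->]]]]] /lexltB lt.
rewrite -mulrA coefL_monoM; apply: nilpotentMl.
rewrite mulrDr mulr1 coefLD (principal_coef_lt up lt) add0r.
by apply: nilpotent_coefL; exact: nilpotentMl.
Qed.

Lemma regular_coef n (l : 'cV[int]_n) (f : iterL n A) :
  regular l f -> exists b, coefL f l * b = 1.
Proof.
move=> [c [d [u [y [cd up yn ->]]]]].
rewrite -mulrA coefL_monoM subrr mulrDr mulr1 coefLD (principal_coef0 up).
have [y' _ yE] : exists2 y', nilpotent y' & (1 + coefL (u * y) 0) * (1 + y') = 1.
  by apply: nilpotent_unit; apply: nilpotent_coefL; exact: nilpotentMl.
by exists (d * (1 + y')); rewrite mulrACA cd mul1r.
Qed.

(** With v inverse to r and w' inverse to 1 + vH, the bracket is r (1 + vH) (1 + vYw'): the positive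
    part joins the principal factor and Y the nilpotent one. *)
Lemma regular_outer n (k : int) (l : 'cV[int]_n) (r : iterL n A) (Y H : laurent (iterL n A)) :
  regular l r -> nilpotent Y -> order_ge 1 H ->
  regular (\col_i (if unlift ord_max i is Some j then l j 0 else k) : 'cV[int]_n.+1)
    (lmono k 1 * (lconst r + Y + H) : iterL n.+1 A).
Proof.
move=> rl Yn H1; have [v rv] := regular_unit rl.
have [c [d [u [y [cd up yn rE]]]]] := rl.
have vH1 : order_ge 1 (lconst v * H) by move=> j j1; rewrite lcoef_constM H1 ?mulr0.
have wp := principal_small vH1.
have [w' wp' wE] := @principal_inv A n.+1 _ wp.
exists c, d, (lconst u * (1 + lconst v * H)), (lconst y + (1 + lconst y) * (lconst v * Y * w')).
split=> //.
- by apply: (@principalM A n.+1) => //; exact: principal_const.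
- apply: nilpotentD; first exact: (nilpotent_rmorph (@lconst _)).
  by apply/nilpotentMl/nilpotentMr; exact: nilpotentMl.
have -> : monoL (\col_i (if unlift ord_max i is Some j then l j 0 else k)) c = 
   lmono k 1 * lconst (monoL l c) :> laurent (iterL n A).
  rewrite -lmonoE monoLS mxE unlift_none; congr (lmono _ (monoL _ _)).
  by apply/matrixP => i j; rewrite !mxE liftK (ord1 j).
rewrite -!mulrA; congr (_ * _).
have rE' : lconst r = lconst (monoL l c) * lconst u * (1 + lconst y).
  by rewrite rE !(rmorphM, rmorphD, rmorph1).
have rv' : lconst r * lconst v = 1 by rewrite -rmorphM rv.
transitivity (lconst r * (1 + lconst v * H) + lconst r * lconst v * Y * ((1 + lconst v * H) * w')).
  by rewrite wE rv' mul1r mulr1 mulrDr mulr1 mulrA rv' mul1r addrAC.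
by rewrite rE'; ring.
Qed.

(* Induction on i + j: the vanishing coefficient of degree i + j of f g, multiplied by f_i g_j, is
   (f_i g_j)^2 up to products involving terms of lower degree. *)
Lemma inverse_coef_nilpotent (R : comPzRingType) (f g : laurent R) : f * g = 1 ->
  forall i j : int, i + j < 0 -> nilpotent (f i * g j).
Proof.
move=> fg i j; have [a fa] := order_ge_ex f; have [b gb] := order_ge_ex g.
have [N] := ubnP (absz (i + j - a - b)%R); elim: N i j => // N IH i j ijN ij0.
have [ia|ai] := ltP i a; first by rewrite fa// mul0r; exact: nilpotent0.
have [jb|bj] := ltP j b; first by rewrite gb// mulr0; exact: nilpotent0.
have small i' j' : i' + j' < i + j -> nilpotent (f i' * g j').
  have [i'a _|ai'] := ltP i' a; first by rewrite fa// mul0r; exact: nilpotent0.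
  have [j'b _|bj'] := ltP j' b; first by rewrite gb// mulr0; exact: nilpotent0.
  by move=> lt; apply: IH; lia.
pose h := lconst (f i * g j) * f.
have := @nilpotent_lcoefM _ h g i j; rewrite -mulrA fg mulr1 lcoef_mono.
have -> : (i + j == 0) = false by lia.
rewrite lcoef_constM -mulrA sub0r => H.
apply: (@nilpotentX _ _ 2); rewrite expr2 -[_ * _]opprK; apply/nilpotentN/H => i' ii'.
rewrite lcoef_constM -mulrA.
have -> : f i * g j * (f i' * g (i + j - i')) = (f i * g (i + j - i')) * (f i' * g j) by ring.
have [h'|h'] := ltP i i'; first by apply: nilpotentMr; apply: small; lia.
by apply: nilpotentMl; apply: small; move: ii' h'; lia.
Qed.

(** The products f_i g_(-i) of outer coefficients add up to 1 and are pairwise orthogonal up to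
    nilpotents, so they lift to idempotents e_i. Over e_i the coefficient f_i is invertible and all
    lower ones are nilpotent: i is the outer valuation there, and the induction treats f_i. *)
Lemma unit_regular n (f g : iterL n A) : f * g = 1 ->
  exists (I : finType) (e : I -> A) (l : I -> 'cV[int]_n) (f' : I -> iterL n A),
  [/\ forall i j, i != j -> e i * e j = 0, \sum_i e i = 1 &
    forall i, regular (l i) (f' i) /\ constL n (e i) * f = constL n (e i) * f' i].
Proof.
elim: n f g => [|n IH] f g fg.
  exists unit, (fun=> 1), (fun=> 0), (fun=> f); split.
  - by case; case.
  - by rewrite (bigD1 tt)//= big1 ?addr0// => -[].
  case; split => //; exists f, g, 1, 0; split => //; first exact: principal1.
    exact: nilpotent0.
  by rewrite addr0 !mulr1.
have fg' : (f : laurent (iterL n A)) * g = 1 by [].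
have [a fa] := order_ge_ex (f : laurent (iterL n A)).
have [b gb] := order_ge_ex (g : laurent (iterL n A)).
(* The product f_i g_(-i) vanishes unless a <= i <= -b, so N indices starting at a exhaust the
   degree 0 coefficient of f g. *)
pose N := (absz (a + b)).+1.
pose F (i : int) := (f : laurent (iterL n A)) i; pose G (i : int) := (g : laurent (iterL n A)) i.
pose K (i : 'I_N) : int := a + i%:Z.
pose x (i : 'I_N) := F (K i) * G (- K i).
have Fnil := inverse_coef_nilpotent fg'.
have x1 : \sum_i x i = 1.
  have := @lcoefM_ord _ a b f g 0 N fa gb; rewrite fg' lcoef_mono eqxx => ->; last first.
    by rewrite /N; lia.
  by apply: eq_bigr => i _; rewrite sub0r.
have xn i j : i != j -> nilpotent (x i * x j).
  move=> ij; have -> : x i * x j = (F (K i) * G (- K j)) * (F (K j) * G (- K i)).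
    by rewrite /x; ring.
  have ijn : (i : nat) != j by [].
  have [h|h] := ltP (K i) (K j).
    by apply: nilpotentMr; apply: Fnil; lia.
  by apply: nilpotentMl; apply: Fnil; move: ijn h; rewrite /K; lia.
have [e [r [ee eo es er]]] := lift_idempotents x1 xn.
(* The lifted idempotents live in [iterL n A]; being constant, they come from idempotents of A. *)
have /choice[eps H] i : exists a : A, a * a = a /\ e i = constL n a.
  by have [z ? ?] := idempotent_const (ee i); exists z.
(* Filling in 1 off e_i makes a unit of the whole ring, to which the induction hypothesis
   applies. *)
pose u i := e i * F (K i) + (1 - e i).
pose v i := e i * (G (- K i) * r i) + (1 - e i).
have uv i : u i * v i = 1.
  rewrite /u /v.
  have -> : (e i * F (K i) + (1 - e i)) * (e i * (G (- K i) * r i) + (1 - e i)) =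
     (e i * e i) * (x i * r i) + (e i - e i * e i) * (F (K i) + G (- K i) * r i) + (1 - e i - e i + e i * e i).
    by rewrite /x; ring.
  by rewrite -er !ee subrr mul0r addr0 subrK addrC subrK.
(* The index type of the inner decomposition varies with i, so it is packed with its data before
   choosing. *)
have /choice[D HD] i : exists D : {J : finType & (J -> A) * (J -> 'cV[int]_n) * (J -> iterL n A)}%type,
    [/\ forall p q, p != q -> (tagged D).1.1 p * (tagged D).1.1 q = 0,
      \sum_p (tagged D).1.1 p = 1 & forall p, regular ((tagged D).1.2 p) ((tagged D).2 p) /\
      constL n ((tagged D).1.1 p) * u i = constL n ((tagged D).1.1 p) * (tagged D).2 p].
  have [J [e' [l' [f' H']]]] := IH (u i) (v i) (uv i).
  by exists (existT (fun J : finType => ((J -> A) * (J -> 'cV[int]_n) * (J -> iterL n A))%type) J (e', l', f')).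
pose J i := tag (D i); pose e' i : J i -> A := (tagged (D i)).1.1.
pose l' i : J i -> 'cV[int]_n := (tagged (D i)).1.2.
pose f' i : J i -> iterL n A := (tagged (D i)).2.
have H' i : [/\ forall p q, p != q -> e' i p * e' i q = 0, \sum_p e' i p = 1 &
    forall p, regular (l' i p) (f' i p) /\ constL n (e' i p) * u i = constL n (e' i p) * f' i p].
  exact: HD.
clearbody e' l' f'.
(* After division by t^(K i), Y collects the terms of f below degree K i and T those above. Y is
   nilpotent since e_i contains the factor g_(-K i), whose product with any lower coefficient of f
   is nilpotent. *)
pose Y i : laurent (iterL n A) := \sum_(j < `|K i - a|%N) lmono (a + j%:Z - K i) (e i * F (a + j%:Z)).
pose T i : laurent (iterL n A) := lmono (- K i) 1 * ltail (K i + 1) (f : laurent (iterL n A)).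
have Yn i : nilpotent (Y i).
  apply: nilpotent_sum => j _; apply: nilpotent_lmono.
  rewrite er /x mulrAC; apply: nilpotentMr.
  have -> : F (K i) * G (- K i) * F (a + j%:Z) = (F (a + j%:Z) * G (- K i)) * F (K i) by ring.
  by apply: nilpotentMr; apply: Fnil; have := ltn_ord j; rewrite /K; lia.
have T1 i : order_ge 1 (T i).
  by move=> k k1; rewrite lcoef_monoM order_ge_tail ?mulr0//; lia.
exists {i : 'I_N & J i}, (fun p => eps (tag p) * e' _ (tagged p)),
  (fun p => \col_i (if unlift ord_max i is Some j then l' _ (tagged p) j 0 else K (tag p))),
  (fun p => lmono (K (tag p)) 1 * (lconst (f' _ (tagged p)) + Y (tag p) + T (tag p))).
have epso i j : i != j -> eps i * eps j = 0.
  move=> /eo; have [_ ->] := H i; have [_ ->] := H j.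
  by rewrite -rmorphM => h; apply: (@constL_inj A n); rewrite h rmorph0.
split.
- move=> [i p] [j q] /= ne; have [ij|ij] := eqVneq i j; last first.
    by rewrite mulrACA epso ?mul0r.
  case: _ / ij in q ne *; rewrite mulrACA; have [o _ _] := H' i; rewrite o ?mulr0//.
  by apply: contra ne => /eqP ->.
- rewrite -(sig_big_dep xpredT (fun i => xpredT) (fun i p => eps i * e' i p)) /=.
  transitivity (\sum_i eps i).
    by apply: eq_bigr => i _; rewrite -mulr_sumr; have [_ -> _] := H' i; rewrite mulr1.
  apply: (@constL_inj A n); rewrite rmorph_sum rmorph1 -es.
  by apply: eq_bigr => i _; have [_ ->] := H i.
move=> [i p] /=; have [_ _ H'i] := H' i; have [reg eu] := H'i p; split.
  by apply: regular_outer.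
set E := constL n.+1 _; pose E0 : laurent (iterL n A) := E.
have [_ epsE] := H i.
have EE : E0 = lconst (constL n (e' i p)) * lconst (e i).
  by rewrite /E0 /E constLS epsE -[RHS]rmorphM -rmorphM mulrC.
pose fl : laurent (iterL n A) := f.
suff : E0 * fl = E0 * (lmono (K i) 1 * (lconst (f' i p) + Y i + T i)) by [].
have Ee : E0 * lconst (e i) = E0 by rewrite EE -mulrA -rmorphM ee.
have Ef : E0 * lconst (f' i p) = E0 * lconst (F (K i)).
  rewrite {1}EE mulrAC -rmorphM -eu rmorphM mulrAC -EE.
  rewrite /u rmorphD rmorphB rmorph1 mulrDr rmorphM mulrA Ee mulrBr mulr1 Ee subrr addr0.
  by [].
have EY : lmono (K i) 1 * Y i =
    lconst (e i) * \sum_(j < `|K i - a|%N) lmono (a + j%:Z) (F (a + j%:Z)).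
  rewrite !mulr_sumr; apply: eq_bigr => j _.
  by rewrite !lmonoM mul1r add0r subrKC.
have ET : lmono (K i) 1 * T i = ltail (K i + 1) fl.
  by rewrite mulrA lmonoM subrr mulr1 mul1r.
have fE : fl = \sum_(j < `|K i - a|%N) lmono (a + j%:Z) (F (a + j%:Z)) +
    (lmono (K i) 1 * lconst (F (K i)) + ltail (K i + 1) fl).
  rewrite {1}(@ltailE _ a `|K i - a|%N fl fa); congr (_ + _).
  have -> : a + `|K i - a|%N = K i by rewrite /K; lia.
  rewrite -lmonoE.
  have := ltailE 1 (@order_ge_tail _ (K i) fl); rewrite big_ord1 addr0 => ->; congr (_ + _).
    by rewrite /= ltxx.
  apply: laurentP => k /=.
  by case: ifP => // /negbT; rewrite -leNgt => k1; rewrite ltNge (le_trans _ k1)// lerDl.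
have -> : lmono (K i) 1 * (lconst (f' i p) + Y i + T i) = lmono (K i) 1 * lconst (f' i p) +
    lconst (e i) * (\sum_(j < `|K i - a|%N) lmono (a + j%:Z) (F (a + j%:Z))) + ltail (K i + 1) fl.
  by rewrite !mulrDr EY ET.
rewrite {1}fE !mulrDr [E0 * (_ * lconst (f' i p))]mulrCA Ef [E0 * (lconst _ * _)]mulrA Ee.
by rewrite [E0 * (_ * lconst (F _))]mulrCA addrA [X in X + _]addrC.
Qed.
End RegularUnits.

(** * Closed 1-forms and residues of exact forms *)

Section ClosedForms.
Variable A : comPzRingType.
Variable m : nat.
Local Notation K := (iterL m A).
Implicit Types (f g : K) (u v : 'rV[K]_m) (M : 'M[K]_m).
Local Notation D := (pderiv A).
Local Notation grad := (@omega1_grad m A).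

(** A row holds the coefficients of a 1-form on dt_1, ..., dt_m; the condition is the vanishing of
    its exterior derivative. *)
Definition closed_row u := forall a b, D a (u 0 b) = D b (u 0 a).

Lemma gradD f g : grad (f + g) = grad f + grad g.
Proof. by apply/rowP => i; rewrite !mxE raddfD. Qed.

Lemma gradN f : grad (- f) = - grad f.
Proof. by apply/rowP => i; rewrite !mxE raddfN. Qed.

Lemma gradM f g : grad (f * g) = f *: grad g + g *: grad f.
Proof. by apply/rowP => i; rewrite !mxE pderivM. Qed.

Lemma grad_const (a : A) : grad (constL m a) = 0.
Proof. by apply/rowP => i; rewrite !mxE pderiv_const. Qed.

Lemma grad1 : grad 1 = 0.
Proof. by rewrite -monoL01; exact: grad_const. Qed.

Lemma gradX f k : grad (f ^+ k.+1) = (f ^+ k *: grad f) *+ k.+1.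
Proof.
elim: k => [|k IH]; first by rewrite expr1 expr0 scale1r.
by rewrite exprS gradM IH -scalerMnr scalerA -exprS -mulrSr.
Qed.

Lemma pderiv1 i : D i (1 : K) = 0.
Proof. by have /rowP/(_ i) := grad1; rewrite !mxE. Qed.

Lemma closed_row0 : closed_row 0.
Proof. by move=> a b; rewrite !mxE !raddf0. Qed.

Lemma closed_rowD u v : closed_row u -> closed_row v -> closed_row (u + v).
Proof. by move=> uc vc a b; rewrite !mxE !raddfD/= uc vc. Qed.

Lemma closed_rowN u : closed_row u -> closed_row (- u).
Proof. by move=> uc a b; rewrite !mxE !raddfN/= uc. Qed.

Lemma closed_rowZ (a : A) u : closed_row u -> closed_row (constL m a *: u).
Proof.
by move=> uc i j; rewrite !mxE !pderivM !pderiv_const !mulr0 !addr0 uc.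
Qed.

Lemma pderivX i f k : D i (f ^+ k.+1) = (f ^+ k * D i f) *+ k.+1.
Proof. by have /rowP/(_ i) := gradX f k; rewrite mulmxnE !mxE. Qed.

Lemma closed_row_pow f k : closed_row (f ^+ k *: grad f).
Proof.
move=> a b; rewrite !mxE !pderivM pderivC; congr (_ + _).
case: k => [|k]; first by rewrite expr0 !pderiv1 !mulr0.
by rewrite !pderivX !mulrnAr; congr (_ *+ _); ring.
Qed.

Lemma closed_row_dlog f g : f * g = 1 -> closed_row (g *: grad f).
Proof.
have dg i : f * g = 1 -> D i g = - (g * g * D i f).
  move=> fg; have := pderivM i f g; rewrite fg pderiv1 => /esym/eqP.
  rewrite addr_eq0 => /eqP E; rewrite -[LHS]mul1r -fg mulrAC E; ring.
move=> fg a b; rewrite !mxE !pderivM pderivC !dg//; congr (_ + _); ring.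
Qed.

Definition setrow (j : 'I_m) v M : 'M[K]_m := \matrix_(i, k) (if i == j then v 0 k else M i k).

Lemma row_setrow j v M : row j (setrow j v M) = v.
Proof. by apply/rowP => k; rewrite !mxE eqxx. Qed.

Lemma row'_setrow j v w M : row' j (setrow j v M) = row' j (setrow j w M).
Proof. by apply/matrixP => i k; rewrite !mxE eq_sym (negPf (neq_lift _ _)). Qed.

Lemma setrow_id j M : setrow j (row j M) M = M.
Proof. by apply/matrixP => i k; rewrite !mxE; case: eqP => [->|]. Qed.

Lemma det_setrow_lin j v w M (a : K) :
  \det (setrow j (a *: v + w) M) = a * \det (setrow j v M) + \det (setrow j w M).
Proof.
rewrite (@determinant_multilinear _ _ _ (setrow j v M) (setrow j w M) j a 1) ?mul1r//.
- by rewrite !row_setrow scale1r.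
- exact: row'_setrow.
- exact: row'_setrow.
Qed.

Lemma det_setrow0 j M : \det (setrow j 0 M) = 0.
Proof.
have := det_setrow_lin j 0 0 M 1; rewrite scaler0 addr0 mul1r => /eqP.
by rewrite eq_sym -subr_eq0 addrK => /eqP.
Qed.

Lemma det_setrowD j v w M : \det (setrow j (v + w) M) = \det (setrow j v M) + \det (setrow j w M).
Proof. by have := det_setrow_lin j v w M 1; rewrite scale1r mul1r. Qed.

Lemma det_setrowZ j v M (a : K) : \det (setrow j (a *: v) M) = a * \det (setrow j v M).
Proof. by have := det_setrow_lin j v 0 M a; rewrite addr0 det_setrow0 addr0. Qed.

Lemma det_setrowN j v M : \det (setrow j (- v) M) = - \det (setrow j v M).
Proof. by rewrite -scaleN1r det_setrowZ mulN1r. Qed.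

Lemma det_setrow_sum j (I : Type) (r : seq I) (F : I -> 'rV[K]_m) M :
  \det (setrow j (\sum_(i <- r) F i) M) = \sum_(i <- r) \det (setrow j (F i) M).
Proof. exact: (big_morph (fun v => \det (setrow j v M)) (fun v w => det_setrowD j v w M) (det_setrow0 j M)). Qed.

Lemma pderiv_prod i (I : eqType) (r : seq I) (F : I -> K) : uniq r ->
  D i (\prod_(k <- r) F k) =
  \sum_(k <- r) D i (F k) * \prod_(l <- r | l != k) F l.
Proof.
elim: r => [|a r IH] /=; first by rewrite !big_nil pderiv1.
move=> /andP[ar ur]; rewrite !big_cons eqxx /= pderivM IH// addrC mulrC; congr (_ * _ + _).
  rewrite big_seq [RHS]big_seq_cond; apply: eq_bigl => l.
  by case lr: (l \in r) => //=; case: eqP => // E; rewrite -E lr in ar.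
rewrite mulr_sumr !big_seq; apply: eq_bigr => k kr.
rewrite big_cons; case: eqP => [E|_]; first by rewrite E kr in ar.
by rewrite mulrCA.
Qed.

Lemma iterL_torsion_free : torsion_free A -> torsion_free K.
Proof. by move=> tf k f fk; apply: coefLP => l; rewrite coefL0; apply: (tf k); rewrite -coefLMn fk coefL0. Qed.

(* Leibniz expansion: d f ^ (closed forms) is a sum of partial derivatives, up to a sum that the
   transposition of two columns shows to be equal to its opposite. *)
Lemma res_exact j f M : torsion_free A -> (forall k, k != j -> closed_row (row k M)) ->
  coefL (\det (setrow j (grad f) M)) (const_mx (-1)) = 0.
Proof.
move=> tf Mc; pose P (s : 'S_m) := \prod_(k | k != j) M k (s k).
pose S := \sum_(s : 'S_m) (-1) ^+ s * D (s j) (P s).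
have S0 : S = 0.
  pose r := [seq k <- index_enum 'I_m | k != j].
  have ur : uniq r by rewrite filter_uniq// index_enum_uniq.
  pose Q k (s : 'S_m) := D (s j) (M k (s k)) * \prod_(l <- r | l != k) M l (s l).
  have -> : S = \sum_(k <- r) \sum_(s : 'S_m) (-1) ^+ s * Q k s.
    rewrite exchange_big /=; apply: eq_bigr => s _.
    by rewrite /P -big_filter pderiv_prod// mulr_sumr.
  rewrite big_seq big1// => k; rewrite mem_filter => /andP[kj _].
  set X := \sum_(s : 'S_m) _.
  suff XN : X = - X.
    by apply: (@iterL_torsion_free tf 1); rewrite mulr2n {1}XN addNr.
  rewrite {1}/X (reindex_inj (mulgI (tperm j k))) /= -sumrN; apply: eq_bigr => s _.
  rewrite odd_permM odd_tperm eq_sym kj signr_addb expr1 mulN1r mulNr; congr (- (_ * _)).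
  rewrite /Q !permM tpermL tpermR; congr (_ * _).
    by have := Mc k kj (s k) (s j); rewrite !mxE.
  rewrite big_seq_cond [RHS]big_seq_cond; apply: eq_bigr => l /andP[].
  by rewrite mem_filter => /andP[lj _] lk; rewrite permM tpermD// eq_sym.
have -> : \det (setrow j (grad f) M) = \sum_(s : 'S_m) D (s j) ((-1) ^+ s * (f * P s)) - f * S.
  rewrite mulr_sumr -sumrB; apply: eq_bigr => s _.
  have -> : D (s j) ((-1) ^+ s * (f * P s)) = (-1) ^+ s * D (s j) (f * P s).
    by rewrite !mulr_sign; case: (s : bool); rewrite ?raddfN.
  rewrite pderivM mulrDr mulrCA addrAC subrr add0r; congr (_ * _).
  rewrite (bigD1 j)//= !mxE eqxx mulrC; congr (_ * _).
  by apply: eq_bigr => k kj; rewrite !mxE (negPf kj).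
rewrite S0 mulr0 subr0 coefL_sum big1// => s _; exact: coefL_pderiv_res.
Qed.

Lemma res_pow_exact j f k M : torsion_free A -> (forall i, i != j -> closed_row (row i M)) ->
  coefL (\det (setrow j (f ^+ k *: grad f) M)) (const_mx (-1)) = 0.
Proof.
move=> tf Mc; apply: (tf k).
by rewrite -coefLMn -mulr_natl -det_setrowZ scaler_nat -gradX; exact: res_exact.
Qed.

End ClosedForms.

(** * Change of coefficient ring *)

Lemma lmap_monoid_morphism (R S : comPzRingType) (h : {rmorphism R -> S}) : monoid_morphism (lmap h).
Proof.
split=> [|f g]; apply: laurentP => k.
  by rewrite /= /lmap_fun /=; case: eqP; rewrite ?rmorph1 ?rmorph0.
have [a fa] := order_ge_ex f; have [b gb] := order_ge_ex g.
pose n := (absz (k - a - b)%R).+1.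
have fa' : order_ge a (lmap h f) by move=> j ja; rewrite /= /lmap_fun fa ?rmorph0.
have gb' : order_ge b (lmap h g) by move=> j jb; rewrite /= /lmap_fun gb ?rmorph0.
rewrite (@lcoefM_ord _ a b _ _ k n fa' gb'); last by rewrite /n; lia.
transitivity (h ((f * g) k)); first by [].
rewrite (@lcoefM_ord _ a b _ _ k n fa gb); last by rewrite /n; lia.
by rewrite rmorph_sum; apply: eq_bigr => i _; rewrite rmorphM.
Qed.
HB.instance Definition _ (R S : comPzRingType) (h : {rmorphism R -> S}) :=
  GRing.isMonoidMorphism.Build (laurent R) (laurent S) (lmap h) (lmap_monoid_morphism h).

Section CoefficientMap.
Variables (B A : comPzRingType) (p : {rmorphism B -> A}).

Fixpoint mapL (n : nat) : {rmorphism iterL n B -> iterL n A} :=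
  match n return {rmorphism iterL n B -> iterL n A} with
  | 0 => p
  | k.+1 => lmap (mapL k)
  end.

Lemma coefL_mapL n (f : iterL n B) l : coefL (mapL n f) l = p (coefL f l).
Proof. by elim: n f l => //= n IH f l; rewrite -IH. Qed.

Lemma mapL_mono n l (b : B) : mapL n (monoL l b) = monoL l (p b).
Proof. by apply: coefLP => l'; rewrite coefL_mapL !coefL_mono; case: eqP; rewrite ?rmorph0. Qed.

Lemma mapL_const n (b : B) : mapL n (constL n b) = constL n (p b).
Proof. exact: mapL_mono. Qed.

Lemma mapL_pderiv n i (f : iterL n B) : mapL n (pderiv B i f) = pderiv A i (mapL n f).
Proof. by apply: coefLP => l; rewrite coefL_mapL !coefL_pderiv coefL_mapL rmorphMz. Qed.

Lemma mapL_grad n (f : iterL n B) : map_mx (mapL n) (omega1_grad f) = omega1_grad (mapL n f).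
Proof. by apply/rowP => i; rewrite !mxE mapL_pderiv. Qed.

Hypothesis p_surj : forall a, exists b, p b = a.

(** Lift coefficient by coefficient. The clause on 0 has to be part of the induction: it bounds the
    support of the lift from below and keeps lex-positivity. *)
Lemma mapL_lift n (f : iterL n A) : exists g : iterL n B,
  [/\ mapL n g = f, f = 0 -> g = 0 & lexpos f -> lexpos g].
Proof.
elim: n f => [|n IH] f.
  have [->|f0] := eqVneq f 0; first by exists 0; rewrite rmorph0.
  by have [b pb] := p_surj f; exists b; split => // f0'; rewrite f0' eqxx in f0.
have /choice[s sP] := IH.
have s0 : s 0 = 0 by have [_ + _] := sP 0; apply.
have bd : exists N : int, forall k, k < N -> s ((f : laurent (iterL n A)) k) = 0.
  by have [N fN] := order_ge_ex (f : laurent (iterL n A)); exists N => k /fN ->.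
exists (MkLaurent bd); split.
- by apply: laurentP => k /=; rewrite /lmap_fun /=; have [] := sP ((f : laurent (iterL n A)) k).
- by move=> f0; apply: laurentP => k /=; rewrite f0.
move=> [o fp]; split; last by have [_ _ /=] := sP ((f : laurent (iterL n A)) 0); apply.
by move=> k k0 /=; rewrite o.
Qed.

Lemma mapL_surj n (f : iterL n A) : exists g, mapL n g = f.
Proof. by have [g [? _ _]] := mapL_lift f; exists g. Qed.

Lemma mapL_principal n (u : iterL n A) : principal u -> exists2 v : iterL n B, principal v & mapL n v = u.
Proof.
move=> up; have [h [hE _ hp]] := mapL_lift (u - 1).
exists (1 + h); first by rewrite /principal addrC addKr; exact: hp.
by rewrite rmorphD rmorph1 hE addrC subrK.
Qed.

End CoefficientMap.

(** * Forms that lift to closed forms over a torsion-free ring *)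

Section LiftableForms.
Variables (B A : comPzRingType) (p : {rmorphism B -> A}).
Hypotheses (p_surj : forall a, exists b, p b = a) (B_tf : torsion_free B).
Variable m : nat.
Local Notation K := (iterL m A).
Local Notation grad := (@omega1_grad m A).
Implicit Types (f g : K) (u v : 'rV[K]_m) (M : 'M[K]_m).

(** Closedness over A itself would not do: in characteristic p the form x^(-p) dy/y is closed, yet
    x^(p-1) dx /\ x^(-p) dy/y has residue 1. *)
Definition liftable u := exists2 v, closed_row v & map_mx (mapL p m) v = u.

Lemma liftable0 : liftable 0.
Proof. by exists 0; [exact: closed_row0|rewrite map_mx0]. Qed.

Lemma liftableD u v : liftable u -> liftable v -> liftable (u + v).
Proof.
move=> [u' uc <-] [v' vc <-]; exists (u' + v'); first exact: closed_rowD.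
by rewrite map_mxD.
Qed.

Lemma liftableN u : liftable u -> liftable (- u).
Proof. by move=> [u' uc <-]; exists (- u'); rewrite ?map_mxN//; exact: closed_rowN. Qed.

Lemma liftableZ a u : liftable u -> liftable (constL m a *: u).
Proof.
move=> [u' uc <-]; have [b <-] := p_surj a; exists (constL m b *: u'); first exact: closed_rowZ.
by rewrite map_mxZ /= mapL_const.
Qed.

Lemma liftable_sum (I : Type) (r : seq I) (F : I -> 'rV[K]_m) :
  (forall i, liftable (F i)) -> liftable (\sum_(i <- r) F i).
Proof. by move=> H; apply: big_ind => //; [exact: liftable0|exact: liftableD]. Qed.

Lemma liftableMz u (k : int) : liftable u -> liftable (u *~ k).
Proof. by move=> ul; rewrite -scaler_int -(rmorph_int (@constL m A)); exact: liftableZ. Qed.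

Lemma liftable_pow f k : liftable (f ^+ k *: grad f).
Proof.
have [g <-] := mapL_surj p_surj f; exists (g ^+ k *: omega1_grad g).
  exact: closed_row_pow.
by rewrite map_mxZ mapL_grad rmorphXn.
Qed.

Lemma dlogM f f' g g' : f * f' = 1 -> g * g' = 1 ->
  (f' * g') *: grad (f * g) = f' *: grad f + g' *: grad g.
Proof.
move=> ff gg; rewrite gradM scalerDr !scalerA addrC; congr (_ *: _ + _ *: _).
  by rewrite -mulrA [g' * g]mulrC gg mulr1.
by rewrite mulrAC [f' * f]mulrC ff mul1r.
Qed.

Lemma inverse_unique f g g' : f * g = 1 -> f * g' = 1 -> g = g'.
Proof. by move=> fg fg'; rewrite -[LHS]mulr1 -fg' mulrA [g * f]mulrC fg mul1r. Qed.

Lemma liftable_dlog_lift (w w' : iterL m B) g : w * w' = 1 ->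
  mapL p m w * g = 1 -> liftable (g *: grad (mapL p m w)).
Proof.
move=> ww wg; exists (w' *: omega1_grad w); first exact: closed_row_dlog.
rewrite map_mxZ mapL_grad; congr (_ *: _); apply: (inverse_unique _ wg).
by rewrite -rmorphM ww rmorph1.
Qed.

Lemma one_sub_inverse (q v : K) N : (1 - q) * v = 1 -> v = \sum_(i < N) q ^+ i + q ^+ N * v.
Proof.
move=> qv; have := subrX1 q N => E.
have -> : \sum_(i < N) q ^+ i = (1 - q ^+ N) * v.
  by rewrite -[1 - _]opprB E -[q - 1]opprB !mulNr opprK mulrAC qv mul1r.
by rewrite mulrBl mul1r subrK.
Qed.

(** The logarithmic differential is additive over the factors of f. The constant contributes 0, and
    t^l u lifts to a unit because principal units do; 1 + y needs a separate treatment. *)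
Lemma liftable_regular_dlog l f g : regular l f -> f * g = 1 -> liftable (g *: grad f).
Proof.
move=> [c [d [u [y [cd up yn fE]]]]] fg.
have [v vp uv] := principal_inv up; have [y' yn' yE] := nilpotent_unit yn.
have gE : g = constL m d * ((monoL (- l) 1 * v) * (1 + y')).
  apply: (inverse_unique fg); rewrite fE monoLE.
  transitivity ((constL m c * constL m d) * (monoL l 1 * monoL (- l) 1) * (u * v) * ((1 + y) * (1 + y'))).
    by ring.
  by rewrite -rmorphM cd rmorph1 monoLM subrr mulr1 monoL01 uv yE !mulr1.
have fE' : f = constL m c * ((monoL l 1 * u) * (1 + y)) by rewrite fE monoLE !mulrA.
have cd1 : constL m c * constL m d = 1 by rewrite -rmorphM cd rmorph1.
have lu : (monoL l 1 * u) * (monoL (- l) 1 * v) = 1 by rewrite mulrACA monoLM subrr uv !mulr1 monoL01.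
rewrite gE fE' dlogM//; last by rewrite mulrACA lu yE mulr1.
rewrite grad_const scaler0 add0r dlogM//; apply: liftableD.
  have [u1 up1 uE] := mapL_principal p_surj up.
  have [v1 vp1 uv1] := principal_inv up1.
  have wE : monoL l 1 * u = mapL p m (monoL l 1 * u1) by rewrite rmorphM mapL_mono rmorph1 uE.
  rewrite wE; apply: (@liftable_dlog_lift _ (monoL (- l) 1 * v1)); last by rewrite -wE.
  by rewrite mulrACA monoLM subrr uv1 !mulr1 monoL01.
(* A lift of 1 + y may fail to be a unit, so its inverse is expanded into the finite sum of the
   (-y)^i, and each (-y)^i dy lifts separately. *)
have [N yN] := yn.
have -> : 1 + y' = \sum_(i < N) (- y) ^+ i.
  rewrite (@one_sub_inverse (- y) (1 + y') N) ?opprK//.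
  by rewrite exprNn yN mulr0 mul0r addr0.
rewrite scaler_suml; apply: liftable_sum => i; rewrite gradD grad1 add0r -[y in grad y]opprK gradN scalerN.
by apply: liftableN; exact: liftable_pow.
Qed.

Local Notation res0 x := (coefL x (const_mx (-1))).

Lemma res_pow j f k M : (forall i, i != j -> liftable (row i M)) ->
  res0 (\det (setrow j (f ^+ k *: grad f) M)) = 0.
Proof.
move=> Ml; have /choice[r Hr] i : exists v : 'rV[iterL m B]_m,
    i != j -> closed_row v /\ map_mx (mapL p m) v = row i M.
  (* Row j gets a dummy lift, since [setrow] overwrites it. *)
  have [->|ij] := eqVneq i j; first by exists 0.
  by have [v vc vE] := Ml i ij; exists v.
have [g gE] := mapL_surj p_surj f.
pose M' := \matrix_i r i.
have -> : setrow j (f ^+ k *: grad f) M = map_mx (mapL p m) (setrow j (g ^+ k *: omega1_grad g) M').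
  apply/matrixP => i l; rewrite !mxE; case: eqP => [_|/eqP ij].
    by rewrite rmorphM rmorphXn /= mapL_pderiv gE.
  by have [_ /rowP/(_ l)] := Hr i ij; rewrite !mxE.
rewrite det_map_mx coefL_mapL res_pow_exact ?rmorph0// => i ij.
by rewrite rowK; have [] := Hr i ij.
Qed.

(** Expand 1/(1 - q) to order N: the terms q^i dq have no residue by [res_pow], and N is chosen to
    kill the remainder. The smallness hypothesis covers both a nilpotent q and a lex-positive
    one. *)
Lemma res_one_sub j (q v : K) M : (1 - q) * v = 1 -> (forall i, i != j -> liftable (row i M)) ->
  (forall x : K, exists N, res0 (q ^+ N * x) = 0) ->
  res0 (\det (setrow j (v *: grad (1 - q)) M)) = 0.
Proof.
move=> qv Ml small; have [N HN] := small (\det (setrow j (v *: grad q) M)).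
rewrite gradD grad1 add0r gradN scalerN det_setrowN coefLN.
rewrite (one_sub_inverse N qv) scalerDl det_setrowD scaler_suml det_setrow_sum -scalerA det_setrowZ.
by rewrite coefLD coefL_sum HN addr0 big1 ?oppr0// => i _; exact: res_pow.
Qed.

Lemma res_regular_dlog j l f g M : regular l f -> f * g = 1 ->
  (forall i, i != j -> liftable (row i M)) ->
  res0 (\det (setrow j (g *: grad f) M)) =
  res0 (\det (setrow j (monoL (- l) 1 *: grad (monoL l 1)) M)).
Proof.
move=> [c [d [u [y [cd up yn fE]]]]] fg Ml.
have [v vp uv] := principal_inv up; have [y' yn' yE] := nilpotent_unit yn.
have cd1 : constL m c * constL m d = 1 by rewrite -rmorphM cd rmorph1.
have ll : monoL l 1 * monoL (- l) 1 = 1 :> K by rewrite monoLM subrr mulr1 monoL01.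
have fE' : f = constL m c * (monoL l 1 * (u * (1 + y))) by rewrite fE monoLE !mulrA.
have gE : g = constL m d * (monoL (- l) 1 * (v * (1 + y'))).
  apply: (inverse_unique fg); rewrite fE'.
  transitivity ((constL m c * constL m d) * (monoL l 1 * monoL (- l) 1) * (u * v) * ((1 + y) * (1 + y'))).
    by ring.
  by rewrite cd1 ll uv yE !mulr1.
have uy : (u * (1 + y)) * (v * (1 + y')) = 1 by rewrite mulrACA uv yE mulr1.
rewrite gE fE' dlogM//; last by rewrite mulrACA ll uy mulr1.
rewrite grad_const scaler0 add0r dlogM// dlogM// !det_setrowD !coefLD.
rewrite [X in _ + (X + _)](_ : _ = 0) ?add0r; last first.
  have E : u = 1 - (1 - u) by rewrite opprB addrC subrK.
  rewrite [in grad u]E; apply: res_one_sub => //; first by rewrite -E.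
  move=> x; have [N HN] := lexpos_expr_coef x (const_mx (-1)) up.
  exists N; rewrite -[1 - u]opprB exprNn -mulrA -signr_odd mulr_sign.
  by case: odd; rewrite ?coefLN HN ?oppr0.
rewrite [X in _ + X](_ : _ = 0) ?addr0//.
have E : 1 + y = 1 - (- y) by rewrite opprK.
rewrite [in grad _]E; apply: res_one_sub => //; first by rewrite -E.
by move=> x; have [N yN] := yn; exists N; rewrite exprNn yN mulr0 mul0r coefL0.
Qed.

(** Entry j of t^(-l) d(t^l) is l_j / t_j, so the matrix is an integer matrix times the diagonal one
    with entries 1/t_j, whose determinant is the monomial read by the residue. *)
Lemma det_dlog_mono (l : 'I_m -> 'cV[int]_m) :
  res0 (\det (\matrix_i (monoL (- l i) 1 *: grad (monoL (l i) 1)))) =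
  (\det (\matrix_(i, j) l i j 0))%:~R.
Proof.
pose d : 'rV[K]_m := \row_j monoL (- delta_mx j 0) 1.
have -> : \matrix_i (monoL (- l i) 1 *: grad (monoL (l i) 1)) =
    map_mx intr (\matrix_(i, j) l i j 0) *m diag_mx d.
  apply/matrixP => i j; rewrite mul_mx_diag !mxE pderiv_mono mulrzAr monoLM mulr1.
  by rewrite addrA addNr add0r mulrzl.
rewrite det_mulmx det_diag det_map_mx.
have -> : \prod_j d 0 j = monoL (const_mx (-1)) 1.
  transitivity (monoL (\sum_(j < m) - delta_mx j 0) 1 : K).
    rewrite (big_morph (fun l => monoL l 1 : K) (id1 := 1) (op1 := *%R)).
    - by apply: eq_bigr => j _; rewrite mxE.
    - by move=> x y; rewrite monoLM mulr1.
    - exact: monoL01.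
  congr (monoL _ _); apply/colP => i; rewrite summxE (bigD1 i)//= big1 ?addr0 ?mxE ?eqxx// => j ji.
  by rewrite !mxE eq_sym (negPf ji) oppr0.
rewrite mulrzl coefLMz coefL_mono eqxx //.
Qed.

Lemma res_det_dlog (l : 'I_m -> 'cV[int]_m) (f g : 'I_m -> K) :
  (forall i, regular (l i) (f i)) -> (forall i, f i * g i = 1) ->
  res0 (\det (\matrix_i (g i *: grad (f i)))) = (\det (\matrix_(i, j) l i j 0))%:~R.
Proof.
move=> fr fg; rewrite -det_dlog_mono.
pose dl i := monoL (- l i) 1 *: grad (monoL (l i) 1).
(* Interpolates between the two matrices: the first k rows are already monomial, and one row is
   changed at a time. *)
pose X k := \matrix_i (if (i < k)%N then dl i else g i *: grad (f i)).
have -> : \matrix_i (g i *: grad (f i)) = X 0%N by apply/matrixP => i j; rewrite !mxE.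
have -> : \matrix_i (monoL (- l i) 1 *: grad (monoL (l i) 1)) = X m.
  by apply/row_matrixP => i; rewrite !rowK ltn_ord.
have lX k i : liftable (row i (X k)).
  rewrite rowK; case: ifP => _; last exact: liftable_regular_dlog (fr i) (fg i).
  apply: (liftable_regular_dlog (regular_mono A (l i))).
  by rewrite monoLM subrr mulr1 monoL01.
suff H k : (k <= m)%N -> res0 (\det (X 0%N)) = res0 (\det (X k)) by exact: H.
elim: k => // k IH km; rewrite IH; last exact: ltnW.
pose j := Ordinal km.
have E : X k = setrow j (g j *: grad (f j)) (X k).
  by rewrite -[LHS](setrow_id j) rowK ltnn.
rewrite E (res_regular_dlog (fr j) (fg j))//; congr (res0 (\det _)).
apply/row_matrixP => i; rewrite rowK; have [->|ij] := eqVneq i j.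
  by rewrite row_setrow ltnSn.
apply/rowP => c; rewrite !mxE (negPf ij) ltnS [(i <= k)%N]leq_eqVlt.
by have -> : (i == k :> nat) = false by apply/negbTE; move: ij; apply: contra => /eqP E'; apply/eqP/val_inj.
Qed.

Lemma col_sum_delta n (l : 'cV[int]_n) : l = \sum_i (l i 0 *: delta_mx i 0).
Proof.
apply/colP => i; rewrite summxE (bigD1 i)//= big1 ?addr0 => [|j ji].
  by rewrite !mxE !eqxx mulr1.
by rewrite !mxE eq_sym (negPf ji) mulr0.
Qed.

(** The Smith form of a matrix with one column: its single invariant factor, up to sign, is k, and
    the first column of the left unimodular factor is the primitive vector. *)
Lemma int_col_unimodular n (l : 'cV[int]_n) : l != 0 ->
  exists (j : 'I_n) (L : 'M[int]_n) (k : int), [/\ L \in unitmx, k != 0 & l = k *: col j L].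
Proof.
case: n l => [|n] l; first by rewrite flatmx0 eqxx.
move=> l0; have [L Lu [Rr Ru [d _ lE]]] := int_Smith_normal_form l.
exists 0, L, (d`_0 * Rr 0 0).
have H : l = (d`_0 * Rr 0 0) *: col 0 L.
  rewrite {1}lE; apply/colP => i; rewrite !mxE big_ord1 mxE (bigD1 0)//= big1 ?addr0.
    by rewrite mxE mulr1n [RHS]mulrC mulrA.
  move=> c c0; rewrite mxE; case: eqP => [E|_]; last by rewrite mulr0n mulr0.
  by case/eqP: c0; exact: val_inj.
split => //; apply: contra l0 => /eqP k0; by rewrite H k0 scale0r.
Qed.

(** * Homomorphisms from Z^m to units, as generalized monomials *)

Section MonomialPowers.
Variable E : 'cV[int]_m -> K.
Hypotheses (E0 : E 0 = 1) (ED : forall l l', E (l + l') = E l * E l').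

Definition dlogE l := E (- l) *: grad (E l).

Lemma EN l : E l * E (- l) = 1. Proof. by rewrite -ED subrr. Qed.

Lemma dlogED l l' : dlogE (l + l') = dlogE l + dlogE l'.
Proof. by rewrite /dlogE opprD !ED dlogM ?EN. Qed.

Lemma dlogE0 : dlogE 0 = 0.
Proof. by rewrite /dlogE E0 grad1 scaler0. Qed.

Lemma dlogEN l : dlogE (- l) = - dlogE l.
Proof. by apply/eqP; rewrite -addr_eq0 -dlogED addNr dlogE0. Qed.

Lemma dlogEMn l k : dlogE (l *+ k) = dlogE l *+ k.
Proof. by elim: k => [|k IH]; rewrite ?dlogE0// !mulrS dlogED IH. Qed.

Lemma dlogEMz l (k : int) : dlogE (l *~ k) = dlogE l *~ k.
Proof. by case: k => k; rewrite ?NegzE ?mulrNz ?dlogEN -!pmulrn dlogEMn. Qed.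

Lemma dlogE_sum (I : Type) (r : seq I) (F : I -> 'cV[int]_m) :
  dlogE (\sum_(i <- r) F i) = \sum_(i <- r) dlogE (F i).
Proof. exact: (big_morph dlogE dlogED dlogE0). Qed.

Lemma EX l k : E (l *+ k) = E l ^+ k.
Proof. by elim: k => [|k IH]; rewrite ?E0// mulrS ED IH exprS. Qed.

Lemma dlogEZ (a : int) l : dlogE (a *: l) = dlogE l *~ a.
Proof. by rewrite -{1}[a]intz scaler_int dlogEMz. Qed.

(* The matrix of a change of basis turns E(l) into a power of one of the basis elements. *)
Lemma res_monomial (e : A) l : e * e = e ->
  (forall i, liftable (constL m e *: dlogE (delta_mx i 0))) -> l != 0 ->
  e * res0 (E l * \det (\matrix_i dlogE (delta_mx i 0))) = 0.
Proof.
move=> ee el l0; have [j [L [k [Lu k0 lE]]]] := int_col_unimodular l0.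
have lift (v : 'cV[int]_m) : liftable (constL m e *: dlogE v).
  rewrite [v]col_sum_delta dlogE_sum scaler_sumr; apply: liftable_sum => i.
  by rewrite dlogEZ -[X in _ *: X]scaler_int scalerA mulrC -scalerA scaler_int; exact: liftableMz.
pose R := \matrix_i dlogE (delta_mx i 0).
pose R' := \matrix_i dlogE (col i L).
have R'E : R' = map_mx intr L^T *m R.
  apply/row_matrixP => i; rewrite row_mul rowK [col i L]col_sum_delta dlogE_sum.
  apply/rowP => c; rewrite summxE mxE; apply: eq_bigr => b _.
  by rewrite dlogEZ -scaler_int !mxE.
have main : e * res0 (E l * \det R') = 0.
  (* Writing e as e^m puts one factor e in each of the m rows, which makes every row liftable. *)
  have [q0 _ em1] : (exists2 q : nat, m = q.+1 & e ^+ m = e).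
    have m0 : (0 < m)%N by apply: leq_ltn_trans (ltn_ord j).
    exists m.-1; first by rewrite prednK.
    rewrite -(prednK m0); elim: m.-1 => [|q IH]; first by rewrite expr1.
    by rewrite exprS IH.
  (* The power must be a positive natural number, so for negative k the sign passes to v = - col j L
     and to s. Then E(l) E(-v) dE(v) = E(v)^q dE(v), which [res_pow] kills. *)
  have [v [q [s [lv vs]]]] : exists (v : 'cV[int]_m) (q : nat) (s : A), l = v *+ q.+1 /\ dlogE (col j L) = constL m s *: dlogE v.
    case: k k0 lE => q k0 lE.
      case: q k0 lE => [//|q] _ ->; exists (col j L), q, 1; rewrite rmorph1 scale1r; split => //.
      by rewrite -scaler_nat natz.
    exists (- col j L), q, (-1); rewrite rmorphN1 scaleN1r dlogEN opprK; split => //.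
    by rewrite lE NegzE scaleNr mulNrn -scaler_nat natz.
  rewrite -coefL_constM -em1 rmorphXn mulrCA -detZ.
  pose M := constL m e *: R'.
  have rowM i : row i M = constL m e *: dlogE (col i L) by rewrite linearZ /= rowK.
  have -> : constL m e *: R' = setrow j (constL m e *: (constL m s *: (E (- v) *: grad (E v)))) M.
    by rewrite -[LHS](setrow_id j) rowM vs.
  rewrite scalerA det_setrowZ -rmorphM mulrCA coefL_constM lv EX exprS -det_setrowZ scalerA.
  rewrite (mulrAC (E v)) EN mul1r res_pow ?mulr0// => i ij.
  by rewrite rowM.
move: main; rewrite R'E det_mulmx det_map_mx det_tr.
move: Lu; rewrite unitmxE => /orP[] /eqP ->; first by rewrite rmorph1 mul1r.
by rewrite rmorphN1 mulN1r mulrN coefLN mulrN => /eqP; rewrite oppr_eq0 => /eqP.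
Qed.

End MonomialPowers.
End LiftableForms.

(** * Neighbourhoods of zero and density of monomials *)

Section Continuity.
Variable A : comPzRingType.

Lemma UnbhsP n (lam : Lam n) (f : iterL n A) :
  Unbhs lam f <-> forall l, Zlam lam (- l) -> coefL f l = 0.
Proof.
rewrite /Unbhs /suppL /=; split=> [H l lZ|H].
  apply: contrapT => /eqP fl; have : set0 l by rewrite -H.
  by [].
by rewrite -subset0 => l [/= /eqP fl /H].
Qed.

Definition col_cons n (l : 'cV[int]_n) (k : int) : 'cV[int]_n.+1 :=
  \col_i (if unlift ord_max i is Some j then l j 0 else k).

Lemma col_cons_last n (l : 'cV[int]_n) k : col_cons l k ord_max 0 = k.
Proof. by rewrite mxE unlift_none. Qed.

Lemma row'_col_cons n (l : 'cV[int]_n) k : row' ord_max (col_cons l k) = l.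
Proof. by apply/matrixP => i j; rewrite !mxE liftK (ord1 j). Qed.

Lemma UnbhsS n (lam : Lam n.+1) (f : laurent (iterL n A)) :
  Unbhs lam (f : iterL n.+1 A) <-> forall j, lam.2 <= - j -> Unbhs (lam.1 (- j)) (f j).
Proof.
split=> [/UnbhsP H j lj|H].
  apply/UnbhsP => l lZ; have := H (col_cons l j).
  rewrite coefLS col_cons_last row'_col_cons; apply.
  by rewrite /= mxE col_cons_last row'N row'_col_cons.
apply/UnbhsP => l /= [l1 l2]; move: l1 l2; rewrite mxE row'N => l1 l2.
by have /UnbhsP := H _ l1; apply.
Qed.

Lemma Unbhs_meet n (lam mu : Lam n) : exists nu : Lam n,
  forall f : iterL n A, Unbhs nu f -> Unbhs lam f /\ Unbhs mu f.
Proof.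
elim: n lam mu => [|n IH] lam mu; first by exists tt; case: lam; case: mu.
have /choice[nu nuP] j := IH (lam.1 j) (mu.1 j).
exists (nu, Num.min lam.2 mu.2) => f /UnbhsS H.
by split; apply/UnbhsS => j lj; have /nuP[] : Unbhs (nu (- j)) ((f : laurent (iterL n A)) j)
  by apply: H; rewrite /= ge_min lj ?orbT.
Qed.

Lemma coefL_mul_continuous n (J : iterL n A) l : exists lam : Lam n,
  forall g, Unbhs lam g -> coefL (g * J) l = 0.
Proof.
elim: n J l => [|n IH] J l.
  by exists tt => g /UnbhsP /(_ 0) /= -> //; rewrite mul0r.
have [b Jb] := order_ge_ex (J : laurent (iterL n A)).
set k := l ord_max 0.
have /choice[lam lamP] i := IH ((J : laurent (iterL n A)) (k + i)) (row' ord_max l).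
(* The neighbourhood constrains g_j for -j >= b - k, that is for k - j >= b: these are the only g_j
   that can meet a nonzero coefficient of J in degree k. The slice at i = -j handles the product of
   g_j with J_(k + i). *)
exists (lam, b - k) => g /UnbhsS H; rewrite coefLS -/k.
have [a ga] := order_ge_ex (g : laurent (iterL n A)).
rewrite (@lcoefM_ord _ a b _ _ k (absz (k - a - b)%R).+1 ga Jb); last by lia.
rewrite coefL_sum big1// => i _; have [h|h] := ltP (k - (a + i%:Z)) b.
  by rewrite Jb// mulr0 coefL0.
by apply: lamP; apply: H => /=; lia.
Qed.

Lemma coefL_continuous n l : exists lam : Lam n, forall g : iterL n A, Unbhs lam g -> coefL g l = 0.
Proof. by have [lam H] := coefL_mul_continuous (1 : iterL n A) l; exists lam => g /H; rewrite mulr1. Qed.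

(** The condition on T expresses that F lies in the additive group generated by the monomials, in
    the form used later and without indexing a finite sum. *)
Lemma monomials_dense n (f : iterL n A) (mu : Lam n) : exists2 F : iterL n A, Unbhs mu (f - F) &
  forall T : iterL n A -> A, {morph T : x y / x + y} -> (forall l a, T (monoL l a) = 0) -> T F = 0.
Proof.
elim: n f mu => [|n IH] f mu.
  exists f; first by apply/UnbhsP => l _; rewrite subrr.
  by move=> T _ T0; exact: (T0 0).
have [a fa] := order_ge_ex (f : laurent (iterL n A)).
pose g := f : laurent (iterL n A).
have /choice[F HF] j : exists F : iterL n A, Unbhs (mu.1 (- j)) (g j - F) /\
    forall T : iterL n A -> A, {morph T : x y / x + y} -> (forall l a, T (monoL l a) = 0) -> T F = 0.
  by have [F ? ?] := IH (g j) (mu.1 (- j)); exists F.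
(* The neighbourhood says nothing about outer degrees above - mu.2, and f has none below a, so N
   slices are enough. *)
pose N := (absz (- mu.2 - a)%R).+1.
exists (\sum_(i < N) lmono (a + i%:Z) (F (a + i%:Z)) : laurent (iterL n A)).
  apply/UnbhsS => j jmu; rewrite lcoefD lcoefN.
  have [ja|aj] := ltP j a.
    rewrite fa// lcoef_sum big1 ?subr0.
      by apply/UnbhsP => l _; rewrite coefL0.
    by move=> i _; rewrite lcoef_mono; case: eqP => // E; lia.
  have hi : (absz (j - a)%R < N)%N by rewrite /N; lia.
  have jE : a + (Ordinal hi)%:Z = j by rewrite /=; lia.
  suff -> : (\sum_(i < N) lmono (a + i%:Z) (F (a + i%:Z)) : laurent (iterL n A)) j = F j.
    by have [] := HF j.
  rewrite lcoef_sum (bigD1 (Ordinal hi))// lcoef_mono jE eqxx big1 => [|i ni]; first exact: addr0.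
  rewrite lcoef_mono; case: eqP => // E; case/eqP: ni; apply: val_inj => /=.
  by rewrite E; lia.
move=> T TD T0.
have T00 : T 0 = 0 by have := TD 0 0; rewrite addr0 => /eqP; rewrite eq_sym -subr_eq0 addrK => /eqP.
rewrite (big_morph T TD T00) big1// => i _.
have [_ HT] := HF (a + i%:Z).
apply: (HT (fun x => T (lmono (a + i%:Z) x : laurent (iterL n A)))) => [x y|l c].
  by rewrite -TD; congr T; exact: lmonoD.
rewrite -[RHS](T0 (col_cons l (a + i%:Z)) c); congr T.
by rewrite monoLS col_cons_last row'_col_cons.
Qed.

Lemma continuous_eq0 n (T : iterL n A -> A) (mu : Lam n) : {morph T : x y / x + y} ->
  (forall f, Unbhs mu f -> T f = 0) -> (forall l a, T (monoL l a) = 0) -> forall f, T f = 0.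
Proof.
move=> TD Tmu T0 f; have [F fF TF] := monomials_dense f mu.
by rewrite -[f](subrK F) TD Tmu// TF// addr0.
Qed.

End Continuity.

(** * Lexicographic order, powers of monomials, echelon form *)

Section LexicographicOrder.

Lemma lexltS n (l : 'cV[int]_n.+1) : lexlt 0 l <->
  0 < l ord_max 0 \/ (l ord_max 0 = 0 /\ lexlt 0 (row' ord_max l)).
Proof.
rewrite /lexlt /= row'0 mxE; split.
  move=> [[?|[E le]] ne]; first by left.
  right; split => //; split => // E'; apply: ne.
  by apply: cV_ord_maxP; rewrite ?mxE ?row'0.
move=> [h|[E [le ne]]]; split.
- by left.
- by move=> E; move: h; rewrite -E mxE ltxx.
- by right.
- by move=> E'; apply: ne; rewrite -E' row'0.
Qed.

(** In topological terms, t^(kl) tends to 0 for l > 0. If the last coordinate of l is zero, all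
    multiples lie in one slice, and the induction applies to it. *)
Lemma lexlt_power_large n (l : 'cV[int]_n) (mu : Lam n) : lexlt 0 l ->
  exists k0, forall k, (k0 <= k)%N -> ~ Zlam mu (- (l *+ k)).
Proof.
elim: n l mu => [|n IH] l mu; first by move=> [_ ne]; case: ne; rewrite (flatmx0 l).
have lastE k : (- (l *+ k)) ord_max 0 = - (l ord_max 0 *+ k) by rewrite mxE mulmxnE.
have rowE k : row' ord_max (- (l *+ k)) = - (row' ord_max l *+ k).
  by rewrite row'N; congr (- _); apply/matrixP => i j; rewrite !(mulmxnE, mxE).
case/lexltS => [h|[E lt]].
  exists (`|mu.2|%N.+1) => k kk [+ _]; rewrite lastE -mulr_natl natz => le.
  have : k%:Z <= k%:Z * l ord_max 0 by rewrite ler_peMr.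
  pose x : int := mu.2; have {}kk : (`|x|%N < k)%N := kk.
  by have {}le : x <= - (k%:Z * l ord_max 0) := le; clearbody x; lia.
have [k0 H] := IH _ (mu.1 0) lt; exists k0 => k /H H' [_ +].
by rewrite lastE rowE E mul0rn oppr0.
Qed.

Lemma Zlam_point n (l : 'cV[int]_n) : exists lam : Lam n, Zlam lam l.
Proof.
elim: n l => [|n IH] l; first by exists tt.
by have [lam H] := IH (row' ord_max l); exists (fun=> lam, l ord_max 0).
Qed.

(** Conversely, for l <= 0 a single neighbourhood forces the coefficients at all multiples of l to
    vanish, so the powers of t^l cannot tend to 0. *)
Lemma Zlam_powers n (l : 'cV[int]_n) : lexle l 0 -> exists lam : Lam n,
  forall k, Zlam lam (- (l *+ k)).
Proof.
elim: n l => [|n IH] l; first by exists tt.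
have lastE k : (- (l *+ k)) ord_max 0 = - (l ord_max 0 *+ k) by rewrite mxE mulmxnE.
have rowE k : row' ord_max (- (l *+ k)) = - (row' ord_max l *+ k).
  by rewrite row'N; congr (- _); apply/matrixP => i j; rewrite !(mulmxnE, mxE).
move=> /= [|[]]; rewrite mxE ?row'0.
  pose x : int := l ord_max 0; rewrite -/x => x0.
  (* If the last coordinate x is negative, the multiples of l have distinct last coordinates, so
     slice j needs to contain one point only; the multiplier is recovered as |j / x|. *)
  have /choice[lam H] (j : int) := Zlam_point (- (row' ord_max l *+ (`|(j %/ x)%Z|%N))).
  exists (lam, 0) => k; split; first by rewrite lastE oppr_ge0 mulrn_wle0// ltW.
  rewrite lastE rowE /= -/x; have := H (- (x *+ k)).
  by rewrite -[x *+ k]mulr_natl -mulNr mulzK ?lt_eqF// natz abszN.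
move=> E le; have [lam H] := IH _ le; exists (fun=> lam, 0) => k.
by split; rewrite lastE ?rowE// E mul0rn oppr0.
Qed.

Lemma lexlt0_pivot n (l : 'cV[int]_n) : lexlt 0 l ->
  exists2 p : 'I_n, 0 < l p 0 & forall j : 'I_n, (p < j)%N -> l j 0 = 0.
Proof.
elim: n l => [|n IH] l; first by move=> [_ ne]; case: ne; rewrite (flatmx0 l).
case/lexltS => [h|[E /IH[p lp H]]].
  by exists ord_max => // j; rewrite ltnNge -ltnS ltn_ord.
exists (lift ord_max p); first by rewrite -col_ordmax.
move=> j; case: (unliftP ord_max j) => [j' ->|->//].
by rewrite !lift_max => pj; rewrite -col_ordmax H.
Qed.

Lemma pivot_lexlt0 n (l : 'cV[int]_n) (p : 'I_n) : 0 < l p 0 ->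
  (forall j : 'I_n, (p < j)%N -> l j 0 = 0) -> lexlt 0 l.
Proof.
elim: n l p => [|n IH] l p lp H; first by case: p lp H => [[]].
apply/lexltS; move: lp H; case: (unliftP ord_max p) => [p' ->|->]; last by left.
rewrite lift_max => lp H; right; split; first by apply: H; exact: ltn_ord.
apply: (IH _ p'); first by rewrite col_ordmax.
by move=> j pj; rewrite col_ordmax H// lift_max.
Qed.

Lemma lexlt0_asym n (l : 'cV[int]_n) : lexlt 0 l -> ~ lexlt 0 (- l).
Proof.
elim: n l => [|n IH] l; first by move=> [_ ne]; case: ne; rewrite (flatmx0 l).
move=> /lexltS H /lexltS; rewrite row'N mxE oppr_gt0; move: H => [h|[-> h]] [h'|[h' h'']].
- by have := lt_trans h h'; rewrite ltxx.
- by move/eqP: h'; rewrite oppr_eq0 gt_eqF.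
- by rewrite ltxx in h'.
- exact: (IH _ h h'').
Qed.

Lemma lexle0N n (l : 'cV[int]_n) : ~ lexlt 0 l -> lexle l 0.
Proof.
move=> nl; have [//|le] := lexle_total l 0.
have [->|/eqP ne] := eqVneq l 0; first exact: lexle_refl.
by case: nl; split => // /esym.
Qed.

(* An additive map preserving strict positivity is in echelon form: test it on e_j - N e_i. *)
Lemma echelon_form n m (M : 'M[int]_(m, n)) : (forall l : 'cV_n, lexlt 0 l -> lexlt 0 (M *m l)) ->
  exists p : {ffun 'I_n -> 'I_m}, [/\ increasing p, forall i, 0 < M (p i) i &
    forall i (j : 'I_m), (p i < j)%N -> M j i = 0].
Proof.
move=> H; have /choice[p pP] i : exists p : 'I_m, 0 < M p i /\ forall j : 'I_m, (p < j)%N -> M j i = 0.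
  have : lexlt 0 (col i M).
    rewrite colE; apply: H; apply: (@pivot_lexlt0 _ _ i); first by rewrite mxE !eqxx.
    by move=> j ij; rewrite mxE; case: eqP ij => // ->; rewrite ltnn.
  move=> /lexlt0_pivot[p]; rewrite mxE => pp pj; exists p; split=> // j /pj.
  by rewrite mxE.
exists [ffun i => p i]; split; last by move=> i j; rewrite ffunE; have [_] := pP i; apply.
  apply/forallP => i; apply/forallP => j; apply/implyP => ij; rewrite !ffunE ltnNge.
  (* As i < j, the vector e_j - N e_i is lex-positive. If p_j <= p_i, the last nonzero entry of its
     image is M_(p_i, j) - N M_(p_i, i), negative because N exceeds |M_(p_i, j)|. *)
  apply/negP => pij; pose N := (absz (M (p i) j)).+1.
  have : lexlt 0 (M *m (delta_mx j 0 - N%:Z *: delta_mx i 0)).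
    apply: H; apply: (@pivot_lexlt0 _ _ j).
      by rewrite !mxE !eqxx -val_eqE (gtn_eqF ij) mulr0 subr0.
    by move=> k jk; rewrite !mxE -!val_eqE (gtn_eqF jk) (gtn_eqF (ltn_trans ij jk)) mulr0 subr0.
  rewrite mulmxBr -scalemxAr -!colE => /lexlt0_asym; apply; apply: (@pivot_lexlt0 _ _ (p i)).
    have [h _] := pP i; have : N%:Z <= N%:Z * M (p i) i by rewrite ler_peMr.
    by rewrite !mxE oppr_gt0 subr_lt0; apply: lt_le_trans; rewrite /N; move: (M (p i) j : int) => z; lia.
  move=> k ik; rewrite !mxE; have [_ ->//] := pP i; have [_ ->] := pP j; last exact: leq_ltn_trans ik.
  by rewrite mulr0 subrr oppr0.
by move=> i; rewrite ffunE; have [] := pP i.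
Qed.
End LexicographicOrder.

(** * Pivots, complementary indices and the sign of the shuffle *)

Section Pivots.
Variables (n m : nat) (hnm : (n <= m)%N).

Lemma pivotsP (M : 'M[int]_(m, n)) (p := pivots hnm M) :
  (forall l : 'cV_n, lexlt 0 l -> lexlt 0 (M *m l)) ->
  [/\ increasing p, forall i, 0 < M (p i) i & forall i (j : 'I_m), (p i < j)%N -> M j i = 0].
Proof.
move=> /echelon_form[q [qi qp q0]]; rewrite {}/p /pivots; case: pickP => /= [p /and3P[pi pp p0]|H].
  split => //; first by move=> i; exact: (forallP pp i).
  by move=> i j ij; have /forallP/(_ j)/implyP/(_ ij)/eqP := forallP p0 i.
have := H q; rewrite qi /= => /negP[]; apply/andP; split; first exact/forallP.
by apply/forallP => i; apply/forallP => j; apply/implyP => /q0 ->.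
Qed.

Lemma increasing_inj k l (p : 'I_k -> 'I_l) : increasing p -> injective p.
Proof.
move=> /forallP pi i j pij; apply: val_inj => /=.
have lt (a b : 'I_k) : (a < b)%N -> (p a < p b)%N by move=> ab; have /forallP/(_ b)/implyP/(_ ab) := pi a.
by case: (ltngtP i j) => // /lt; rewrite pij ltnn.
Qed.

(** Listing the indices missed by p in increasing order provides a q, so the default value of
    [complement] is not reached. *)
Lemma complementP (p : 'I_n -> 'I_m) (q := complement p) : increasing p ->
  increasing q /\ forall i j, p i != q j.
Proof.
move=> pi; rewrite {}/q /complement; case: pickP => /= [q /andP[qi /forallP H]|H].
  by split => // i j; have /forallP := H i; apply.
pose C := [predC codom p].
have cC : #|C| = (m - n)%N.
  have := cardC (mem (codom p)); rewrite card_codom ?card_ord; last exact: increasing_inj.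
  by move=> E; apply: (@addnI n); rewrite subnKC.
pose q := [ffun j : 'I_(m - n) => enum_val (cast_ord (esym cC) j)].
have := H q => /negP[]; apply/andP; split; last first.
  apply/forallP => i; apply/forallP => j; rewrite ffunE.
  have := enum_valP (cast_ord (esym cC) j); rewrite inE.
  by apply: contra => /eqP <-; exact: codom_f.
apply/forallP => i; apply/forallP => j; apply/implyP => ij; rewrite !ffunE.
have sC : sorted (relpre val ltn) (enum C).
  rewrite /enum_mem; apply: sorted_filter; first by move=> a b c; exact: ltn_trans.
  by have := iota_ltn_sorted 0 m; rewrite -val_enum_ord sorted_map enumT.
have tr : transitive (relpre val ltn : rel 'I_m) by move=> a b c; exact: ltn_trans.
have x0 := enum_val (cast_ord (esym cC) i); rewrite !(enum_val_nth x0).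
by apply: (sorted_ltn_nth tr _ sC) => //; rewrite inE -cardE ltn_ord.
Qed.

(** Permuting the columns by s puts p_1, ..., p_k first. The unit vectors then form the block row
    (0, 1), and the echelon condition makes the upper left block triangular with diagonal entries
    M_(p_a, a). *)
Lemma echelon_det k l c (h : (k + l)%N = c) (p : 'I_k -> 'I_c) (q : 'I_l -> 'I_c) (s : 'S_c)
    (M : 'M[int]_(c, k)) : (forall i, s i = join_fun h p q i) ->
  (forall a b : 'I_k, (a < b)%N -> M (p b) a = 0) ->
  \det (\matrix_(i, j) join_fun h (fun a => col a M) (fun b => delta_mx (q b) 0) i j 0) =
  (-1) ^+ s * \prod_a M (p a) a.
Proof.
case: c / h p q s M => p q s M sE M0.
set W := \matrix_(i, j) _.
have jl (T : Type) (u : 'I_k -> T) (v : 'I_l -> T) a : join_fun erefl u v (lshift l a) = u a.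
  by rewrite /join_fun cast_ord_id (unsplitK (inl _ a)).
have jr (T : Type) (u : 'I_k -> T) (v : 'I_l -> T) a : join_fun erefl u v (rshift k a) = v a.
  by rewrite /join_fun cast_ord_id (unsplitK (inr _ a)).
have sWE : col_perm s W = block_mx (\matrix_(a, b) M (p b) a) (\matrix_(a, b) M (q b) a) 0 1%:M.
  apply/matrixP => i j; case: (fintype.split_ordP i) => a ->; case: (fintype.split_ordP j) => b ->;
    rewrite ?(block_mxEul, block_mxEur, block_mxEdl, block_mxEdr) !mxE ?jl ?jr ?mxE !sE ?jl ?jr //=.
  - rewrite -(jl _ p q b) -(jr _ p q a) -!sE (inj_eq perm_inj).
    by rewrite eq_lrshift.
  - by rewrite andbT -(jr _ p q b) -(jr _ p q a) -!sE (inj_eq perm_inj) eq_rshift eq_sym.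
have : \det (col_perm s W) = \prod_a M (p a) a.
  rewrite sWE det_ublock det1 mulr1 det_trig; first by apply: eq_bigr => a _; rewrite mxE.
  by apply/is_trig_mxP => a b ab; rewrite mxE M0.
rewrite col_permE det_mulmx det_perm odd_permV => <-.
by rewrite mulrC -mulrA -expr2 sqrr_sign mulr1.
Qed.

Lemma shuffleE (p : {ffun 'I_n -> 'I_m}) : increasing p ->
  forall i, shuffle hnm p i = join_fun (subnKC hnm) p (complement p) i.
Proof.
move=> pi i; have [qi pq] := complementP pi.
pose F := [ffun i => join_fun (subnKC hnm) p (complement p) i].
have Finj : injectiveb F.
  apply/injectiveP => a b; rewrite !ffunE /join_fun.
  have pI := increasing_inj pi; have qI := increasing_inj qi.
  have I1 := @cast_ord_inj _ _ (esym (subnKC hnm)).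
  case: (fintype.split_ordP (cast_ord _ a)) => a' E; case: (fintype.split_ordP (cast_ord _ b)) => b' E'.
  - by move=> /pI ab; apply: I1; rewrite E E' ab.
  - by move=> ab; have := pq a' b'; rewrite ab eqxx.
  - by move=> ab; have := pq b' a'; rewrite ab eqxx.
  - by move=> /qI ab; apply: I1; rewrite E E' ab.
by rewrite -pvalE /shuffle -[pval _]/(val _) insubdK ?ffunE.
Qed.
End Pivots.

(** * Prime ideals, decompositions and locally constant data *)

Section Spectrum.
Variable A : comPzRingType.

Record ideal_avoiding (e : A) := MkIdeal {
  ideal_set :> A -> Prop;
  ideal0 : ideal_set 0;
  idealD : forall a b, ideal_set a -> ideal_set b -> ideal_set (a + b);
  idealM : forall a b, ideal_set b -> ideal_set (a * b);
  ideal_avoids : ~ ideal_set e }.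

Lemma ideal_ext e (I J : ideal_avoiding e) : (forall a, I a <-> J a) -> I = J.
Proof.
case: I J => I ? ? ? ? [J ? ? ? ?] /= IJ.
have E : I = J by apply/funext => a; apply/propext.
by subst J; f_equal; exact: Prop_irrelevance.
Qed.

(* A maximal ideal avoiding the idempotent e is prime. *)
Lemma prime_avoiding (e : A) : e * e = e -> e != 0 -> exists x : Spec A, ~ x e.
Proof.
move=> ee e0.
pose le (I J : ideal_avoiding e) : bool := `[< forall a, I a -> J a >].
pose Z := @MkIdeal e (fun a => a = 0) (erefl _)
  (fun a b (a0 : a = 0) (b0 : b = 0) => etrans (congr2 +%R a0 b0) (addr0 _))
  (fun a b (b0 : b = 0) => etrans (congr1 ( *%R a) b0) (mulr0 _)) (elimN eqP e0).
have [|||F Ftot|M Mmax] := @Zorn _ le.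
- by move=> I; apply/asboolP.
- by move=> I J K /asboolP IJ /asboolP JK; apply/asboolP => a /IJ /JK.
- by move=> I J /asboolP IJ /asboolP JI; apply: ideal_ext => a; split; [exact: IJ|exact: JI].
- have [[I0 FI0]|noF] := pselect (exists I, F I); last first.
    by exists Z => I FI; case: noF; exists I.
  have U0 : exists2 I, F I & I 0 by exists I0 => //; exact: ideal0.
  have UD a b : (exists2 I, F I & I a) -> (exists2 I, F I & I b) -> exists2 I, F I & I (a + b).
    move=> [I FI Ia] [J FJ Jb]; have [/asboolP IJ|/asboolP JI] := Ftot I J FI FJ.
      by exists J => //; apply: idealD => //; exact: IJ.
    by exists I => //; apply: idealD => //; exact: JI.
  have UM a b : (exists2 I, F I & I b) -> exists2 I, F I & I (a * b).
    by move=> [I FI Ib]; exists I => //; exact: idealM.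
  have Ue : ~ exists2 I, F I & I e by move=> [I FI /ideal_avoids].
  exists (MkIdeal U0 UD UM Ue) => I FI; apply/asboolP => a Ia; by exists I.
(* Maximality: for b outside M, the ideal generated by M and b must contain e. *)
have extend b : ~ M b -> exists2 c, M c & exists r, e = c + r * b.
  move=> Mb; apply: contrapT => no.
  pose J a := exists2 c, M c & exists r, a = c + r * b.
  have J0 : J 0 by exists 0; [exact: ideal0|exists 0; rewrite mul0r addr0].
  have JD x y : J x -> J y -> J (x + y).
    move=> [c Mc [r ->]] [d Md [s ->]]; exists (c + d); first exact: idealD.
    by exists (r + s); rewrite mulrDl addrACA.
  have JM x y : J y -> J (x * y).
    move=> [c Mc [r ->]]; exists (x * c); first exact: idealM.
    by exists (x * r); rewrite mulrDr mulrA.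
  have MJ : le M (MkIdeal J0 JD JM no).
    by apply/asboolP => a Ma; exists a => //; exists 0; rewrite mul0r addr0.
  apply: Mb; rewrite -(Mmax _ MJ) /=; exists 0; first exact: ideal0.
  by exists 1; rewrite mul1r add0r.
have M1 : ~ M 1 by move=> /(idealM e); rewrite mulr1; exact: ideal_avoids.
have MP a b : M (a * b) -> M a \/ M b.
  move=> Mab; apply: contrapT => /not_orP[/extend[c Mc [r E]] /extend[d Md [s E']]].
  (* From e in M + (a) and e in M + (b) follows e = e^2 in M + (ab), which is M. *)
  have H : M ((d + s * b) * c + (r * a) * d + (r * s) * (a * b)).
    by apply: idealD; [apply: idealD|]; exact: idealM.
  apply: (@ideal_avoids _ M); suff -> : M e = M ((d + s * b) * c + (r * a) * d + (r * s) * (a * b)) by [].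
  congr (ideal_set M _); transitivity ((c + r * a) * (d + s * b)); last by ring.
  by rewrite -E -E' ee.
exists (MkSpec (@ideal0 _ M) (@idealD _ M) (@idealM _ M) M1 MP); exact: ideal_avoids.
Qed.

Lemma dec_idempotent (e : decomposition A) i : e i * e i = e i.
Proof.
rewrite -[RHS]mulr1 -(dec_sum e) mulr_sumr (bigD1 i)//= big1 ?addr0// => j ji.
by rewrite dec_orth// eq_sym.
Qed.

Lemma dec_disjoint (e : decomposition A) (x : Spec A) i j : ~ x (e i) -> ~ x (e j) -> i = j.
Proof.
move=> xi xj; have [//|ij] := eqVneq i j.
by case: (@specP _ x (e i) (e j)); rewrite ?dec_orth//; exact: spec0.
Qed.

Lemma family_dec (I : finType) (e : I -> A) (eo : forall i j, i != j -> e i * e j = 0)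
  (es : \sum_i e i = 1) : exists d : decomposition A,
  exists r : 'I_(dec_size d) -> I, bijective r /\ forall i, d i = e (r i).
Proof.
have o (i j : 'I_#|I|) : i != j -> e (enum_val i) * e (enum_val j) = 0.
  by move=> ij; apply: eo; rewrite (inj_eq enum_val_inj).
have s : \sum_(i < #|I|) e (enum_val i) = 1.
  by rewrite -es [RHS](reindex _ (onW_bij _ (enum_val_bij I))).
exists (MkDecomposition o s), enum_val; split => //; exact: enum_val_bij.
Qed.

Lemma lcfun_of_dec (X : Type) (e : decomposition A) (w : 'I_(dec_size e) -> X) :
  exists F : lcfun A X, forall i (x : Spec A), ~ x (e i) -> F x = w i.
Proof.
have /choice[k kP] x := dec_point e x.
have lc : locally_constant (fun x => w (k x)).
  move=> x; exists (e (k x)); split => // y yk; congr w; exact: dec_disjoint (kP y) yk.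
exists (MkLcfun lc) => i x xi /=; congr w; exact: dec_disjoint (kP x) xi.
Qed.

(** Two decompositions are compared on the products e_i e'_j. A nonzero product is an idempotent, so
    some prime avoids it, and at that prime both local values equal that of F. *)
Lemma lc_glueE (V : zmodType) (act : A -> V -> V) (F : lcfun A V) (e : decomposition A)
    (w : 'I_(dec_size e) -> V) :
  (forall v, {morph act^~ v : a b / a + b}) -> (forall i (x : Spec A), ~ x (e i) -> F x = w i) ->
  lc_glue act F = \sum_i act (e i) (w i).
Proof.
move=> actD Fw; apply: xget_unique; first by exists e, w.
move=> _ [e' [w' [Fw' ->]]].
have act0 v : act 0 v = 0 by have := actD v 0 0; rewrite addr0 => /eqP; rewrite eq_sym -subr_eq0 addrK => /eqP.
have S (d d' : decomposition A) (u : 'I_(dec_size d) -> V) :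
    \sum_i act (d i) (u i) = \sum_i \sum_j act (d i * d' j) (u i).
  apply: eq_bigr => i _.
  by rewrite -(big_morph (act^~ (u i)) (actD (u i)) (act0 (u i))) -mulr_sumr dec_sum mulr1.
rewrite (S e' e) (S e e') exchange_big /=; apply: eq_bigr => i _; apply: eq_bigr => j _.
rewrite mulrC; have [->|ne] := eqVneq (e i * e' j) 0; first by rewrite !act0.
have [|x xe] := @prime_avoiding (e i * e' j) _ ne.
  by rewrite mulrACA !dec_idempotent.
rewrite -(Fw i x) 1?(Fw' j x)// => h; apply: xe; [exact: specM|exact: specMr].
Qed.

Lemma lc_glue_family (V : zmodType) (act : A -> V -> V) (F : lcfun A V) (I : finType) (e : I -> A)
    (w : I -> V) : (forall i j, i != j -> e i * e j = 0) -> \sum_i e i = 1 ->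
  (forall v, {morph act^~ v : a b / a + b}) -> (forall i (x : Spec A), ~ x (e i) -> F x = w i) ->
  lc_glue act F = \sum_i act (e i) (w i).
Proof.
move=> eo es actD Fw; have [d [r [rb dE]]] := family_dec eo es.
rewrite (@lc_glueE _ _ _ d (fun i => w (r i)))//.
  by rewrite [RHS](reindex r (onW_bij _ rb)); apply: eq_bigr => i _; rewrite dE.
by move=> i x; rewrite dE => /Fw.
Qed.

Lemma nu_regular n (f : iterL n A) (I : finType) (e : I -> A) (l : I -> 'cV[int]_n) (f' : I -> iterL n A) :
  (forall i j, i != j -> e i * e j = 0) -> \sum_i e i = 1 ->
  (forall i, regular (l i) (f' i) /\ constL n (e i) * f = constL n (e i) * f' i) ->
  forall i (x : Spec A), ~ x (e i) -> nu f x = l i.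
Proof.
move=> eo es H; have [d [r [rb dE]]] := family_dec eo es.
have [c cP] := lcfun_of_dec (fun i => l (r i)).
have coefE i l' : d i * coefL f l' = d i * coefL (f' (r i)) l'.
  by rewrite -!coefL_constM dE; have [_ ->] := H (r i).
have nuc : is_nu f c.
  exists d, (fun i => l (r i)) => i; have [reg _] := H (r i); split; last exact: cP.
    move=> l' lt; have [N HN] := regular_coef_lt reg lt; exists N.
    by rewrite coefE exprMn HN mulr0.
  have [b fb] := regular_coef reg; exists b.
  by rewrite coefE mulrACA fb mulr1 dec_idempotent.
have nuE : nu f = c by apply: xget_unique => // c' hc'; exact: nu_unique hc' nuc.
have [r' rK r'K] := rb.
by move=> i x; rewrite -(r'K i) -dE nuE; exact: cP.
Qed.

(** Products of the idempotents of the separate decompositions give one decomposition on which all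
    the units are regular at once. *)
Lemma units_regular n k (f g : 'I_k -> iterL n A) : (forall i, f i * g i = 1) ->
  exists (I : finType) (e : I -> A) (l : I -> 'I_k -> 'cV[int]_n) (f' : I -> 'I_k -> iterL n A),
  [/\ forall i j, i != j -> e i * e j = 0, \sum_i e i = 1 &
    forall j i, regular (l j i) (f' j i) /\ constL n (e j) * f i = constL n (e j) * f' j i].
Proof.
elim: k f g => [|k IH] f g fg.
  exists unit, (fun=> 1), (fun _ _ => 0), (fun _ _ => 1); split.
  - by case; case.
  - by rewrite (bigD1 tt)//= big1 ?addr0// => -[].
  - by move=> _ [].
have [I [e [l [f' [eo es H]]]]] := IH (fun i => f (lift ord_max i)) (fun i => g (lift ord_max i)) (fun i => fg _).
have [J [e' [l' [f'' [eo' es' H']]]]] := unit_regular (fg ord_max).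
exists (I * J)%type, (fun p => e p.1 * e' p.2),
  (fun p i => if unlift ord_max i is Some i' then l p.1 i' else l' p.2),
  (fun p i => if unlift ord_max i is Some i' then f' p.1 i' else f'' p.2); split.
- move=> [i j] [i' j'] /=; rewrite xpair_eqE negb_and => /orP[h|h].
    by rewrite mulrACA eo// mul0r.
  by rewrite mulrACA eo'// mulr0.
- rewrite -(pair_bigA _ (fun i j => e i * e' j)) /= -[RHS]mulr1 -{1}es -es' big_distrlr.
  by [].
move=> [i j] k' /=; rewrite rmorphM; case: unliftP => [k'' ->|->].
  have [reg E] := H i k''; split => //.
  by rewrite mulrAC E mulrAC.
have [reg E] := H' j; split => //.
by rewrite -!mulrA E.
Qed.

End Spectrum.

(** * Alternating products of n vectors *)

Section ExteriorTop.
Variables (R : comPzRingType) (M : lmodType R).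

Lemma upd_id k (u : 'I_k -> M) i : upd u i (u i) = u.
Proof. by apply/funext => j; rewrite /upd; case: eqP => [->|]. Qed.

Lemma ext_pure0 k (u : 'I_k -> M) i : ext_pure (upd u i 0) = 0.
Proof. by rewrite -(scale0r (0 : M)) ext_pure_scale scale0r. Qed.

Lemma ext_pure_sum k (u : 'I_k -> M) i (I : Type) (r : seq I) (F : I -> M) :
  ext_pure (upd u i (\sum_(c <- r) F c)) = \sum_(c <- r) ext_pure (upd u i (F c)).
Proof.
exact: (big_morph (fun x => ext_pure (upd u i x)) (ext_pure_add u i) (ext_pure0 u i)).
Qed.

(** Polarization: the product vanishes with u_i + u_j in both places, and its bilinear expansion
    leaves the two mixed terms. *)
Lemma ext_pure_tperm k (u : 'I_k -> M) i j : i != j ->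
  ext_pure (u \o tperm i j) = - ext_pure u.
Proof.
move=> ij; pose W x y := ext_pure (upd (upd u i x) j y).
have WDl x x' y : W (x + x') y = W x y + W x' y.
  have C z z' : upd (upd u i z) j z' = upd (upd u j z') i z.
    apply/funext => c; rewrite /upd; case: (eqVneq c j) => [->|//].
    by rewrite eq_sym (negPf ij).
  by rewrite /W !C ext_pure_add.
have WDr x y y' : W x (y + y') = W x y + W x y' by exact: ext_pure_add.
have W0 x : W x x = 0.
  apply: (ext_pure_alt ij); rewrite /upd eqxx (negPf ij).
  by rewrite eqxx.
have uE : u = upd (upd u i (u i)) j (u j) by rewrite !upd_id.
have utE : u \o tperm i j = upd (upd u i (u j)) j (u i).
  apply/funext => c; rewrite /upd /=; case: tpermP => [->|->|/eqP/negPf -> /eqP/negPf ->//].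
    by rewrite (negPf ij) eqxx.
  by rewrite eqxx.
rewrite utE [in RHS]uE -/(W _ _) -/(W _ _); apply/eqP; rewrite -addr_eq0.
have := W0 (u i + u j); rewrite WDl !WDr !W0 add0r addr0 addrC => ->.
by [].
Qed.

Lemma ext_pure_perm k (u : 'I_k -> M) (s : 'S_k) :
  ext_pure (u \o s) = (-1) ^+ s *: ext_pure u.
Proof.
have [ts -> tsd] := prod_tpermP s; elim: ts tsd u => [|t ts IH] /=.
  move=> _ u; rewrite big_nil odd_perm1 expr0 scale1r; congr ext_pure.
  by apply/funext => i /=; rewrite perm1.
move=> /andP[td tsd] u; rewrite big_cons odd_permM odd_tperm.
have -> : u \o (tperm t.1 t.2 * \prod_(t <- ts) tperm t.1 t.2)%g =
    (u \o (\prod_(t <- ts) tperm t.1 t.2)%g) \o tperm t.1 t.2.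
  by apply/funext => i; rewrite /= permM.
by rewrite ext_pure_tperm// IH// signr_addb (td : t.1 != t.2) mulN1r scaleNr.
Qed.

(** The signature of J if J is a permutation, and 0 otherwise. *)
Definition selection_sign n (J : 'I_n -> 'I_n) : int := \det (\matrix_(i, j) (J i == j)%:R).

Lemma ext_pure_selection n (u : 'I_n -> M) (J : 'I_n -> 'I_n) :
  ext_pure (u \o J) = (selection_sign J)%:~R *: ext_pure u.
Proof.
have [/injectiveP Ji|/injectivePn[i [j ij Jij]]] := boolP (injectiveb J).
  have JE : u \o J = u \o perm Ji by apply/funext => i; rewrite /= permE.
  rewrite JE ext_pure_perm /selection_sign (_ : \matrix_(i, j) _ = perm_mx (perm Ji)).
    by rewrite det_perm rmorphXn rmorphN1.
  by apply/matrixP => i j; rewrite !mxE permE.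
rewrite (@ext_pure_alt _ _ _ _ i j)//= ?Jij// /selection_sign.
by rewrite (determinant_alternate ij) ?scale0r// => c; rewrite !mxE Jij.
Qed.

End ExteriorTop.

(** * Top forms as multiples of the volume form; residues as coefficients *)

Section TopForms.
Variables (A : comPzRingType) (m : nat).
Local Notation K := (iterL m A).
Local Notation vol := (ext_pure (fun i : 'I_m => dform (tvar A i))).

Lemma omega1_coord_dform (f : K) : omega1_coord (dform f) = omega1_grad f.
Proof. by rewrite /omega1_coord pm_lift_gen//; exact: omega1_grad_rel. Qed.

Lemma omega1_coord0 : omega1_coord (0 : omega1 m A) = 0.
Proof. by rewrite -[0](scale0r (0 : omega1 m A)) omega1_coordZ scale0r. Qed.

Lemma omega1_coord_sum (I : Type) (r : seq I) (F : I -> omega1 m A) :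
  omega1_coord (\sum_(i <- r) F i) = \sum_(i <- r) omega1_coord (F i).
Proof. exact: (big_morph _ (@omega1_coordD m A) omega1_coord0). Qed.

Lemma omega1_basis (x : omega1 m A) : x = \sum_j omega1_coord x 0 j *: dform (tvar A j).
Proof.
elim/presmod_ind: x => [f||x y {1}-> {1}->|a x {1}->].
- rewrite -[pm_gen _ f]/(dform f) omega1_coord_dform.
  under eq_bigr do rewrite mxE.
  transitivity (pm_cls (@omega1_rel m A) (\big[@Add _ _/Zero]_(i < m) Scale (pderiv A i f) (Gen (tvar A i)))).
    by apply/clsP; apply: cong_rel; exact: omega1_partial.
  rewrite (@big_morph _ _ (pm_cls (@omega1_rel m A)) 0 +%R Zero (@Add _ _)) => [|x y|//].
    by apply: eq_bigr => i _; rewrite [RHS]pm_scaleE.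
  by rewrite [RHS]pm_addE.
- by rewrite omega1_coord0 big1// => j _; rewrite mxE scale0r.
- by rewrite omega1_coordD -big_split; apply: eq_bigr => j _; rewrite mxE scalerDl.
- by rewrite omega1_coordZ scaler_sumr; apply: eq_bigr => j _; rewrite mxE scalerA.
Qed.

Lemma jacobian_upd (u : 'I_m -> omega1 m A) i x :
  jacobian (upd u i x) = \det (setrow i (omega1_coord x) (\matrix_j omega1_coord (u j))).
Proof.
congr (\det _); apply/matrixP => j c; rewrite !mxE /upd.
by case: eqP => // _; rewrite !mxE.
Qed.

(** Both sides are linear in each factor, so the factors are expanded in the basis one at a time; s
    bounds the number of factors not yet of the form dt_j. When all are, the determinant is a
    selection sign. *)
Lemma ext_pure_jacobian (u : 'I_m -> omega1 m A) : ext_pure u = (jacobian u : K) *: vol.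
Proof.
suff H s : (s <= m)%N -> forall u : 'I_m -> omega1 m A,
    (forall i : 'I_m, (s <= i)%N -> exists j, u i = dform (tvar A j)) -> ext_pure u = (jacobian u : K) *: vol.
  by apply: (H m) => // i; rewrite leqNgt ltn_ord.
elim: s => [_ {}u uE|s IH sm {}u uE].
  have /choice[J JE] i : exists j, u i = dform (tvar A j) by exact: uE.
  have -> : u = (fun i => dform (tvar A i)) \o J by apply/funext => i; rewrite JE.
  rewrite ext_pure_selection; congr (_ *: _).
  rewrite /selection_sign /jacobian -(det_map_mx (intmul 1 : int -> K)); congr (\det _).
  by apply/matrixP => i j; rewrite !mxE omega1_coord_dform mxE pderiv_tvar eq_sym rmorph_nat.
pose i := Ordinal sm.
have IHu x : (exists j, x = dform (tvar A j)) -> ext_pure (upd u i x) = (jacobian (upd u i x) : K) *: vol.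
  move=> xE; apply: IH => [|j]; first exact: ltnW.
  rewrite leq_eqVlt => /orP[/eqP ij|ij]; rewrite /upd.
    by rewrite (_ : j == i)//; apply/eqP/val_inj.
  by case: eqP => // _; exact: uE.
rewrite -(upd_id u i) [u i in LHS]omega1_basis [u i in RHS]omega1_basis ext_pure_sum.
rewrite jacobian_upd omega1_coord_sum det_setrow_sum scaler_suml; apply: eq_bigr => j _.
rewrite omega1_coordZ det_setrowZ -jacobian_upd ext_pure_scale IHu ?scalerA//.
by exists j.
Qed.

Definition top_coef (w : omega m m A) : K := pm_lift (@jacobian m A) w.

Lemma top_coefE w : w = top_coef w *: vol.
Proof.
have lin : linear (pm_lift (@jacobian m A) : omega m m A -> K^o).
  by apply: pm_lift_linear; exact: jacobian_rel.
have top0 : top_coef 0 = 0.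
  have := lin 1 0 0; rewrite addr0 scale1r => /eqP.
  by rewrite scale1r eq_sym -subr_eq0 addrK => /eqP.
have topD x y : top_coef (x + y) = top_coef x + top_coef y by have := lin 1 x y; rewrite !scale1r.
have topZ a x : top_coef (a *: x) = a * top_coef x by have := lin a x 0; rewrite addr0 -/(top_coef _) => ->; rewrite -/(top_coef 0) top0 addr0.
elim/presmod_ind: w => [u||x y {1}-> {1}->|a x {1}->].
- transitivity ((jacobian u : K) *: vol); first exact: ext_pure_jacobian.
  congr (_ *: _).
  by rewrite /top_coef pm_lift_gen//; exact: jacobian_rel.
- by rewrite top0 scale0r.
- by rewrite topD scalerDl.
- by rewrite topZ scalerA.
Qed.

Lemma res_vol (f : K) : res (f *: vol) = coefL f (const_mx (-1)).
Proof.
by apply: xget_unique; [exists f|move=> _ [g [/res_unique <- ->]]].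
Qed.

Lemma res_pure (f : K) (u : 'I_m -> omega1 m A) :
  res (f *: ext_pure u) = coefL (f * (jacobian u : K)) (const_mx (-1)).
Proof. by rewrite ext_pure_jacobian scalerA res_vol. Qed.

End TopForms.

(** [form_map] chooses an arbitrary presentation by terms F_J dt_J. Each collapses to the
    coefficient \sum_J F_J sign(J) of the volume form, which is unique, and [phi] respects this
    collapse because signs are integers. *)
Lemma form_map_vol n m (A : comPzRingType) (phi : {rmorphism iterL n A -> iterL m A}) (f : iterL n A) :
  form_map phi (f *: ext_pure (fun i : 'I_n => dform (tvar A i))) =
  phi f *: ext_pure (fun i : 'I_n => dform (phi (tvar A i))).
Proof.
pose vol := ext_pure (fun i : 'I_n => dform (tvar A i)).
pose vol' := ext_pure (fun i : 'I_n => dform (phi (tvar A i))).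
have E (F : {ffun 'I_n -> 'I_n} -> iterL n A) :
    \sum_J (F J *: ext_pure (fun j => dform (tvar A (J j)))) = (\sum_J F J * (selection_sign J)%:~R) *: vol.
  rewrite scaler_suml; apply: eq_bigr => J _.
  by rewrite -scalerA -ext_pure_selection.
have E' (F : {ffun 'I_n -> 'I_n} -> iterL n A) :
    \sum_J (phi (F J) *: ext_pure (fun j => dform (phi (tvar A (J j))))) = phi (\sum_J F J * (selection_sign J)%:~R) *: vol'.
  rewrite rmorph_sum scaler_suml; apply: eq_bigr => J _.
  by rewrite rmorphM rmorph_int -scalerA -ext_pure_selection.
apply: xget_unique; last first.
  by move=> _ [F [wE ->]]; rewrite E' -/vol'; congr (phi _ *: _); apply: res_unique; rewrite -E -wE.
pose F (J : {ffun 'I_n -> 'I_n}) := if J == [ffun i => i] then f else 0.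
have FE : f = \sum_J F J * (selection_sign J)%:~R.
  rewrite (bigD1 [ffun i => i])//= big1 ?addr0 => [|J /negPf J1]; last by rewrite /F J1 mul0r.
  rewrite /F eqxx /selection_sign (_ : \matrix_(i, j) _ = 1%:M) ?det1 ?mulr1//.
  by apply/matrixP => i j; rewrite !mxE ffunE.
by exists F; rewrite E E' -FE.
Qed.

Lemma join_fun_lshift (T : Type) (k l m : nat) (h : (k + l)%N = m) (u : 'I_k -> T) v i :
  join_fun h u v (cast_ord h (lshift l i)) = u i.
Proof. by rewrite /join_fun cast_ordK (unsplitK (inl _ i)). Qed.

Lemma join_fun_rshift (T : Type) (k l m : nat) (h : (k + l)%N = m) (u : 'I_k -> T) v i :
  join_fun h u v (cast_ord h (rshift k i)) = v i.
Proof. by rewrite /join_fun cast_ordK (unsplitK (inr _ i)). Qed.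

(** * The residue formula over one component, cut out by an idempotent *)

Section Component.
Variables (A : comPzRingType) (n m : nat) (hnm : (n <= m)%N).
Variable phi : {rmorphism iterL n A -> iterL m A}.
Hypotheses (phi_alg : forall a : A, phi (constL n a) = constL m a) (phi_cont : continuousL phi).
Local Notation K := (iterL m A).
Local Notation grad := (@omega1_grad m A).
Local Notation res0 x := (coefL x (const_mx (-1))).
Local Notation tmono l := (monoL l 1 : iterL n A).

Variables (e : A) (ee : e * e = e) (l : 'I_n -> 'cV[int]_m) (f : 'I_n -> K).
Hypothesis fP : forall i, regular (l i) (f i) /\ constL m e * phi (tvar A i) = constL m e * f i.
Local Notation eK := (constL m e).
Local Notation X := (\matrix_(j, i) l i j 0 : 'M[int]_(m, n)).

Lemma eKK : eK * eK = eK. Proof. by rewrite -rmorphM ee. Qed.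

Lemma eK_inverse (a b a' b' : K) : a * b = 1 -> a' * b' = 1 -> eK * a = eK * a' -> eK * b = eK * b'.
Proof.
move=> ab ab' E; rewrite -[LHS]mulr1 -ab' mulrA (mulrAC eK) -E.
by rewrite (mulrAC eK) -[eK * b * a]mulrA [b * a]mulrC ab mulr1.
Qed.

Lemma eK_mul (a b a' b' : K) : eK * a = eK * a' -> eK * b = eK * b' -> eK * (a * b) = eK * (a' * b').
Proof. by move=> E E'; rewrite mulrA E -mulrA mulrCA E' mulrCA. Qed.

Lemma phi_monoM (l1 l2 : 'cV_n) : phi (tmono (l1 + l2)) = phi (tmono l1) * phi (tmono l2).
Proof. by rewrite -rmorphM monoLM mulr1. Qed.

Lemma phi_mono0 : phi (tmono 0) = 1.
Proof. by rewrite monoL01 rmorph1. Qed.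

(** The exponents v with this property form a subgroup, and it contains the unit vectors by the
    choice of l and f. *)
Lemma component_regular (v : 'cV[int]_n) : exists F : K,
  regular (X *m v) F /\ eK * phi (tmono v) = eK * F.
Proof.
pose P v := exists F : K, regular (X *m v) F /\ eK * phi (tmono v) = eK * F.
have PD v1 v2 : P v1 -> P v2 -> P (v1 + v2).
  move=> [F1 [r1 E1]] [F2 [r2 E2]]; exists (F1 * F2); split.
    by rewrite mulmxDr; exact: regularM.
  by rewrite phi_monoM; exact: eK_mul.
have PN v1 : P v1 -> P (- v1).
  move=> [F1 [r1 E1]]; have [G FG] := regular_unit r1; exists G; split.
    by rewrite mulmxN; exact: regularV r1.
  by apply: eK_inverse E1 => //; rewrite -phi_monoM subrr phi_mono0.
have P0 : P 0.
  exists 1; rewrite mulmx0 phi_mono0; split => //.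
  by rewrite -monoL01; exact: regular_mono.
have PMn v1 k : P v1 -> P (v1 *+ k).
  by move=> P1; elim: k => [|k IH]; rewrite ?mulr0n// mulrS; exact: PD.
rewrite -/(P v) [v]col_sum_delta; apply: big_ind => // i _.
have P1 : P (delta_mx i 0).
  have [ri Ei] := fP i; exists (f i); split=> //.
  suff -> : X *m delta_mx i 0 = l i by [].
  by rewrite -colE; apply/colP => j; rewrite !mxE.
have -> : v i 0 *: delta_mx i 0 = delta_mx i 0 *~ v i 0 :> 'cV[int]_n.
  by rewrite -{1}[v i 0]intz scaler_int.
by case: (v i 0) => k; rewrite ?NegzE ?mulrNz -pmulrn; [|apply: PN]; exact: PMn.
Qed.

(* Powers of a lex-positive monomial tend to zero, hence so do those of its image. *)
Lemma component_positive : e != 0 -> forall v : 'cV[int]_n, lexlt 0 v -> lexlt 0 (X *m v).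
Proof.
move=> e0 v v0; apply: contrapT => /lexle0N le.
have [F [reg FE]] := component_regular v.
(* Membership in this neighbourhood forces the coefficient at every multiple of X v to vanish,
   whereas those coefficients are invertible over e. *)
have [lam lamP] := Zlam_powers le.
have [mu muP] := phi_cont 0 lam.
have [k kP] := lexlt_power_large mu v0.
have H1 : Unbhs lam (phi (tmono (v *+ k)) - phi 0).
  apply: muP; rewrite subr0; apply/UnbhsP => l' lZ; rewrite coefL_mono.
  by case: eqP => // E; case: (kP k (leqnn _)); rewrite -E.
have PX j : phi (tmono (v *+ j)) = phi (tmono v) ^+ j.
  by elim: j => [|j IH]; rewrite ?mulr0n ?phi_mono0// mulrS phi_monoM IH exprS.
have FX j : regular ((X *m v) *+ j) (F ^+ j).
  elim: j => [|j IH]; last by rewrite mulrS exprS; exact: regularM.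
  by rewrite mulr0n expr0 -monoL01; exact: regular_mono.
have EX j : eK * phi (tmono v) ^+ j = eK * F ^+ j.
  by elim: j => [|j IH]; rewrite ?expr0// !exprS; exact: eK_mul.
have [b Fb] := regular_coef (FX k).
(* For the k found above, e times an invertible coefficient of F^k is 0, so e = 0. *)
case/eqP: e0; rewrite -[e]mulr1 -Fb mulrA -coefL_constM -EX -PX coefL_constM.
have /UnbhsP H1' := H1; have := H1' ((X *m v) *+ k) (lamP k).
by rewrite rmorph0 subr0 => ->; rewrite mulr0 mul0r.
Qed.

Variable q : 'I_(m - n) -> 'I_m.
Local Notation h := (subnKC hnm).
Local Notation li := (fun i : 'I_n => cast_ord h (lshift (m - n) i)).
Local Notation ri := (fun j : 'I_(m - n) => cast_ord h (rshift n j)).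

(** Adjoining the t_(q_j) to the phi(t_i) gives m units in m variables, the situation of
    [res_monomial]. The logarithmic differentials of the generators are those of the phi(t_i)
    followed by the dt_(q_j) / t_(q_j). *)
Definition mixed_mono (v : 'cV[int]_m) : K :=
  phi (tmono (\col_i v (li i) 0)) * monoL (\sum_j (v (ri j) 0 *: delta_mx (q j) 0)) 1.

Lemma mixed_mono0 : mixed_mono 0 = 1.
Proof.
rewrite /mixed_mono big1 => [|j _]; last by rewrite mxE scale0r.
rewrite monoL01 mulr1 (_ : \col_i _ = 0) ?phi_mono0//.
by apply/colP => i; rewrite !mxE.
Qed.

Lemma mixed_monoD v v' : mixed_mono (v + v') = mixed_mono v * mixed_mono v'.
Proof.
rewrite /mixed_mono mulrACA -phi_monoM monoLM mulr1 -big_split; congr (phi (tmono _) * monoL _ 1).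
  by apply/colP => i; rewrite !mxE.
by apply: eq_bigr => j _; rewrite mxE scalerDl.
Qed.

Lemma mixed_mono_delta i : mixed_mono (delta_mx i 0) =
  join_fun h (fun a => phi (tvar A a)) (fun b => tvar A (q b)) i.
Proof.
have lr a b : (li a == ri b) = false by rewrite (inj_eq (@cast_ord_inj _ _ h)) eq_lrshift.
rewrite /mixed_mono -[i](cast_ordKV h); case: (fintype.split_ordP (cast_ord (esym h) i)) => a ->.
  rewrite join_fun_lshift big1 => [|j _]; last by rewrite mxE eq_sym lr scale0r.
  rewrite monoL01 mulr1 /tvar; congr (phi (monoL _ _)).
  by apply/colP => b; rewrite !mxE (inj_eq (@cast_ord_inj _ _ h)) eq_lshift.
rewrite join_fun_rshift (bigD1 a)//= big1 ?addr0 => [|j ja]; last first.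
  by rewrite mxE (inj_eq (@cast_ord_inj _ _ h)) eq_rshift (negPf ja) scale0r.
rewrite mxE !eqxx scale1r (_ : \col_i _ = 0) ?phi_mono0 ?mul1r//.
by apply/colP => b; rewrite !mxE lr.
Qed.

Local Notation E := mixed_mono.
Local Notation w := (join_fun h l (fun b => delta_mx (q b) 0)).
Local Notation F := (join_fun h f (fun b => tvar A (q b))).

Lemma mixed_regular i : regular (w i) (F i) /\ eK * E (delta_mx i 0) = eK * F i.
Proof.
rewrite mixed_mono_delta -[i](cast_ordKV h); case: (fintype.split_ordP (cast_ord (esym h) i)) => a ->.
  by rewrite !join_fun_lshift; exact: fP.
by rewrite !join_fun_rshift; split => //; exact: regular_mono.
Qed.

Lemma eK_grad (a : K) : eK *: grad a = grad (eK * a).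
Proof. by rewrite gradM grad_const scaler0 addr0. Qed.

Lemma eK_dlogE (a b : K) : eK *: (b *: grad a) = (eK * b) *: grad (eK * a).
Proof. by rewrite -eK_grad !scalerA mulrAC eKK. Qed.

Lemma eK_det (U V : 'M[K]_m) : eK *: U = eK *: V -> eK * \det U = eK * \det V.
Proof.
(* An empty determinant has no row to absorb e, but then the two matrices coincide. *)
have [m0|m0] := posnP m.
  by have -> : U = V by apply/matrixP => i; have := ltn_ord i; rewrite {2}m0.
have eX k : eK ^+ k.+1 = eK.
  by elim: k => [|k IH]; rewrite ?expr1// exprS IH eKK.
have {}eX : eK ^+ m = eK by case: (m) m0 eX => [//|k] _; apply.
by move=> UV; rewrite -eX -!detZ UV.
Qed.

Local Notation r := (\matrix_i dlogE E (delta_mx i 0)).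
Local Notation W := (\matrix_(i, j) w i j 0 : 'M[int]_m).

Lemma mixed_dlog i (G : K) : F i * G = 1 -> eK *: dlogE E (delta_mx i 0) = eK *: (G *: grad (F i)).
Proof.
move=> FG; have [_ EF] := mixed_regular i.
have EE : E (delta_mx i 0) * E (- delta_mx i 0) = 1 by rewrite -mixed_monoD subrr mixed_mono0.
by rewrite /dlogE !eK_dlogE EF (eK_inverse EE FG EF).
Qed.

Lemma mixed_res_det : e * res0 (\det r) = e * (\det W)%:~R.
Proof.
have [B [p [B_tf p_surj]]] := torsion_free_cover A.
have /choice[G FG] i : exists G, F i * G = 1 by have [/regular_unit] := mixed_regular i.
rewrite -coefL_constM (@eK_det _ (\matrix_i (G i *: grad (F i)))).
  rewrite coefL_constM (res_det_dlog p_surj B_tf (l := w))// => i.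
  by have [] := mixed_regular i.
by apply/row_matrixP => i; rewrite !linearZ /= !rowK; apply: mixed_dlog.
Qed.

Lemma mixed_res_zero v : v != 0 -> e * res0 (E v * \det r) = 0.
Proof.
have [B [p [B_tf p_surj]]] := torsion_free_cover A.
apply: (res_monomial p_surj B_tf mixed_mono0 mixed_monoD ee) => i.
have [reg _] := mixed_regular i; have [G FG] := regular_unit reg.
rewrite (mixed_dlog FG); apply: (liftableZ p_surj).
exact: (liftable_regular_dlog p_surj reg FG).
Qed.

Local Notation Y := (\matrix_i join_fun h (fun a => grad (phi (tvar A a)))
  (fun b => tvarV A (q b) *: grad (tvar A (q b))) i : 'M[K]_m).

(** Only the first n rows are plain differentials; turning them into logarithmic ones extracts the
    factor phi(t_1 ... t_n). *)
Lemma det_pullback : \det Y = phi (tmono (const_mx 1)) * \det r.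
Proof.
pose d : 'rV[K]_m := \row_i join_fun h (fun a => phi (tvar A a)) (fun=> 1) i.
have EE i : E (delta_mx i 0) * E (- delta_mx i 0) = 1 by rewrite -mixed_monoD subrr mixed_mono0.
have -> : Y = diag_mx d *m r.
  apply/row_matrixP => i; rewrite row_mul row_diag_mx -scalemxAl -rowE !rowK mxE.
  have := EE i; rewrite /dlogE mixed_mono_delta.
  rewrite -[i](cast_ordKV h); case: (fintype.split_ordP (cast_ord (esym h) i)) => a ->.
    by rewrite !join_fun_lshift scalerA => ->; rewrite scale1r.
  rewrite !join_fun_rshift scale1r => EE'; congr (_ *: _); apply: (inverse_unique _ EE').
  by rewrite monoLM subrr mulr1 monoL01.
rewrite det_mulmx det_diag; congr (_ * _).
have -> : const_mx 1 = \sum_(a < n) delta_mx a 0 :> 'cV[int]_n.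
  apply/colP => a; rewrite mxE summxE (bigD1 a)//= mxE !eqxx big1 ?addr0// => b ba.
  by rewrite mxE eq_sym (negPf ba).
rewrite (big_morph (fun v => phi (tmono v)) phi_monoM phi_mono0).
rewrite (reindex (cast_ord h)) /=; last by apply: onW_bij; exists (cast_ord (esym h)); [exact: cast_ordK|exact: cast_ordKV].
rewrite big_split_ord /= [X in _ * X]big1 ?mulr1 => [|b _]; last by rewrite mxE join_fun_rshift.
by apply: eq_bigr => a _; rewrite mxE join_fun_lshift.
Qed.

(** The extracted factor combines with phi(t^v) into E(pad) with pad = (v + 1, 0), which is the zero
    exponent exactly when v = -1. The matrix U is left free because the actual form is glued and
    agrees with Y only after multiplication by e. *)
Lemma component_residue (U : 'M[K]_m) (v : 'cV[int]_n) (c : A) : eK *: U = eK *: Y ->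
  e * res0 (phi (monoL v c) * \det U) = e * ((\det W)%:~R * coefL (monoL v c : iterL n A) (const_mx (-1))).
Proof.
move=> UY; pose pad : 'cV[int]_m := \col_i join_fun h (fun a => v a 0 + 1) (fun=> 0) i.
have Epad : E pad = phi (tmono (v + const_mx 1)).
  rewrite /mixed_mono big1 => [|j _]; last by rewrite mxE join_fun_rshift scale0r.
  rewrite monoL01 mulr1; congr (phi (tmono _)).
  by apply/colP => a; rewrite !mxE join_fun_lshift.
have -> : e * res0 (phi (monoL v c) * \det U) = c * (e * res0 (E pad * \det r)).
  rewrite -coefL_constM mulrCA (eK_det UY) det_pullback monoLE rmorphM phi_alg.
  rewrite -mulrA coefL_constM; congr (_ * _); rewrite -coefL_constM; congr (res0 _).
  by rewrite mulrCA; congr (_ * _); rewrite mulrA -phi_monoM -Epad.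
have [v1|v1] := eqVneq (const_mx (-1)) v.
  have -> : pad = 0.
    apply/colP => i; rewrite !mxE -[i](cast_ordKV h).
    case: (fintype.split_ordP (cast_ord (esym h) i)) => a ->; rewrite ?join_fun_lshift ?join_fun_rshift//.
    by rewrite -v1 mxE addNr.
  by rewrite mixed_mono0 mul1r mixed_res_det coefL_mono -v1 eqxx mulrCA [c * _]mulrC.
rewrite mixed_res_zero ?mulr0; first by rewrite coefL_mono (negPf v1) !mulr0.
apply: contra v1 => /eqP p0; apply/eqP/colP => a; rewrite mxE.
have := congr1 (fun p : 'cV[int]_m => p (li a) 0) p0; rewrite !mxE join_fun_lshift => /eqP.
by rewrite addr_eq0 => /eqP ->.
Qed.
End Component.

(** * Gluing the components *)

Lemma scale_orthogonal_sum (R : comPzRingType) (V : lmodType R) (I : finType) (e : I -> R) (x : I -> V) k :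
  (forall i j, i != j -> e i * e j = 0) -> e k * e k = e k ->
  e k *: (\sum_i e i *: x i) = e k *: x k.
Proof.
move=> eo ek; rewrite scaler_sumr (bigD1 k)//= scalerA ek big1 ?addr0// => j jk.
by rewrite scalerA eo ?scale0r// eq_sym.
Qed.

Lemma ext_wedgeZ (R : comPzRingType) (N : lmodType R) (k l m : nat) (h : (k + l)%N = m)
    (a : R) (x : extpow N k) (y : extpow N l) : ext_wedge h (a *: x) y = a *: ext_wedge h x y.
Proof.
have lin := ext_wedge_linearl h y.
have w0 : ext_wedge h 0 y = 0.
  have := lin 1 0 0; rewrite addr0 scale1r => /eqP.
  by rewrite scale1r eq_sym -subr_eq0 addrK => /eqP.
by have := lin a x 0; rewrite addr0 w0 addr0.
Qed.

Theorem proposition5p3 (A : comPzRingType) (n m : nat)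
    (hn : (1 <= n)%N) (hnm : (n <= m)%N)
    (phi : {rmorphism iterL n A -> iterL m A})
    (phi_alg : forall a : A, phi (constL n a) = constL m a)
    (phi_cont : continuousL phi)
    (w : omega n n A) :
  res (ext_wedge (subnKC hnm) (form_map phi w) (ext_pure (dlog_q hnm phi))) =
  ZtoA (sgn_phi hnm phi) * ZtoA (d_phi hnm phi) * res w.
Proof.
rewrite (top_coefE w); move: (top_coef w) => f {w}.
rewrite form_map_vol res_vol ext_wedgeZ ext_wedge_pure res_pure.
pose V := \matrix_i omega1_coord (join_fun (subnKC hnm) (fun i => dform (phi (tvar A i))) (dlog_q hnm phi) i).
rewrite -[jacobian _]/(\det V).
have tV i : phi (tvar A i) * phi (tvarV A i) = 1.
  by rewrite -rmorphM monoLM subrr mulr1 monoL01 rmorph1.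
have [I [e [l [f' [eo es H]]]]] := units_regular tV.
pose M k : 'M[int]_(m, n) := \matrix_(j, i) l k i j 0.
have UpsE k (x : Spec A) : ~ x (e k) -> Upsilon phi x = M k.
  move=> xk; apply/matrixP => j i; rewrite !mxE.
  by rewrite /= (nu_regular eo es (fun k => H k i) xk).
pose q k := complement (pivots hnm (M k)).
have ei k : e k * e k = e k.
  rewrite -[RHS]mulr1 -es mulr_sumr (bigD1 k)//= big1 ?addr0// => j jk.
  by rewrite eo// eq_sym.
have ZE (c : lcfun A int) (z : I -> int) : (forall k (x : Spec A), ~ x (e k) -> c x = z k) ->
    forall k, e k * ZtoA c = e k * (z k)%:~R.
  move=> cz k; rewrite /ZtoA (lc_glue_family (e := e) (w := fun k => (z k)%:~R))//.
  - rewrite mulr_sumr (bigD1 k)//= mulrA ei big1 ?addr0// => j jk.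
    by rewrite mulrA eo ?mul0r// eq_sym.
  - by move=> v a b; rewrite mulrDl.
  - by move=> j x /cz <-.
have dlogqE b : dlog_q hnm phi b = \sum_k (constL m (e k) : iterL m A) *: dlog_t A (q k b).
  apply: (@lc_glue_family A (omega1 m A) (fun (a : A) (v : omega1 m A) => (constL m a : iterL m A) *: v)
    _ I e (fun k => dlog_t A (q k b)) eo es).
  - by move=> v x y; rewrite /= rmorphD scalerDl.
  - by move=> j x xj; rewrite /q -(UpsE j x xj).
have coordE b : omega1_coord (dlog_q hnm phi b) =
    \sum_k constL m (e k) *: (tvarV A (q k b) *: omega1_grad (tvar A (q k b))).
  rewrite dlogqE omega1_coord_sum; apply: eq_bigr => k _.
  by rewrite omega1_coordZ omega1_coordZ omega1_coord_dform.
(* The glued forms dt_q / t_q are sums over all components; multiplication by e_k keeps only the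
   k-th choice of q. *)
have VY k : constL m (e k) *: V = constL m (e k) *: \matrix_i join_fun (subnKC hnm)
    (fun a => omega1_grad (phi (tvar A a))) (fun b => tvarV A (q k b) *: omega1_grad (tvar A (q k b))) i.
  apply/row_matrixP => i; rewrite !linearZ /= !rowK -[i](cast_ordKV (subnKC hnm)).
  case: (fintype.split_ordP (cast_ord (esym (subnKC hnm)) i)) => a ->.
    by rewrite !join_fun_lshift omega1_coord_dform.
  rewrite !join_fun_rshift coordE; apply: scale_orthogonal_sum; last by rewrite -rmorphM ei.
  by move=> i' j' ij; rewrite -rmorphM eo// rmorph0.
suff main k : e k * coefL (phi f * \det V) (const_mx (-1)) =
    e k * (ZtoA (sgn_phi hnm phi) * ZtoA (d_phi hnm phi) * coefL f (const_mx (-1))).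
  by rewrite -[LHS]mul1r -[RHS]mul1r -es !mulr_suml; apply: eq_bigr => k _; exact: main.
(* If e_k = 0, the matrix M k need not be in echelon form, but both sides vanish. *)
have [->|e0] := eqVneq (e k) 0; first by rewrite !mul0r.
have Mpos := component_positive phi_cont (H k) e0.
have [pi pp p0] := pivotsP hnm Mpos.
pose s := (-1) ^+ odd_perm (shuffle hnm (pivots hnm (M k))) : int.
pose d := \prod_i M k (pivots hnm (M k) i) i.
have detE : \det (\matrix_(i, j) join_fun (subnKC hnm) (l k) (fun b => delta_mx (q k b) 0) i j 0) = s * d.
  rewrite /s /d -(echelon_det (shuffleE hnm pi) (M := M k)); last first.
    move=> a b ab; apply: (p0 a); have /forallP/(_ b)/implyP := forallP pi a; exact.
  congr (\det _); apply/matrixP => i j; rewrite !mxE /join_fun.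
  by case: fintype.split => a; rewrite ?mxE.
have -> : e k * (ZtoA (sgn_phi hnm phi) * ZtoA (d_phi hnm phi) * coefL f (const_mx (-1))) =
    e k * ((s * d)%:~R * coefL f (const_mx (-1))).
  rewrite !mulrA (ZE (sgn_phi hnm phi) (fun k => (-1) ^+ odd_perm (shuffle hnm (pivots hnm (M k))))).
    rewrite [e k * _ * ZtoA _]mulrAC (ZE (d_phi hnm phi) (fun k => \prod_i M k (pivots hnm (M k) i) i)).
      by rewrite rmorphM mulrA [_ * d%:~R * _]mulrAC.
    by move=> j x xj; cbv beta; rewrite -(UpsE j x xj).
  by move=> j x xj; cbv beta; rewrite -(UpsE j x xj).
apply/eqP; rewrite -subr_eq0; apply/eqP; move: f.
(* Continuity of the difference in f: mu1 controls multiplication by \det V, mu2 pulls it back along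
   [phi], and mu3 controls the residue on the right. What remains is the case of a monomial. *)
have [mu1 mu1P] := coefL_mul_continuous (\det V) (const_mx (-1)).
have [mu2 mu2P] := phi_cont 0 mu1.
have [mu3 mu3P] := @coefL_continuous A n (const_mx (-1)).
have [mu muP] := Unbhs_meet A mu2 mu3.
apply: (continuous_eq0 (mu := mu)) => [f g|f /muP[f2 f3]|v c].
- by rewrite rmorphD mulrDl !coefLD !mulrDr opprD addrACA.
- rewrite mu3P// !mulr0 subr0 mu1P ?mulr0//.
  by have := mu2P f; rewrite rmorph0 !subr0; apply.
by rewrite (component_residue phi_alg (ei k) (H k) v c (VY k)) detE subrr.
Qed.
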